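(* Let $K$ be a field with $\operatorname{char} K \neq 2$, let $a,b,c \in K^\times$, let $\varepsilon_{ij} \in \{1,-1\}$ for $i\ne j$ in $\{1,2,3\}$, and let $x_1,x_2,x_3$ be independent indeterminates over $K$. Let $G$ be the group of $K$-automorphisms of $K(x_1,x_2,x_3)$ generated by $$\sigma_1: x_1 \mapsto \frac{a}{x_1},\ x_2 \mapsto \varepsilon_{12}x_2,\ x_3 \mapsto \varepsilon_{13}x_3,$$ $$\sigma_2: x_1 \mapsto \varepsilon_{21}x_1,\ x_2 \mapsto \frac{b}{x_2},\ x_3 \mapsto \varepsilon_{23}x_3,$$ $$\sigma_3: x_1 \mapsto \varepsilon_{31}x_1,\ x_2 \mapsto \varepsilon_{32}x_2,\ x_3 \mapsto \frac{c}{x_3}.$$ Call the following four choices of signs exceptional: (i) $\varepsilon_{12}=\varepsilon_{21}=1$ and all other $\varepsilon_{ij}=-1$; or $\varepsilon_{13}=\varepsilon_{31}=1$ and all other $\varepsilon_{ij}=-1$; or $\varepsilon_{23}=\varepsilon_{32}=1$ and all other $\varepsilon_{ij}=-1$; (ii) all $\varepsilon_{ij}=-1$. If the signs are not exceptional, then $K(x_1,x_2,x_3)^G$ is rational over $K$. If the signs are exceptional, then $K(x_1,x_2,x_3)^G$ is rational over $K$ if and only if $[K(\sqrt{a},\sqrt{b},\sqrt{c}):K] \le 4$.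
   Context: Rational over $K$ means purely transcendental over $K$. For a group $H$ of automorphisms of a field $F$, $F^H$ is the fixed subfield. (The group $G$ is isomorphic to $C_2\times C_2\times C_2$.) *)

(* Defs.v *)
From HB Require Import structures.
From mathcomp Require Import all_boot all_order all_algebra all_field ring.
From mathcomp Require Import generic_quotient.
From mathcomp Require Export mpoly.
From Stdlib Require Classical_Prop.

Set Implicit Arguments.
Unset Strict Implicit.
Unset Printing Implicit Defensive.

Import GRing.Theory.
Local Open Scope ring_scope.

Section Extensions.

(* An extension F / K of arbitrary (possibly infinite) degree is an embedding
   [iota]; subfields of F are predicates on F. *)
Variables (K F : fieldType) (iota : {rmorphism K -> F}).

Definition algebraically_independent (S : F -> Prop) : Prop :=
  forall (n : nat) (y : n.-tuple F), uniq y -> (forall i, S (tnth y i)) ->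
  forall p : {mpoly K[n]}, mmap iota (tnth y) p = 0 -> p = 0.

Inductive adjoin (S : F -> Prop) : F -> Prop :=
| adjoin_base k : adjoin S (iota k)
| adjoin_gen f of S f : adjoin S f
| adjoin_add f g of adjoin S f & adjoin S g : adjoin S (f + g)
| adjoin_opp f of adjoin S f : adjoin S (- f)
| adjoin_mul f g of adjoin S f & adjoin S g : adjoin S (f * g)
| adjoin_inv f of adjoin S f : adjoin S f^-1.

Definition purely_transcendental (L : F -> Prop) : Prop :=
  exists2 S : F -> Prop,
    algebraically_independent S & forall f, L f <-> adjoin S f.

Definition is_automorphism_over (s : F -> F) : Prop :=
  bijective s /\ forall k, s (iota k) = iota k.

Inductive automorphism_group (S : (F -> F) -> Prop) : (F -> F) -> Prop :=
| automorphism_group_id : automorphism_group S id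
| automorphism_group_mem s of S s : automorphism_group S s
| automorphism_group_comp s t of automorphism_group S s & automorphism_group S t :
    automorphism_group S (s \o t)
| automorphism_group_inv s t of automorphism_group S s & cancel s t & cancel t s :
    automorphism_group S t.

Definition fixed_field (G : (F -> F) -> Prop) (f : F) : Prop :=
  forall s, G s -> s f = f.

End Extensions.

Section RationalFunctions.

Variable K : fieldType.

Definition ratfun3 : fieldType := {fraction {mpoly K[3]}}.

Definition const3 : {rmorphism K -> ratfun3} :=
  (@FracField.tofrac {mpoly K[3]} \o @mpolyC 3 K).

Definition indet (i : 'I_3) : ratfun3 := FracField.tofrac ('X_i : {mpoly K[3]}).
Definition x1 : ratfun3 := indet (@Ordinal 3 0 isT).
Definition x2 : ratfun3 := indet (@Ordinal 3 1 isT).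
Definition x3 : ratfun3 := indet (@Ordinal 3 2 isT).

Definition exceptional (e12 e13 e21 e23 e31 e32 : K) : Prop :=
  [\/ [/\ e12 = 1, e21 = 1, e13 = -1, e31 = -1 & e23 = -1 /\ e32 = -1],
      [/\ e13 = 1, e31 = 1, e12 = -1, e21 = -1 & e23 = -1 /\ e32 = -1],
      [/\ e23 = 1, e32 = 1, e12 = -1, e21 = -1 & e13 = -1 /\ e31 = -1]
    | [/\ e12 = -1, e21 = -1, e13 = -1, e31 = -1 & e23 = -1 /\ e32 = -1]].

End RationalFunctions.

Arguments x1 {K}.
Arguments x2 {K}.
Arguments x3 {K}.

Local Open Scope quotient_scope.

Section FracExt.
Variables (R : idomainType) (E : fieldType) (phi : {rmorphism R -> E}).
Hypothesis phi_inj : forall p, phi p = 0 -> p = 0.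
Local Notation tf := (@FracField.tofrac R).

Lemma frac_repr (f : {fraction R}) :
  tf \d_(repr f) != 0 /\ f = tf \n_(repr f) / tf \d_(repr f).
Proof.
have dn0 : tf \d_(repr f) != 0 by rewrite tofrac_eq0 denom_ratioP.
split=> //; apply: (mulIf dn0); rewrite divfK //.
rewrite -[in LHS](reprK f); set r := repr f.
unlock FracField.tofrac; rewrite -[LHS]FracField.pi_mul /FracField.mulf.
apply/eqmodP; rewrite /= FracField.equivfE !numden_Ratio ?oner_neq0 ?mulr1 ?denom_ratioP //.
by rewrite reprK mulrC.
Qed.

Definition fext (f : {fraction R}) : E := phi \n_(repr f) / phi \d_(repr f).

Lemma phi_neq0 d : d != 0 -> phi d != 0.
Proof. by apply: contra_neq => /phi_inj. Qed.

Lemma fextE n d : d != 0 -> fext (tf n / tf d) = phi n / phi d.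
Proof.
move=> d0; rewrite /fext; case: (frac_repr (tf n / tf d)).
set n' := \n_ _; set d' := \d_ _ => d'0 e.
have hd' : d' != 0 by rewrite tofrac_eq0 in d'0.
have : n * d' = n' * d.
  apply/eqP; rewrite -tofrac_eq !tofracM; apply/eqP.
  move/(congr1 (fun z => z * (tf d * tf d'))): e.
  have td0 : tf d != 0 by rewrite tofrac_eq0.
  rewrite mulrA divfK // => ->; rewrite [tf d * _]mulrC mulrA divfK //.
move/(congr1 phi); rewrite !rmorphM => e2.
apply/eqP; rewrite eqr_div ?phi_neq0 //; by rewrite e2.
Qed.

Lemma fracP (f : {fraction R}) : exists n d, d != 0 /\ f = tf n / tf d.
Proof.
case: (frac_repr f) => d0 e; exists \n_(repr f), \d_(repr f); split=> //.
by rewrite denom_ratioP.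
Qed.

Lemma fext_add f g : fext (f - g) = fext f - fext g.
Proof.
have [n [d [hd ->]]] := fracP f; have [n' [d' [hd' ->]]] := fracP g.
rewrite -mulNr addf_div ?tofrac_eq0 // -tofracN -!tofracM -tofracD !fextE ?mulf_neq0 //.
by rewrite -mulNr addf_div ?phi_neq0 // rmorphD !rmorphM rmorphN.
Qed.

Lemma fext_mul : monoid_morphism fext.
Proof.
split.
  have := @fextE 1 1 (oner_neq0 _); by rewrite tofrac1 rmorph1 !divr1.
move=> f g.
have [n [d [hd ->]]] := fracP f; have [n' [d' [hd' ->]]] := fracP g.
by rewrite mulf_div -!tofracM !fextE ?mulf_neq0 // !rmorphM -mulf_div.
Qed.

HB.instance Definition _ := GRing.isZmodMorphism.Build _ _ fext fext_add.
HB.instance Definition _ := GRing.isMonoidMorphism.Build _ _ fext fext_mul.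

Lemma frac_ext_exists : exists s : {rmorphism {fraction R} -> E}, forall p, s (tf p) = phi p.
Proof.
exists fext => p.
by have := @fextE p 1 (oner_neq0 _); rewrite tofrac1 rmorph1 !divr1.
Qed.
End FracExt.

Lemma rmor_ext_frac (K : fieldType) (s t : {rmorphism ratfun3 K -> ratfun3 K}) :
  (forall k, s (const3 K k) = t (const3 K k)) ->
  (forall i, s (indet K i) = t (indet K i)) -> s =1 t.
Proof.
move=> hk hx.
have hp (p : {mpoly K[3]}) : s (FracField.tofrac p) = t (FracField.tofrac p).
  elim/mpolyind: p => [|k m p _ _ IH]; first by rewrite !rmorph0.
  rewrite !rmorphD IH -mul_mpolyC !rmorphM; congr (_ * _ + _); first exact: hk.
  rewrite mpolyXE_id !rmorph_prod; apply: eq_bigr => i _.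
  by rewrite !rmorphXn; congr (_ ^+ _); apply: hx.
move=> f; case: (frac_repr f) => d0 ->; by rewrite !fmorph_div !hp.
Qed.

Lemma fext_ring1 (F : fieldType) (x y u v : F) :
  x * y * (u + v) = y * (x * u) + x * (y * v).
Proof. ring. Qed.
Lemma fext_ring2 (F : fieldType) (x y u v : F) :
  y * (x * u) + x * (y * v) = x * y * (u + v).
Proof. ring. Qed.

(* The monomial automorphisms prescribed on the indeterminates do exist, so
   quantifying over ring morphisms with the prescribed values is not vacuous. *)
Lemma sigma_exists (K : fieldType) (i : 'I_3) (a : K) (e : 'I_3 -> K) :
  a != 0 -> (forall j, e j = 1 \/ e j = -1) ->
  exists s : {rmorphism ratfun3 K -> ratfun3 K},
    is_automorphism_over (const3 K) s /\
    forall j, s (indet K j) =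
      if j == i then const3 K a / indet K i else const3 K (e j) * indet K j.
Proof.
move=> a0 he.
pose h j := if j == i then const3 K a / indet K i else const3 K (e j) * indet K j.
pose phi : {rmorphism {mpoly K[3]} -> ratfun3 K} := mmap (const3 K) h.
have x0 j : indet K j != 0.
  rewrite tofrac_eq0; apply/eqP => /(congr1 (fun p => p@_U_(j))).
  by rewrite mcoeffX eqxx mcoeff0 => /eqP; rewrite oner_eq0.
have phiC k : phi k%:MP = const3 K k by rewrite /phi /= mmapC.
have phiX j : phi 'X_j = h j by rewrite /phi /= mmapX mmap1U.
have ca0 : const3 K a != 0 by rewrite fmorph_eq0.
have hi0 : h i != 0 by rewrite /h eqxx; apply: mulf_neq0; [exact: ca0|rewrite invr_eq0; exact: x0].
have ee j : e j * e j = 1 by case: (he j) => ->; rewrite ?mulrNN mulr1.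
pose Q p := exists N q, indet K i ^+ N * phi p = FracField.tofrac q /\
                        phi q = h i ^+ N * FracField.tofrac p.
have QC k : Q k%:MP.
  by exists 0%N, k%:MP; rewrite !expr0 !mul1r phiC.
have QX j : Q 'X_j.
  case: (eqVneq j i) => [->|ji].
    exists 1%N, a%:MP; rewrite !expr1 phiX phiC /h eqxx; split.
      rewrite mulrC; exact: (divfK (x0 i)).
    exact: esym (divfK (x0 i) _).
  exists 0%N, ((e j)%:MP * 'X_j); rewrite !expr0 !mul1r (rmorphM phi) phiX phiC /h (negPf ji).
  split; first by rewrite tofracM.
  by rewrite mulrA -(rmorphM (const3 K)) ee rmorph1 mul1r.
have QM p q : Q p -> Q q -> Q (p * q).
  move=> [N [p' [e1 e2]]] [M [q' [e3 e4]]]; exists (N + M)%N, (p' * q').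
  by rewrite !(rmorphM phi) tofracM exprD mulrACA e1 e3 e2 e4 exprD mulrACA -!tofracM.
have QD p q : Q p -> Q q -> Q (p + q).
  move=> [N [p' [e1 e2]]] [M [q' [e3 e4]]].
  exists (N + M)%N, ('X_i ^+ M * p' + 'X_i ^+ N * q').
  rewrite !(rmorphD phi) !(rmorphM phi) !(rmorphXn phi) !tofracD !tofracM !tofracXn phiX -e1 -e3 e2 e4 !exprD.
  rewrite -[FracField.tofrac 'X_i]/(indet K i).
  by split; [exact: fext_ring1|exact: fext_ring2].
have Qall p : Q p.
  elim/mpolyind: p => [|k m p _ _ IH]; first by rewrite -[0]mpolyC0; apply: QC.
  apply: (QD) => //; rewrite -mul_mpolyC; apply: (QM).
    exact: QC.
  rewrite mpolyXE_id; elim/big_ind: _ => [|p' q|j _].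
  - exact: (QC 1).
  - exact: (QM p' q).
  - elim: (m j) => [|n IHn]; first exact: (QC 1).
    by rewrite exprS; apply: (QM).
have phi_inj p : phi p = 0 -> p = 0.
  move=> pp; case: (Qall p) => N [q []]; rewrite pp mulr0 => /esym/eqP.
  rewrite tofrac_eq0 => /eqP ->; rewrite rmorph0 => /esym/eqP.
  by rewrite mulf_eq0 expf_eq0 (negPf hi0) andbF /= tofrac_eq0 => /eqP.
case: (frac_ext_exists phi_inj) => s hs.
have sx j : s (indet K j) = h j by rewrite -phiX -hs.
have sk k : s (const3 K k) = const3 K k by rewrite -[RHS]phiC -hs.
exists s; split=> //; split=> //.
have ss : cancel s s.
  apply: (@rmor_ext_frac K (s \o s : {rmorphism _ -> _}) (idfun : {rmorphism _ -> _})) => [k|j] /=.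
    by rewrite !sk.
  rewrite sx /h; case: eqP => [->|/eqP ji].
    rewrite fmorph_div sk sx /h eqxx invfM invrK mulrA (divff ca0); exact: mul1r.
  by rewrite (rmorphM s) sk sx /h (negPf ji) mulrA -rmorphM ee rmorph1 mul1r.
by exists s.
Qed.

Lemma sqrt_step (K : fieldType) (L : fieldExtType K) (z : L) :
  exists (L' : fieldExtType K) (f : {rmorphism L -> L'}) (w : L'),
    (forall k : K, f k%:A = k%:A) /\ w ^+ 2 = f z.
Proof.
have [[y yz]|nr] := Classical_Prop.classic (exists y : L, y ^+ 2 = z).
  by exists L, idfun, y.
have sz : size ('X^2 - z%:P) = 3 by rewrite size_XnsubC.
have irr : irreducible_poly ('X^2 - z%:P).
  apply: cubic_irreducible; first by rewrite sz.
  move=> x; apply/negP; rewrite /root !hornerE subr_eq0 => /eqP xz.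
  by apply: nr; exists x.
have [M _ [w rw _]] := irredp_FAdjoin irr.
exists (baseFieldType M), (in_alg M : {rmorphism L -> M}), w; split.
  by move=> k; rewrite baseField_scaleE.
move: rw; rewrite /root rmorphB /= map_polyXn map_polyC !hornerE subr_eq0.
by move/eqP.
Qed.

(* A finite extension containing the three square roots exists over every K;
   the degree of the subfield they generate does not depend on the choice. *)
Lemma sqrt_ext_exists (K : fieldType) (a b c : K) :
  exists (L : fieldExtType K) (ra rb rc : L),
    [/\ ra ^+ 2 = a%:A, rb ^+ 2 = b%:A & rc ^+ 2 = c%:A].
Proof.
have [L1 [f1 [ra [h1 e1]]]] := sqrt_step (a : K^o).
have [L2 [f2 [rb [h2 e2]]]] := sqrt_step (b%:A : L1).
have [L3 [f3 [rc [h3 e3]]]] := sqrt_step (c%:A : L2).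
exists L3, (f3 (f2 ra)), (f3 rb), rc; split.
- have -> : a%:A = f3 (f2 (f1 (a%:A : K^o))) by rewrite h1 h2 h3.
  by rewrite -!rmorphXn e1 /GRing.scale /= mulr1.
- by rewrite -rmorphXn e2 h2 h3.
- by rewrite e3 h3.
Qed.

(* Main.v *)
(** Write (a_1, a_2, a_3) = (a, b, c) and zeta_i = (x_i^2 - a_i) / (x_i^2 + a_i).
    As sigma_j changes the sign of zeta_i exactly when i = j, the fixed field is
    generated by the Z_i = zeta_i^2 and by r_i = 2 a_i / (p_i m_i), where
    p_i = x_i + a_i / x_i and m_i is the product of the zeta_j with
    epsilon_ji = -1; they satisfy a_i (1 - Z_i) = m_i^2 r_i^2.  For
    nonexceptional signs elimination leaves three generators, which are
    algebraically independent by the exchange lemma.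

    For exceptional signs the fixed field is K(S, u, v, w) with
    w^2 = (S + a) (u^2 S + b) (v^2 S + c), with (a c, b c, c) instead of
    (a, b, c) in case (i).  If a nontrivial product of a, b, c is a square in K,
    which means that the degree is at most 4, then a quadric over K(S) has a
    rational point and projecting from it gives three generators.

    Otherwise suppose that the field is rational.  Comparing valuations, S is up
    to a constant and a square a product of norms p^2 - x q^2 with x in
    {a, b, c, a b c}.  Over E = K(u, S) the field is the function field of a
    conic which stays anisotropic over the fields E(sqrt x, sqrt y), so that a
    descent on the degree moves this relation into E.  There it is impossible:
    S has odd degree in S, but p^2 - x q^2 has even degree. *)

Require Import Defs.
From HB Require Import structures.
From mathcomp Require Import all_boot all_order all_fingroup all_algebra all_solvable.
From mathcomp Require Import all_field ring zify.
From Stdlib Require Import Classical_Prop ClassicalEpsilon.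

Set Implicit Arguments.
Unset Strict Implicit.
Unset Printing Implicit Defensive.

Import Order.TTheory GRing.Theory Num.Theory.
Local Open Scope ring_scope.

(** * Squares and norm forms *)

Definition is_square (R : pzRingType) (d : R) : Prop := exists e, e ^+ 2 = d.

Definition norm_form (R : pzRingType) (x p q : R) : R := p ^+ 2 - x * q ^+ 2.

Lemma rmorph_is_square (R S : pzRingType) (f : {rmorphism R -> S}) d :
  is_square d -> is_square (f d).
Proof. by case=> e <-; exists (f e); rewrite rmorphXn. Qed.

Lemma rmorph_norm_form (R S : pzRingType) (f : {rmorphism R -> S}) x p q :
  f (norm_form x p q) = norm_form (f x) (f p) (f q).
Proof. by rewrite /norm_form !(rmorphB, rmorphM, rmorphXn). Qed.

Lemma norm_formM (R : comPzRingType) (x p q p' q' : R) :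
  norm_form x p q * norm_form x p' q' =
  norm_form x (p * p' + x * (q * q')) (p * q' + q * p').
Proof. by rewrite /norm_form; ring. Qed.

Lemma norm_form_scale (R : comPzRingType) (x d p q : R) :
  norm_form x (d * p) (d * q) = d ^+ 2 * norm_form x p q.
Proof. by rewrite /norm_form; ring. Qed.

Section SquaresInFields.
Variable F : fieldType.
Implicit Types a b c d e x p q : F.

Lemma is_squareM_sqr d e : e != 0 -> is_square (d * e ^+ 2) <-> is_square d.
Proof.
move=> e0; split=> -[f fE]; last by exists (f * e); rewrite exprMn fE.
by exists (f / e); rewrite expr_div_n fE mulfK ?expf_neq0.
Qed.

Lemma nonsquare_neq0 d : ~ is_square d -> d != 0.
Proof. by apply: contra_notN => /eqP->; exists 0; rewrite expr0n. Qed.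

Lemma norm_form_anisotropic x p q :
  ~ is_square x -> norm_form x p q = 0 -> p = 0 /\ q = 0.
Proof.
move=> nsq /eqP; rewrite subr_eq0 => /eqP e.
have [q0|q0] := eqVneq q 0.
  by split=> //; apply/eqP; rewrite -sqrf_eq0 e q0 expr0n mulr0.
by case: nsq; apply/(is_squareM_sqr _ q0); exists p.
Qed.

Lemma norm_form_eq0 x p q : ~ is_square x -> (norm_form x p q == 0) = (p == 0) && (q == 0).
Proof.
move=> nsq; apply/eqP/andP => [/(norm_form_anisotropic nsq)[-> ->] //|[/eqP-> /eqP->]].
by rewrite /norm_form !expr0n mulr0 subr0.
Qed.

(* The hypotheses say that (a0 + a1 r)^2 = x (b0 + b1 r)^2 for a square root r of A. *)
Lemma square_ratio_quadratic A x a0 a1 b0 b1 : ~ is_square x -> ~ is_square (A * x) ->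
  a0 * a1 = x * (b0 * b1) -> a0 ^+ 2 + A * a1 ^+ 2 = x * (b0 ^+ 2 + A * b1 ^+ 2) ->
  [/\ a0 = 0, a1 = 0, b0 = 0 & b1 = 0].
Proof.
move=> nx nAx e1 e2; have x0 := nonsquare_neq0 nx.
have A0 : A != 0 by move: (nonsquare_neq0 nAx); rewrite mulf_eq0 => /norP[].
have [a10|a10] := eqVneq a1 0.
  move: e1 e2; rewrite a10 mulr0 expr0n mulr0 addr0 => /esym/eqP.
  rewrite !mulf_eq0 (negPf x0) /= => /orP[]/eqP -> e2.
    have [] := @norm_form_anisotropic (A * x) a0 b1 nAx; first by rewrite /norm_form e2; ring.
    by move=> -> ->.
  have [] := @norm_form_anisotropic x a0 b0 nx; first by rewrite /norm_form e2; ring.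
  by move=> -> ->.
have : norm_form (A * x) (A * a1) b0 * norm_form x a1 b1 = 0.
  transitivity (A * ((x * (b0 * b1)) ^+ 2 + A * a1 ^+ 4 -
    a1 ^+ 2 * (x * (b0 ^+ 2 + A * b1 ^+ 2)))); first by rewrite /norm_form; ring.
  by rewrite -e1 -e2; ring.
move/eqP; rewrite mulf_eq0 !norm_form_eq0 // mulf_eq0 (negPf A0) (negPf a10) //.
Qed.

Definition square_product a b c : Prop :=
  exists i j l : bool, i || j || l /\ is_square (a ^+ i * b ^+ j * c ^+ l).

Lemma square_productC12 a b c : square_product a b c -> square_product b a c.
Proof.
move=> [i [j [l [ijl sq]]]]; exists j, i, l; split; first by rewrite [j || i]orbC.
by rewrite [b ^+ j * _]mulrC.
Qed.

Lemma square_productC23 a b c : square_product a b c -> square_product a c b.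
Proof.
move=> [i [j [l [ijl sq]]]]; exists i, l, j; split; first by rewrite orbAC.
by rewrite mulrAC.
Qed.

Lemma square_product_odd a b c (i j l : nat) : a != 0 -> b != 0 -> c != 0 ->
  odd i || odd j || odd l -> is_square (a ^+ i * b ^+ j * c ^+ l) -> square_product a b c.
Proof.
move=> a0 b0 c0 ijl sq; exists (odd i), (odd j), (odd l); split=> //.
have halve x n : x ^+ n = x ^+ odd n * (x ^+ n./2) ^+ 2.
  by rewrite -exprM muln2 -exprD odd_double_half.
have half_neq0 : a ^+ i./2 * b ^+ j./2 * c ^+ l./2 != 0 by rewrite !mulf_neq0 ?expf_neq0.
apply/(is_squareM_sqr _ half_neq0); move: sq.
by rewrite (halve a i) (halve b j) (halve c l); congr is_square; ring.
Qed.

Lemma square_product_scale a b c : a != 0 -> b != 0 -> c != 0 ->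
  square_product (a * c) (b * c) c <-> square_product a b c.
Proof.
move=> a0 b0 c0; split=> -[i [j [l [ijl sq]]]].
  apply: (@square_product_odd _ _ _ i j (i + j + l)) => //.
    by case: i j l ijl {sq} => [] [] [].
  by move: sq; rewrite !exprMn !exprD; congr is_square; ring.
apply: (@square_product_odd _ _ _ i j (i + j + l)); rewrite ?mulf_neq0 //.
  by case: i j l ijl {sq} => [] [] [].
have ij0 : c ^+ (i + j) != 0 by rewrite expf_neq0.
move/(is_squareM_sqr _ ij0): sq; rewrite !exprMn !exprD.
by congr is_square; ring.
Qed.
End SquaresInFields.

(** * Square roots in finite extensions *)

Section SquareRootAdjunction.
Variables (K : fieldType) (L : fieldExtType K).
Implicit Types (E : {subfield L}) (x y : L).

Lemma mem_adjoin_sqrt E y x : y ^+ 2 \in E -> x \in <<E; y>>%VS ->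
  exists e0 e1, [/\ e0 \in E, e1 \in E & x = e0 + e1 * y].
Proof.
move=> yE /Fadjoin_polyP[p + ->]; elim/poly_ind: p => [|p d IH] pE.
  by exists 0, 0; rewrite horner0 mul0r addr0 rpred0.
have coef_in i : (p * 'X + d%:P)`_i \in E by apply/polyOverP.
have dE : d \in E by have := coef_in 0; rewrite coefD coefMX coefC add0r.
have [|e0 [e1 [e0E e1E e]]] := IH.
  by apply/polyOverP => i; have := coef_in i.+1; rewrite coefD coefMX coefC addr0.
exists (e1 * y ^+ 2 + d), e0; split=> //; first by apply: rpredD => //; apply: rpredM.
by rewrite hornerMXaddC e mulrDl -mulrA -expr2 -addrA addrC.
Qed.

Lemma adjoin_degree_sqrt E y : y ^+ 2 \in E -> adjoin_degree E y = (y \notin E).+1.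
Proof.
move=> yE; have [yinE|ynE] /= := boolP (y \in E); first by apply/eqP; rewrite adjoin_deg_eq1.
apply/eqP; rewrite eqn_leq; apply/andP; split; last first.
  rewrite ltn_neqAle eq_sym adjoin_deg_eq1 ynE.
  by rewrite -(ltn_pmul2r (adim_gt0 E)) mul0n -dim_Fadjoin adim_gt0.
rewrite -ltnS -size_minPoly -(size_XnsubC (y ^+ 2) (ltn0Sn 1)).
apply: dvdp_leq; first by rewrite -size_poly_eq0 size_XnsubC.
apply: minPoly_dvdp; first by rewrite rpredB ?rpredX ?polyOverX // polyOverC.
by rewrite /root !hornerE subrr.
Qed.

Lemma dim_adjoin_sqrt E y : y ^+ 2 \in E -> \dim <<E; y>> = ((y \notin E).+1 * \dim E)%N.
Proof. by move=> yE; rewrite dim_Fadjoin adjoin_degree_sqrt. Qed.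

Hypothesis two_neq0 : (2%:R : K) != 0.

Lemma sqrt_mem_adjoin E y x : y != 0 -> y ^+ 2 \in E -> x ^+ 2 \in E ->
  (x \in <<E; y>>%VS) = (x \in E) || (x * y \in E).
Proof.
move=> y0 yE xE; have two0 : (2%:R : L) != 0.
  by rewrite -(rmorph_nat (in_alg L)) fmorph_eq0.
apply/idP/orP => [/(mem_adjoin_sqrt yE)[e0 [e1 [e0E e1E e]]]|[xinE|xyE]].
- have [e10|e10] := eqVneq e1 0; first by left; rewrite e e10 mul0r addr0.
  have [e00|e00] := eqVneq e0 0.
    by right; rewrite e e00 add0r -mulrA -expr2 rpredM.
  left; suff yinE : y \in E by rewrite e rpredD ?rpredM.
  have -> : y = (x ^+ 2 - e0 ^+ 2 - e1 ^+ 2 * y ^+ 2) / (2%:R * e0 * e1).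
    by rewrite e; field; rewrite e00 e10.
  apply: rpred_div; last by rewrite !rpredM ?rpred_nat.
  by apply: rpredB; [apply: rpredB | apply: rpredM] => //; apply: rpredX.
- exact: subvP (subv_adjoin _ _) _ xinE.
- rewrite -(mulfK y0 x) rpred_div ?memv_adjoin //.
  exact: subvP (subv_adjoin _ _) _ xyE.
Qed.

Lemma scalar_mem E d : in_alg L d \in E.
Proof. by rewrite rpredZ ?rpred1. Qed.

Lemma sqrt_mem1 x d : x ^+ 2 = in_alg L d -> x \in 1%VS <-> is_square d.
Proof.
move=> xd; split=> [/vlineP[k xE]|[e ed]].
  by exists k; apply: (fmorph_inj (in_alg L)); rewrite rmorphXn /= -xE.
have : x ^+ 2 == in_alg L e ^+ 2 by rewrite -rmorphXn ed xd.
by rewrite eqf_sqr => /orP[]/eqP->; rewrite ?rpredN (scalar_mem 1%AS).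
Qed.

Lemma sqrtM x y d e : x ^+ 2 = in_alg L d -> y ^+ 2 = in_alg L e ->
  (x * y) ^+ 2 = in_alg L (d * e).
Proof. by move=> xd ye; rewrite exprMn xd ye -rmorphM. Qed.

Lemma sqrt_neq0 x d : d != 0 -> x ^+ 2 = in_alg L d -> x != 0.
Proof. by move=> d0 xd; rewrite -sqrf_eq0 xd fmorph_eq0. Qed.

Section TwoRoots.
Variables (xi eta : L) (x y : K).
Hypotheses (x0 : x != 0) (y0 : y != 0).
Hypotheses (xiE : xi ^+ 2 = in_alg L x) (etaE : eta ^+ 2 = in_alg L y).

Lemma sqrt_mem_adjoin1 t z : t ^+ 2 = in_alg L z ->
  t \in <<1; xi>>%VS <-> is_square z \/ is_square (z * x).
Proof.
move=> tz; rewrite sqrt_mem_adjoin ?xiE ?tz ?scalar_mem ?(sqrt_neq0 x0) //.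
rewrite -(sqrt_mem1 tz) -(sqrt_mem1 (sqrtM tz xiE)).
exact: iff_sym (rwP orP).
Qed.

Lemma sqrt_mem_adjoin2 t z : t ^+ 2 = in_alg L z ->
  t \in <<<<1; xi>>; eta>>%VS <->
  (is_square z \/ is_square (z * x)) \/ (is_square (z * y) \/ is_square (z * y * x)).
Proof.
move=> tz; rewrite sqrt_mem_adjoin ?etaE ?tz ?scalar_mem ?(sqrt_neq0 y0) //.
rewrite -(sqrt_mem_adjoin1 tz) -(sqrt_mem_adjoin1 (sqrtM tz etaE)).
exact: iff_sym (rwP orP).
Qed.
End TwoRoots.

Lemma dim_adjoin1 (xi : L) (x : K) : ~ is_square x -> xi ^+ 2 = in_alg L x -> \dim <<1; xi>> = 2%N.
Proof.
move=> nx xiE; rewrite dim_adjoin_sqrt ?xiE ?scalar_mem // dimv1.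
by rewrite (introN idP (fun h => nx (proj1 (sqrt_mem1 xiE) h))).
Qed.

Lemma dim_adjoin2 (xi eta : L) (x y : K) : ~ is_square x -> ~ is_square y -> ~ is_square (y * x) ->
  xi ^+ 2 = in_alg L x -> eta ^+ 2 = in_alg L y -> \dim <<<<1; xi>>; eta>> = 4%N.
Proof.
move=> nx ny nyx xiE etaE.
rewrite dim_adjoin_sqrt ?etaE ?scalar_mem // (dim_adjoin1 nx xiE).
by case: (boolP (eta \in _)) => // /(sqrt_mem_adjoin1 (nonsquare_neq0 nx) xiE etaE)[].
Qed.

Lemma dim_adjoin3_le4 a b c (ra rb rc : L) :
  ra ^+ 2 = in_alg L a -> rb ^+ 2 = in_alg L b -> rc ^+ 2 = in_alg L c ->
  (\dim <<1 & [:: ra; rb; rc]>> <= 4)%N <->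
  ra \in 1%VS \/ rb \in <<1; ra>>%VS \/ rc \in <<<<1; ra>>; rb>>%VS.
Proof.
move=> ha hb hc; rewrite !adjoin_cons adjoin_nil agenv_id.
rewrite !dim_adjoin_sqrt ?ha ?hb ?hc ?scalar_mem // dimv1 muln1.
split=> [|[|[]] ->]; [|by do 2!case: (_ \in _)..].
case: (boolP (ra \in _)) => [|_]; first by left.
case: (boolP (rb \in _)) => [|_]; first by right; left.
by case: (boolP (rc \in _)) => [|_] //; right; right.
Qed.

Lemma dim_three_sqrt a b c (ra rb rc : L) : a != 0 -> b != 0 -> c != 0 ->
  ra ^+ 2 = in_alg L a -> rb ^+ 2 = in_alg L b -> rc ^+ 2 = in_alg L c ->
  (\dim <<1 & [:: ra; rb; rc]>> <= 4)%N <-> square_product a b c.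
Proof.
move=> a0 b0 c0 ha hb hc; rewrite (dim_adjoin3_le4 ha hb hc).
rewrite (sqrt_mem1 ha) (sqrt_mem_adjoin1 a0 ha hb) (sqrt_mem_adjoin2 a0 b0 ha hb hc).
split=> [h|[i [j [l [ijl sq]]]]].
  have product (i j l : bool) d : i || j || l -> is_square d ->
      d = a ^+ i * b ^+ j * c ^+ l -> square_product a b c.
    by move=> ijl sq dE; exists i, j, l; rewrite -dE.
  case: h => [sq|[[sq|sq]|[[sq|sq]|[sq|sq]]]].
  - by apply: (product true false false) sq _ => //=; ring.
  - by apply: (product false true false) sq _ => //=; ring.
  - by apply: (product true true false) sq _ => //=; ring.
  - by apply: (product false false true) sq _ => //=; ring.
  - by apply: (product true false true) sq _ => //=; ring.
  - by apply: (product false true true) sq _ => //=; ring.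
  - by apply: (product true true true) sq _ => //=; ring.
have square d : d = a ^+ i * b ^+ j * c ^+ l -> is_square d by move=> ->.
case: i j l ijl square {sq} => [] [] [] //= _ square.
- by do 4!right; apply: square; ring.
- by right; left; right; apply: square; ring.
- by do 2!right; left; right; apply: square; ring.
- by left; apply: square; ring.
- by do 3!right; left; apply: square; ring.
- by right; left; left; apply: square; ring.
- by do 2!right; left; left; apply: square; ring.
Qed.
End SquareRootAdjunction.

(** * Fractions *)

Section Fractions.
Variables (R : comNzRingType) (F : fieldType) (ev : {rmorphism R -> F}).
Implicit Types (f g : F).

Definition fraction_of f : Prop := exists n d, ev d != 0 /\ f = ev n / ev d.

Definition is_fraction_field : Prop := injective ev /\ forall f, fraction_of f.

Lemma fraction_of_eval n : fraction_of (ev n).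
Proof. by exists n, 1; rewrite rmorph1 divr1 oner_neq0. Qed.

Lemma fraction_ofD f g : fraction_of f -> fraction_of g -> fraction_of (f + g).
Proof.
move=> [n [d [d0 ->]]] [n' [d' [d'0 ->]]]; exists (n * d' + n' * d), (d * d').
by rewrite rmorphD !rmorphM mulf_neq0 // addf_div.
Qed.

Lemma fraction_ofN f : fraction_of f -> fraction_of (- f).
Proof. by move=> [n [d [d0 ->]]]; exists (- n), d; rewrite rmorphN mulNr. Qed.

Lemma fraction_ofM f g : fraction_of f -> fraction_of g -> fraction_of (f * g).
Proof.
move=> [n [d [d0 ->]]] [n' [d' [d'0 ->]]]; exists (n * n'), (d * d').
by rewrite !rmorphM mulf_neq0 // mulf_div.
Qed.

Lemma fraction_ofV f : fraction_of f -> fraction_of f^-1.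
Proof.
move=> [n [d [d0 ->]]]; have [n0|n0] := eqVneq (ev n) 0; last by exists d, n; rewrite invf_div.
by rewrite n0 mul0r invr0 -(rmorph0 ev); apply: fraction_of_eval.
Qed.

Lemma common_denominator (s : seq F) : (forall f, f \in s -> fraction_of f) ->
  exists2 d, ev d != 0 & forall f, f \in s -> exists n, f = ev n / ev d.
Proof.
elim: s => [|f s IH] fr; first by exists 1; rewrite ?rmorph1 ?oner_neq0.
have [n [d [d0 fE]]] := fr f (mem_head _ _).
have [|d' d'0 hd'] := IH; first by move=> g gs; apply: fr; rewrite inE gs orbT.
exists (d * d'); first by rewrite rmorphM mulf_neq0.
move=> g; rewrite inE => /predU1P[->|/hd'[n' ->]].
  by exists (n * d'); rewrite fE !rmorphM; field; rewrite d0 d'0.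
by exists (n' * d); rewrite !rmorphM; field; rewrite d0 d'0.
Qed.

Lemma clear_denominators (p : {poly F}) : (forall i, fraction_of p`_i) ->
  exists d P, ev d != 0 /\ map_poly ev P = ev d *: p.
Proof.
elim/poly_ind: p => [|p c IH] fr; first by exists 1, 0; rewrite rmorph1 !rmorph0 scaler0 oner_neq0.
have [|d [P [d0 PE]]] := IH.
  by move=> i; have := fr i.+1; rewrite coefD coefMX coefC addr0.
have [n [d' [d'0 cE]]] : fraction_of c by have := fr 0; rewrite coefD coefMX coefC add0r.
exists (d * d'), (P * d'%:P * 'X + (n * d)%:P); rewrite rmorphM mulf_neq0 //; split=> //.
rewrite rmorphD !rmorphM /= map_polyX !map_polyC /= PE scalerDr -!mul_polyC cE.
congr (_ + _); first by rewrite polyCM; ring.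
by rewrite -!polyCM; congr polyC; field.
Qed.
End Fractions.

Section Evaluation.
Variables (R S : comNzRingType) (phi : {rmorphism R -> S}).

Definition eval_at (t : S) : {rmorphism {poly R} -> S} := horner_eval t \o map_poly phi.

Lemma eval_atC t c : eval_at t c%:P = phi c.
Proof. by rewrite /= /horner_eval map_polyC hornerC. Qed.

Lemma eval_atX t : eval_at t 'X = t.
Proof. by rewrite /= /horner_eval map_polyX hornerX. Qed.

Lemma eval_at_swapXY Q t f :
  (map_poly (eval_at f) (swapXY Q)).[t] = (map_poly (eval_at t) Q).[f].
Proof.
have mapE s (P : {poly {poly R}}) :
    map_poly (eval_at s) P = (swapXY (map_poly (map_poly phi) P)).[s%:P].
  by rewrite horner_swapXY -map_poly_comp.
by rewrite !mapE [in LHS]swapXY_map swapXYK; apply: esym (horner2_swapXY _ _ _).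
Qed.
End Evaluation.

Lemma rmorph_eval_at (R S T : comNzRingType) (phi : {rmorphism R -> S})
    (h : {rmorphism S -> T}) t q :
  h (eval_at phi t q) = eval_at (h \o phi) (h t) q.
Proof. by rewrite /= /horner_eval -horner_map -map_poly_comp. Qed.

Lemma eval_at_map (T R S : comNzRingType) (h : {rmorphism T -> R}) (phi : {rmorphism R -> S}) t q :
  eval_at phi t (map_poly h q) = eval_at (phi \o h) t q.
Proof. by rewrite /= /horner_eval -map_poly_comp. Qed.

Lemma eval_at_uniq (R S : comNzRingType) (g : {rmorphism {poly R} -> S}) q :
  g q = eval_at (g \o polyC) (g 'X) q.
Proof.
elim/poly_ind: q => [|q e IH]; first by rewrite !rmorph0.
by rewrite !rmorphD !rmorphM IH eval_atX eval_atC.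
Qed.

(** * Adjunction and transcendence bases *)

Section Adjunction.
Variables (K F : fieldType) (iota : {rmorphism K -> F}).
Local Notation adj := (adjoin iota).
Implicit Types (A : F -> Prop) (l : seq F) (t f : F).

Lemma adjoin_trans A A' f : (forall g, A g -> adj A' g) -> adj A f -> adj A' f.
Proof.
move=> h; elim=> [k|g Ag|g g' _ h1 _ h2|g _ h1|g g' _ h1 _ h2|g _ h1].
- exact: adjoin_base.
- exact: h.
- exact: adjoin_add.
- exact: adjoin_opp.
- exact: adjoin_mul.
- exact: adjoin_inv.
Qed.

Lemma adjoin_mono A A' f : (forall g, A g -> A' g) -> adj A f -> adj A' f.
Proof. by move=> h; apply: adjoin_trans => g /h; apply: adjoin_gen. Qed.

Lemma adjoin0 A : adj A 0.
Proof. by rewrite -(rmorph0 iota); apply: adjoin_base. Qed.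

Lemma adjoin1 A : adj A 1.
Proof. by rewrite -(rmorph1 iota); apply: adjoin_base. Qed.

Lemma adjoin_sub A f g : adj A f -> adj A g -> adj A (f - g).
Proof. by move=> Af Ag; apply: adjoin_add => //; apply: adjoin_opp. Qed.

Lemma adjoin_div A f g : adj A f -> adj A g -> adj A (f / g).
Proof. by move=> Af Ag; apply: adjoin_mul => //; apply: adjoin_inv. Qed.

Lemma adjoin_exp A f n : adj A f -> adj A (f ^+ n).
Proof.
move=> Af; elim: n => [|n IH]; first by rewrite expr0; apply: adjoin1.
by rewrite exprS; apply: adjoin_mul.
Qed.

Lemma adjoin_nat A n : adj A n%:R.
Proof. by rewrite -(rmorph_nat iota); apply: adjoin_base. Qed.

Lemma adjoin_sum (I : Type) (r : seq I) (P : pred I) (f : I -> F) A :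
  (forall i, P i -> adj A (f i)) -> adj A (\sum_(i <- r | P i) f i).
Proof. by move=> Af; elim/big_ind: _ => //; [apply: adjoin0 | apply: adjoin_add]. Qed.

Lemma adjoin_prod (I : Type) (r : seq I) (P : pred I) (f : I -> F) A :
  (forall i, P i -> adj A (f i)) -> adj A (\prod_(i <- r | P i) f i).
Proof. by move=> Af; elim/big_ind: _ => //; [apply: adjoin1 | apply: adjoin_mul]. Qed.

Lemma adjoin_horner A (p : {poly F}) f : (forall i, adj A p`_i) -> adj A f -> adj A p.[f].
Proof.
move=> Ap Af; rewrite horner_coef; apply: adjoin_sum => i _.
by apply: adjoin_mul => //; apply: adjoin_exp.
Qed.

Lemma adjoin_mmap n (y : 'I_n -> F) A (p : {mpoly K[n]}) :
  (forall i, adj A (y i)) -> adj A (mmap iota y p).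
Proof.
move=> Ay; apply: adjoin_sum => m _; apply: adjoin_mul; first exact: adjoin_base.
by apply: adjoin_prod => i _; apply: adjoin_exp.
Qed.

Lemma adjoin_fraction (R : comNzRingType) (ev : {rmorphism R -> F}) A f :
  (forall k, fraction_of ev (iota k)) -> (forall g, A g -> fraction_of ev g) ->
  adj A f -> fraction_of ev f.
Proof.
move=> base gen; elim=> [//|//|g g' _ h1 _ h2|g _ h1|g g' _ h1 _ h2|g _ h1].
- exact: fraction_ofD.
- exact: fraction_ofN.
- exact: fraction_ofM.
- exact: fraction_ofV.
Qed.

Lemma adjoin_image (k : fieldType) (phi : {rmorphism k -> F}) A f :
  (forall c, exists z, phi z = iota c) -> (forall g, A g -> exists z, phi z = g) ->
  adj A f -> exists z, phi z = f.
Proof.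
move=> base gen Af; suff [n [d [_ ->]]] : fraction_of phi f by exists (n / d); rewrite fmorph_div.
by apply: adjoin_fraction Af => [c|g /gen[z <-]]; [have [z <-] := base c|]; apply: fraction_of_eval.
Qed.

Definition in_adjoin A : pred F :=
  fun f => if excluded_middle_informative (adj A f) then true else false.

Lemma in_adjoinP A f : reflect (adj A f) (f \in in_adjoin A).
Proof. by rewrite /in_adjoin unfold_in; case: excluded_middle_informative => h; constructor. Qed.

Lemma in_adjoin_divring A : divring_closed (in_adjoin A).
Proof.
split; first by apply/in_adjoinP; apply: adjoin1.
  by move=> f g /in_adjoinP Af /in_adjoinP Ag; apply/in_adjoinP; apply: adjoin_sub.
by move=> f g /in_adjoinP Af /in_adjoinP Ag; apply/in_adjoinP; apply: adjoin_div.
Qed.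

HB.instance Definition _ A := GRing.isDivringClosed.Build F (in_adjoin A) (in_adjoin_divring A).

Record subfield_of A := SubfieldOf { subfield_val :> F; _ : subfield_val \in in_adjoin A }.
HB.instance Definition _ A := [isSub for @subfield_val A].
HB.instance Definition _ A := [Choice of subfield_of A by <:].
HB.instance Definition _ A := [SubChoice_isSubIntegralDomain of subfield_of A by <:].
HB.instance Definition _ A := [SubIntegralDomain_isSubField of subfield_of A by <:].

Definition sf_val A : {rmorphism subfield_of A -> F} := val.

Lemma sf_valP A (z : subfield_of A) : adj A (sf_val A z).
Proof. by apply/in_adjoinP; apply: valP. Qed.

Lemma sf_val_exists A f : adj A f -> exists z : subfield_of A, sf_val A z = f.
Proof. by move/in_adjoinP => h; exists (SubfieldOf h). Qed.

Section Lift.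
Variables (R : nzRingType) (h : {rmorphism R -> F}) (A : F -> Prop).

Hypothesis h_in : forall z, adj A (h z).

Definition sf_lift_subdef (z : R) : subfield_of A :=
  SubfieldOf (introT (in_adjoinP A (h z)) (h_in z)).

Fact sf_lift_zmod_morphism : zmod_morphism sf_lift_subdef.
Proof. by move=> y z; apply: val_inj; rewrite /= rmorphB. Qed.

Fact sf_lift_monoid_morphism : monoid_morphism sf_lift_subdef.
Proof. by split=> [|y z]; apply: val_inj; rewrite /= ?rmorph1 ?rmorphM. Qed.

HB.instance Definition _ := GRing.isZmodMorphism.Build _ _ sf_lift_subdef sf_lift_zmod_morphism.
HB.instance Definition _ := GRing.isMonoidMorphism.Build _ _
  sf_lift_subdef sf_lift_monoid_morphism.

Definition sf_lift : {rmorphism R -> subfield_of A} := sf_lift_subdef.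

Lemma sf_liftK z : sf_val A (sf_lift z) = h z.
Proof. by []. Qed.
End Lift.

Lemma lift_poly (k : fieldType) (phi : {rmorphism k -> F}) (p : {poly F}) :
  (forall i, exists z, phi z = p`_i) -> exists q, map_poly phi q = p.
Proof.
elim/poly_ind: p => [|p c IH] im; first by exists 0; rewrite rmorph0.
have [|q qE] := IH; first by move=> i; have := im i.+1; rewrite coefD coefMX coefC addr0.
have [z zE] : exists z, phi z = c by have := im 0; rewrite coefD coefMX coefC add0r.
by exists (q * 'X + z%:P); rewrite rmorphD rmorphM /= map_polyX map_polyC /= zE qE.
Qed.

Definition alg_over A f : Prop := algebraicOver (sf_val A) f.

Lemma alg_overP A (p : {poly F}) f : p != 0 -> (forall i, adj A p`_i) -> root p f ->
  alg_over A f.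
Proof.
move=> p0 Ap rp; have [q qE] := lift_poly (fun i => sf_val_exists (Ap i)).
by exists q; rewrite ?qE // -(map_poly_eq0 (sf_val A)) qE.
Qed.

Lemma adjoin_alg_over A f : adj A f -> alg_over A f.
Proof. by move=> /sf_val_exists[z <-]; apply: algebraic_id. Qed.

Lemma alg_over_closed A f : adj (alg_over A) f -> alg_over A f.
Proof.
elim=> [k|g //|g g' _ h1 _ h2|g _ h1|g g' _ h1 _ h2|g _ h1].
- by apply: adjoin_alg_over; apply: adjoin_base.
- exact: algebraic_add.
- exact: algebraic_opp.
- exact: algebraic_mul.
- exact: algebraic_inv.
Qed.

Lemma alg_over_trans A A' f : (forall g, A g -> alg_over A' g) -> alg_over A f -> alg_over A' f.
Proof.
move=> h [p p0 rp]; apply/integral_algebraic.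
apply: (@integral_root _ _ _ (map_poly (sf_val A) p)) => //; first by rewrite map_poly_eq0.
move=> c /(nthP 0)[i _ <-]; apply/integral_algebraic.
rewrite -/(polyseq _) coef_map; apply: alg_over_closed.
exact: adjoin_mono h (sf_valP _).
Qed.

Lemma alg_over_mono A A' f : (forall g, A g -> A' g) -> alg_over A f -> alg_over A' f.
Proof.
by move=> h; apply: alg_over_trans => g /h A'g; apply: adjoin_alg_over; apply: adjoin_gen.
Qed.

Lemma alg_over_sqrt A f : alg_over A (f ^+ 2) -> alg_over A f.
Proof.
move=> h; apply: (@alg_over_trans (eq (f ^+ 2))); first by move=> g <-.
apply: (@alg_overP _ ('X^2 - (f ^+ 2)%:P)) => [||].
- by rewrite -size_poly_eq0 size_XnsubC.
- move=> i; rewrite coefB coefXn coefC; apply: adjoin_sub; first exact: adjoin_nat.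
  by case: ifP => _; [apply: adjoin_gen | apply: adjoin0].
- by rewrite /root !hornerE subrr.
Qed.

Lemma adjoin_alg_over_sqrt A f : adj (alg_over A) (f ^+ 2) -> adj (alg_over A) f.
Proof. by move=> /alg_over_closed/alg_over_sqrt; apply: adjoin_gen. Qed.

Lemma transcendental_eval (R : comNzRingType) (phi : {rmorphism R -> F}) A t :
  injective phi -> (forall z, adj A (phi z)) -> ~ alg_over A t -> injective (eval_at phi t).
Proof.
move=> inj im nt; apply: raddf_inj => p e; apply: NNPP => /eqP p0; apply: nt.
apply: (@alg_overP _ (map_poly phi p)); last exact/eqP.
  by apply: contra_neq p0 => h; apply: (map_inj_poly inj (rmorph0 phi)); rewrite h rmorph0.
by move=> i; rewrite coef_map; apply: im.
Qed.

Lemma eval_at_inj_transcendental A (k : fieldType) (phi : {rmorphism k -> F}) t :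
  (forall f, adj A f -> exists z, phi z = f) -> injective (eval_at phi t) -> ~ alg_over A t.
Proof.
move=> im inj [p p0 /eqP rp]; case/negP: p0; rewrite -(map_poly_eq0 (sf_val A)).
have [|q qE] := @lift_poly _ phi (map_poly (sf_val A) p).
  by move=> i; rewrite coef_map; apply: im; apply: sf_valP.
have q0 : q = 0 by apply: inj; rewrite rmorph0 -[LHS]/((map_poly phi q).[t]) qE.
by rewrite -qE q0 rmorph0.
Qed.

Definition with_list A l f : Prop := A f \/ f \in l.

Lemma adjoin_with_fraction A t f :
  adj (with_list A [:: t]) f -> fraction_of (eval_at (sf_val A) t) f.
Proof.
have sub g : adj A g -> fraction_of (eval_at (sf_val A) t) g.
  by move=> /sf_val_exists[z <-]; rewrite -(eval_atC _ t); apply: fraction_of_eval.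
apply: adjoin_fraction => [k|g [Ag|]]; first by apply: sub; apply: adjoin_base.
  by apply: sub; apply: adjoin_gen.
rewrite inE => /eqP->; rewrite -[X in fraction_of _ X](eval_atX (sf_val A) t).
exact: fraction_of_eval.
Qed.

(* A polynomial over K(A, t) that vanishes at f becomes, after clearing denominators, a polynomial
   over K(A) that vanishes at (t, f); it is then read as a polynomial in t. *)
Lemma alg_over_exchange A t f : alg_over (with_list A [:: t]) f -> ~ alg_over A f ->
  alg_over (with_list A [:: f]) t.
Proof.
case=> p p0 rp nf.
have [i|d [Q [d0 QE]]] := @clear_denominators _ _ (eval_at (sf_val A) t) (map_poly (sf_val _) p).
  by rewrite coef_map; apply/adjoin_with_fraction/sf_valP.
apply: (@alg_overP _ (map_poly (eval_at (sf_val A) f) (swapXY Q))).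
- have Q0 : Q != 0.
    apply: contra_neq p0 => Q0; apply/eqP; rewrite -(map_poly_eq0 (sf_val _)).
    by have /eqP := QE; rewrite Q0 rmorph0 eq_sym scaler_eq0 (negPf d0).
  have inj := transcendental_eval (fmorph_inj (sf_val A)) (@sf_valP A) nf.
  by rewrite map_poly_eq0_id0 ?swapXY_eq0 // raddf_eq0 // lead_coef_eq0 swapXY_eq0.
- move=> i; rewrite coef_map; apply: adjoin_horner => [j|].
    by rewrite coef_map; apply: adjoin_mono (sf_valP _) => g Ag; left.
  by apply: adjoin_gen; right; rewrite inE.
- by rewrite /root eval_at_swapXY QE hornerZ (eqP rp) mulr0.
Qed.

Fixpoint indep_over A l : Prop :=
  if l is t :: l' then ~ alg_over A t /\ indep_over (with_list A [:: t]) l' else True.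

Lemma with_list_cat A l1 l2 f : with_list (with_list A l1) l2 f <-> with_list A (l1 ++ l2) f.
Proof.
rewrite /with_list mem_cat; split; first by move=> [[|->]|->]; rewrite ?orbT; auto.
by move=> [|/orP[]]; auto.
Qed.

Lemma alg_over_eq A A' f : (forall g, A g <-> A' g) -> alg_over A f <-> alg_over A' f.
Proof. by move=> h; split; apply: alg_over_mono => g /h. Qed.

Lemma indep_over_eq A A' l : (forall g, A g <-> A' g) -> indep_over A l -> indep_over A' l.
Proof.
elim: l A A' => //= t l IH A A' h [nt il]; split; first by move/(alg_over_eq _ h).
by apply: IH il => g; rewrite /with_list h.
Qed.

Lemma indep_over_cat A l1 l2 :
  indep_over A (l1 ++ l2) <-> indep_over A l1 /\ indep_over (with_list A l1) l2.
Proof.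
elim: l1 A => [|t l IH] A /=.
  split=> [h|[_ h]]; last first.
    by apply: indep_over_eq h => g; rewrite /with_list in_nil; split; [case|left].
  by split=> //; apply: indep_over_eq h => g; rewrite /with_list in_nil; split; [left|case].
split=> [[nt /IH[il il2]]|[[nt il] il2]]; split=> //.
  by apply: indep_over_eq il2 => g; apply: (with_list_cat A [:: t] l).
apply/IH; split=> //; apply: indep_over_eq il2 => g.
by split=> h; apply/(with_list_cat A [:: t] l).
Qed.

Lemma indep_over_rcons A l t :
  indep_over A (rcons l t) <-> indep_over A l /\ ~ alg_over (with_list A l) t.
Proof. by rewrite -cats1 indep_over_cat /=; split=> [[? []]|[]]. Qed.

Lemma dependence_split A l : ~ indep_over A l ->
  exists l1 y l2, [/\ l = l1 ++ y :: l2, indep_over A l1 & alg_over (with_list A l1) y].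
Proof.
elim/last_ind: l => [|l y IH] dep; first by case: dep.
have [il|/IH[l1 [z [l2 [-> il1 az]]]]] := classic (indep_over A l); last first.
  by exists l1, z, (rcons l2 y); rewrite rcons_cat rcons_cons.
exists l, y, [::]; rewrite cats1; split=> //; apply: NNPP => ny; apply: dep.
exact/indep_over_rcons.
Qed.

Lemma indep_over_size_le xs : forall A ys, indep_over A xs ->
  (forall f, f \in xs -> alg_over (with_list A ys) f) -> (size xs <= size ys)%N.
Proof.
elim: xs => // x xs IH A ys /= [nx ix] hx.
have [l [y [r [yE nl al]]]] : exists l y r,
    [/\ ys = l ++ y :: r, ~ alg_over (with_list A l) x & alg_over (with_list A (l ++ [:: y])) x].
  elim/last_ind: ys {hx} (hx x (mem_head _ _)) => [|ys y IHy] ax.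
    by case: nx; apply: alg_over_mono ax => g [|].
  have [/IHy[l [z [r [-> h1 h2]]]]|h] := classic (alg_over (with_list A ys) x).
    by exists l, z, (rcons r y); rewrite rcons_cat rcons_cons.
  by exists ys, y, [::]; rewrite cats1.
have ay : alg_over (with_list (with_list A [:: x]) (l ++ r)) y.
  have ax : alg_over (with_list (with_list A l) [:: y]) x.
    exact/(alg_over_eq _ (with_list_cat A l [:: y])).
  apply: alg_over_mono (alg_over_exchange ax nl) => g; rewrite /with_list mem_cat.
  by case=> [[?|->]|?]; [left; left | right | left; right].
move: hx; rewrite yE size_cat /= addnS ltnS -size_cat => hx.
apply: (IH _ _ ix) => f fx; apply: alg_over_trans (hx f _); last by rewrite inE fx orbT.
move=> g [Ag|]; first by apply: adjoin_alg_over; apply: adjoin_gen; left; left.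
rewrite mem_cat inE => /or3P[gl|/eqP-> //|gr]; apply: adjoin_alg_over; apply: adjoin_gen; right;
  by rewrite mem_cat ?gl ?gr ?orbT.
Qed.

Lemma indep_over_exchange A xs ys : indep_over A xs -> (size ys <= size xs)%N ->
  (forall f, f \in xs -> alg_over (with_list A ys) f) -> indep_over A ys.
Proof.
move=> ix sy hx; apply: NNPP => /dependence_split[l [y [r [yE _ ay]]]].
suff h f : f \in xs -> alg_over (with_list A (l ++ r)) f.
  by have := indep_over_size_le ix h; move: sy; rewrite yE !size_cat /=; lia.
move=> /hx; rewrite yE; apply: alg_over_trans => g.
rewrite /with_list mem_cat inE => -[Ag|/or3P[gl|/eqP->|gr]].
- by apply: adjoin_alg_over; apply: adjoin_gen; left.
- by apply: adjoin_alg_over; apply: adjoin_gen; right; rewrite mem_cat gl.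
- by apply: alg_over_mono ay => h [|hl]; [left | right; rewrite mem_cat hl].
- by apply: adjoin_alg_over; apply: adjoin_gen; right; rewrite mem_cat gr orbT.
Qed.

Definition in_list l f : Prop := f \in l.
Definition no_element f : Prop := False.
Local Notation indep := (indep_over no_element).

Lemma adjoin_no_generator A f : (forall g, ~ A g) -> adj A f -> exists z, iota z = f.
Proof. by move=> noA; apply: adjoin_image => [z|g /noA//]; exists z. Qed.

Lemma adjoin_in_list_sub l l' f : {subset l <= l'} -> adj (in_list l) f -> adj (in_list l') f.
Proof. by move=> sub; apply: adjoin_mono. Qed.

Lemma adjoin_finite A f : adj A f -> exists2 l, forall g, g \in l -> A g & adj (in_list l) f.
Proof.
have both g g' l l' : (forall h, h \in l -> A h) -> (forall h, h \in l' -> A h) ->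
    adj (in_list l) g -> adj (in_list l') g' ->
    exists2 m, forall h, h \in m -> A h & adj (in_list m) g /\ adj (in_list m) g'.
  move=> lA l'A lg lg'; exists (l ++ l').
    by move=> h; rewrite mem_cat => /orP[/lA|/l'A].
  by split; [apply: adjoin_in_list_sub lg | apply: adjoin_in_list_sub lg'] => h hl;
    rewrite mem_cat hl ?orbT.
elim=> [z|g Ag|g g' _ [l lA lg] _ [l' l'A lg']|g _ [l lA lg]
      |g g' _ [l lA lg] _ [l' l'A lg']|g _ [l lA lg]].
- by exists [::] => //; apply: adjoin_base.
- by exists [:: g]; [move=> h; rewrite inE => /eqP-> | apply: adjoin_gen; apply: mem_head].
- by have [m mA []] := both _ _ _ _ lA l'A lg lg'; exists m => //; apply: adjoin_add.
- by exists l => //; apply: adjoin_opp.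
- by have [m mA []] := both _ _ _ _ lA l'A lg lg'; exists m => //; apply: adjoin_mul.
- by exists l => //; apply: adjoin_inv.
Qed.

Lemma adjoin_finite_seq A (s : seq F) : (forall f, f \in s -> adj A f) ->
  exists l, [/\ uniq l, forall g, g \in l -> A g & forall f, f \in s -> adj (in_list l) f].
Proof.
elim: s => [|f s IH] sA; first by exists [::].
have [g gs|l [ul lA ls]] := IH; first by apply: sA; rewrite inE gs orbT.
have [l' l'A l'f] := adjoin_finite (sA f (mem_head _ _)).
exists (undup (l ++ l')); rewrite undup_uniq; split=> // g.
  by rewrite mem_undup mem_cat => /orP[/lA|/l'A].
by rewrite inE => /orP[/eqP->|/ls lg];
  [apply: adjoin_in_list_sub l'f | apply: adjoin_in_list_sub lg];
  move=> h hl; rewrite mem_undup mem_cat hl ?orbT.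
Qed.

Lemma with_no_element l f : with_list no_element l f <-> in_list l f.
Proof. by split; [case|right]. Qed.

Lemma indep_rcons l t : indep (rcons l t) <-> indep l /\ ~ alg_over (in_list l) t.
Proof. by rewrite indep_over_rcons (alg_over_eq _ (with_no_element l)). Qed.

Lemma indep_exchange l l' : indep l -> (size l' <= size l)%N ->
  (forall f, f \in l -> alg_over (in_list l') f) -> indep l'.
Proof.
move=> il hs h; apply: (indep_over_exchange il hs) => f /h.
by apply: alg_over_mono => g; right.
Qed.

Lemma indep_size_le l l' : indep l ->
  (forall f, f \in l -> alg_over (in_list l') f) -> (size l <= size l')%N.
Proof.
by move=> il h; apply: (indep_over_size_le il) => f /h; apply: alg_over_mono => g; right.
Qed.

Lemma indep_mem l t : indep l -> t \in l -> ~ alg_over no_element t.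
Proof.
move=> il tl at0; have := @indep_size_le l (rem t l) il; rewrite size_rem // => h.
suff : (size l <= (size l).-1)%N by case: (l) tl => //= x r _; rewrite ltnn.
apply: h => f fl; have [->|ft] := eqVneq f t; first by apply: alg_over_mono at0.
by apply: adjoin_alg_over; apply: adjoin_gen; rewrite /in_list; move: fl;
  rewrite (perm_mem (perm_to_rem tl)) inE (negPf ft).
Qed.

(** * Multivariate polynomials in a sequence of generators *)

Lemma mpoly_morph_ext n (R : comNzRingType) (f g : {rmorphism {mpoly K[n]} -> R}) :
  (forall c, f c%:MP = g c%:MP) -> (forall i, f 'X_i = g 'X_i) -> f =1 g.
Proof.
move=> hc hx p; elim/mpolyind: p => [|c m p _ _ IH]; first by rewrite !rmorph0.
rewrite !rmorphD IH -mul_mpolyC !rmorphM hc; congr (_ * _ + _).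
by rewrite mpolyXE_id !rmorph_prod; apply: eq_bigr => i _; rewrite !rmorphXn hx.
Qed.

Lemma lift_max_val n (i : 'I_n) : lift ord_max i = i :> nat.
Proof. by rewrite /= /bump leqNgt ltn_ord. Qed.

Lemma muniX_lift n (i : 'I_n) : muni ('X_(lift ord_max i) : {mpoly K[n.+1]}) = ('X_i)%:P.
Proof.
rewrite /muni mmapX mmap1U; case: splitP => [m hm|m hm].
  by congr ('X_ _)%:P; apply: val_inj; rewrite -[RHS]lift_max_val.
by have := ltn_ord i; rewrite -(lift_max_val i) (hm : nat_of_ord (lift ord_max i) = _)
  (ord1 m) addn0 ltnn.
Qed.

Lemma muniX_max n : muni ('X_ord_max : {mpoly K[n.+1]}) = 'X.
Proof.
rewrite /muni mmapX mmap1U; case: splitP => [m /= h|//].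
by have := ltn_ord m; rewrite -h ltnn.
Qed.

Lemma muni_bijective n : bijective (@muni n K).
Proof.
have [h [hC hX]] : exists h : {rmorphism {poly {mpoly K[n]}} -> {mpoly K[n.+1]}},
    (forall q, h q%:P = mwiden q) /\ h 'X = 'X_ord_max.
  by exists (eval_at (@mwiden n K) 'X_ord_max); split=> [q|]; rewrite ?eval_atC ?eval_atX.
have wX (i : 'I_n) : mwiden ('X_i : {mpoly K[n]}) = 'X_(lift ord_max i).
  by rewrite mwidenX mnmwiden1; congr 'X_ _; apply: val_inj; apply: esym (lift_max_val i).
have wK : @muni n K \o @mwiden n K =1 polyC.
  apply: (@mpoly_morph_ext _ _ (@muni n K \o @mwiden n K) (@polyC {mpoly K[n]})) => [c|i] /=.
    by rewrite mwidenC muniC.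
  by rewrite wX muniX_lift.
exists h => [|q].
  apply: (@mpoly_morph_ext _ _ (h \o @muni n K) idfun) => [c|i] /=.
    by rewrite muniC hC mwidenC.
  by case: (unliftP ord_max i) => [m ->|->]; rewrite ?muniX_lift ?hC ?wX // muniX_max hX.
elim/poly_ind: q => [|q c IH]; first by rewrite !rmorph0.
by rewrite (rmorphD h) (rmorphM h) hX hC muniD muniM IH muniX_max; congr (_ + _); apply: wK.
Qed.

Lemma mmap_muni n (y : n.-tuple F) t (p : {mpoly K[n.+1]}) :
  mmap iota (tnth [tuple of rcons y t]) p = eval_at (mmap iota (tnth y)) t (muni p).
Proof.
apply: (@mpoly_morph_ext _ _ (mmap iota (tnth [tuple of rcons y t]))
         (eval_at (mmap iota (tnth y)) t \o @muni n K)) => [c|i].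
  rewrite -[RHS]/(eval_at _ t (muni _)) muniC eval_atC.
  by rewrite -[LHS]/(mmap _ _ _) -[RHS]/(mmap _ _ _) !mmapC.
rewrite -[LHS]/(mmap _ _ _) mmapX mmap1U -[RHS]/(eval_at _ t (muni _)) (tnth_nth 0).
rewrite -[tval _]/(rcons y t) nth_rcons size_tuple.
case: (unliftP ord_max i) => [m ->|->]; last by rewrite muniX_max ltnn eqxx eval_atX.
rewrite muniX_lift eval_atC lift_max_val ltn_ord -tnth_nth.
by rewrite -[RHS]/(mmap _ _ _) mmapX mmap1U.
Qed.

Lemma indep_mmap_inj n (y : n.-tuple F) : indep y -> injective (mmap iota (tnth y)).
Proof.
elim: n y => [|n IH] y iy; apply: raddf_inj => p; rewrite -[X in X = _ -> _]/(mmap iota (tnth y) p).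
  have -> : p = (p@_0)%:MP.
    apply/mpolyP => m; rewrite mcoeffC; have -> : m = 0%MM by apply/mnmP => -[].
    by rewrite eqxx mulr1.
  by rewrite mmapC => /eqP; rewrite fmorph_eq0 => /eqP ->; rewrite mpolyC0.
have [y' [t yE]] : exists (y' : n.-tuple F) t, y = [tuple of rcons y' t].
  case/tupleP: y {iy} => a y0; exists [tuple of belast a y0], (last a y0).
  by apply: val_inj; apply: lastI.
move: iy; rewrite yE => /indep_rcons[iy' nt]; rewrite mmap_muni => e.
apply: (bij_inj (muni_bijective n)); rewrite muni0.
apply: (transcendental_eval (IH _ iy') _ nt); last by rewrite e rmorph0.
by move=> q; apply: adjoin_mmap => i; apply: adjoin_gen; apply: mem_tnth.
Qed.

Lemma algebraically_independent_indep S l : algebraically_independent iota S -> uniq l ->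
  (forall f, f \in l -> S f) -> indep l.
Proof.
move=> iS; elim/last_ind: l => // l t IH ult lS.
have [tl ul] : t \notin l /\ uniq l by apply/andP; rewrite -rcons_uniq.
apply/indep_rcons; split; first by apply: IH => // f fl; apply: lS; rewrite mem_rcons inE fl orbT.
case=> p p0 rp; pose ev : {rmorphism {mpoly K[size l]} -> F} := mmap iota (tnth (in_tuple l)).
have [i|d [Q [d0 QE]]] := @clear_denominators _ _ ev (map_poly (sf_val _) p).
  rewrite coef_map; apply: adjoin_fraction (sf_valP _) => [k|g /(@tnthP _ _ (in_tuple l))[j ->]].
    have <- : ev k%:MP = iota k by rewrite -[LHS]/(mmap _ _ _) mmapC.
    exact: fraction_of_eval.
  have <- : ev 'X_j = tnth (in_tuple l) j by rewrite -[LHS]/(mmap _ _ _) mmapX mmap1U.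
  exact: fraction_of_eval.
have [m _ mK] := muni_bijective (size l).
have Q0 : Q = 0.
  suff mQ0 : m Q = 0 by rewrite -(mK Q) mQ0 muni0.
  apply: (iS _ [tuple of rcons (in_tuple l) t]) => // [i|]; first by apply: lS; apply: mem_tnth.
  by rewrite mmap_muni mK -[LHS]/(map_poly ev Q).[t] QE hornerZ (eqP rp) mulr0.
case/negP: p0; rewrite -(map_poly_eq0 (sf_val _)).
by have /eqP := QE; rewrite Q0 rmorph0 eq_sym scaler_eq0 (negPf d0).
Qed.

Lemma purely_transcendental_generators xs ys (L : F -> Prop) : indep xs ->
  (size ys <= size xs)%N -> (forall f, f \in xs -> alg_over (in_list ys) f) ->
  (forall f, L f <-> adj (in_list ys) f) -> purely_transcendental iota L.
Proof.
move=> ix sy hx hL; exists (in_list ys) => // n y uy hy.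
pose zs := y ++ [seq z <- undup ys | z \notin y].
have mem_zs z : (z \in zs) = (z \in ys).
  rewrite mem_cat mem_filter mem_undup; case: (boolP (z \in y)) => //= /tnthP[i ->].
  by rewrite [RHS]hy.
have sz : (size zs <= size ys)%N.
  rewrite uniq_leq_size //; last by move=> z; rewrite mem_zs.
  rewrite cat_uniq uy filter_uniq ?undup_uniq // andbT /=.
  by apply/hasPn => z; rewrite mem_filter => /andP[].
have /indep_over_cat[iy _] : indep zs.
  apply: indep_exchange ix (leq_trans sz sy) _ => f /hx.
  by apply: alg_over_mono => g gy; rewrite /in_list mem_zs.
by move=> p; rewrite -(rmorph0 (mmap iota (tnth y))) => /(indep_mmap_inj iy).
Qed.

Lemma purely_transcendental_eq (L L' : F -> Prop) : (forall f, L f <-> L' f) ->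
  purely_transcendental iota L <-> purely_transcendental iota L'.
Proof. by move=> h; split=> -[A hA hL]; exists A => // f; rewrite -hL h. Qed.
End Adjunction.

(** * The coordinate ring of a conic *)

Lemma coefM_top (R : nzRingType) (p q : {poly R}) n m :
  (size p <= n.+1)%N -> (size q <= m.+1)%N -> (p * q)`_(n + m) = p`_n * q`_m.
Proof.
move=> sp sq; rewrite coefM.
have nlt : (n < (n + m).+1)%N by lia.
rewrite (bigD1 (Ordinal nlt)) //= big1 ?addr0; first by rewrite addKn.
move=> i /eqP ni; have {}ni : nat_of_ord i != n by apply/eqP => h; apply: ni; apply: val_inj.
case: (ltnP i n) => hi; last first.
  by rewrite [p`_i]nth_default ?mul0r // (leq_trans sp) // ltn_neqAle eq_sym ni.
rewrite [q`__]nth_default ?mulr0 // (leq_trans sq) //.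
by move: hi; move: (nat_of_ord i) => t; lia.
Qed.

(* The pair (p, q) stands for p(v) + q(v) w, where w ^ 2 = A v ^ 2 + C. *)
Definition conic_ring (E : fieldType) (A C : E) : Type := ({poly E} * {poly E})%type.

Section ConicRing.
Variables (E : fieldType) (A C : E).
Local Notation B := (conic_ring A C).
Implicit Types (b z : B) (p q : {poly E}).

HB.instance Definition _ := GRing.Zmodule.copy B ({poly E} * {poly E})%type.

Definition conic_poly : {poly E} := A *: 'X^2 + C%:P.

Arguments conic_poly : simpl never.

Definition conic_mul b z : B := (b.1 * z.1 + conic_poly * (b.2 * z.2), b.1 * z.2 + b.2 * z.1).

Lemma conic_mulA : associative conic_mul.
Proof. by move=> b y z; rewrite /conic_mul /=; congr (_, _); ring. Qed.

Lemma conic_mulC : commutative conic_mul.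
Proof. by move=> b z; rewrite /conic_mul; congr (_, _); ring. Qed.

Lemma conic_mul1 : left_id (1, 0) conic_mul.
Proof. by case=> p q; rewrite /conic_mul /=; congr (_, _); ring. Qed.

Lemma conic_mulD : left_distributive conic_mul +%R.
Proof. by move=> b y z; rewrite /conic_mul /=; congr (_, _); rewrite /=; ring. Qed.

Lemma conic_one_neq0 : (1, 0) != 0 :> B.
Proof. by rewrite xpair_eqE oner_eq0. Qed.

HB.instance Definition _ := GRing.Zmodule_isComNzRing.Build B
  conic_mulA conic_mulC conic_mul1 conic_mulD conic_one_neq0.

Definition conic_of_poly_subdef p : B := (p, 0).

Fact conic_of_poly_zmod_morphism : zmod_morphism conic_of_poly_subdef.
Proof. by move=> p q; congr (_, _); rewrite /= subr0. Qed.

Fact conic_of_poly_monoid_morphism : monoid_morphism conic_of_poly_subdef.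
Proof. by split=> // p q; congr (_, _); rewrite /=; ring. Qed.

HB.instance Definition _ :=
  GRing.isZmodMorphism.Build {poly E} B conic_of_poly_subdef conic_of_poly_zmod_morphism.
HB.instance Definition _ :=
  GRing.isMonoidMorphism.Build {poly E} B conic_of_poly_subdef conic_of_poly_monoid_morphism.

Definition conic_of_poly : {rmorphism {poly E} -> B} := conic_of_poly_subdef.

Definition conic_cst : {rmorphism E -> B} := conic_of_poly \o polyC.

Lemma conic_of_polyM p b : conic_of_poly p * b = (p * b.1, p * b.2).
Proof. by congr (_, _); rewrite /=; ring. Qed.

Lemma conic_of_poly_lreg p : p != 0 -> GRing.lreg (conic_of_poly p).
Proof.
move=> p0 [b1 b2] [z1 z2]; rewrite !conic_of_polyM /= => -[/(mulfI p0) -> /(mulfI p0) ->] //.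
Qed.

Definition conic_conj b : B := (b.1, - b.2).
Definition conic_norm b : {poly E} := norm_form conic_poly b.1 b.2.

Lemma mul_conic_conj b : b * conic_conj b = conic_of_poly (conic_norm b).
Proof. by congr (_, _); rewrite /conic_norm /norm_form /=; ring. Qed.

Lemma conic_normM b z : conic_norm (b * z) = conic_norm b * conic_norm z.
Proof. by rewrite /conic_norm /norm_form /=; ring. Qed.

Lemma conic_norm_of_poly p : conic_norm (conic_of_poly p) = p ^+ 2.
Proof. by rewrite /conic_norm /norm_form /=; ring. Qed.

Lemma conic_norm_prod (I : Type) (r : seq I) (f : I -> B) :
  conic_norm (\prod_(i <- r) f i) = \prod_(i <- r) conic_norm (f i).
Proof.
by apply: (big_morph conic_norm conic_normM);
  rewrite -[1]/(conic_of_poly 1) conic_norm_of_poly expr1n.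
Qed.

Lemma conic_dvd D P z : conic_norm P != 0 -> D %| conic_norm P ->
  (size (conic_norm P) <= size D)%N ->
  D %| (z * conic_conj P).1 -> D %| (z * conic_conj P).2 -> exists z', z = P * z'.
Proof.
move=> NP0 DN sN D1 D2; have /andP[_ ND] : D %= conic_norm P.
  by rewrite -dvdp_size_eqp // eqn_leq sN dvdp_leq.
have /dvdpP[q1 e1] := dvdp_trans ND D1; have /dvdpP[q2 e2] := dvdp_trans ND D2.
exists (q1, q2); apply: (conic_of_poly_lreg NP0).
have e : z * conic_conj P = conic_of_poly (conic_norm P) * (q1, q2).
  by rewrite conic_of_polyM /= ![conic_norm P * _]mulrC -e1 -e2 -surjective_pairing.
rewrite -!mul_conic_conj; transitivity (P * (z * conic_conj P)); first by ring.
by rewrite e -mul_conic_conj; ring.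
Qed.

Lemma size_conic_poly_le : (size conic_poly <= 3)%N.
Proof.
rewrite (leq_trans (size_polyD _ _)) // geq_max (leq_trans (size_scale_leq _ _)) ?size_polyXn //.
by rewrite (leq_trans (size_polyC_leq1 _)).
Qed.

Lemma coef2_conic_poly : conic_poly`_2 = A.
Proof. by rewrite coefD coefZ coefXn coefC mulr1 addr0. Qed.

(* The degree of w is 1. *)
Definition conic_deg_le n b := (size b.1 <= n.+1)%N && (size b.2 <= n)%N.

Lemma conic_deg_leM n m b z :
  conic_deg_le n b -> conic_deg_le m z -> conic_deg_le (n + m) (b * z).
Proof.
move=> /andP[b1 b2] /andP[z1 z2]; have s3 := size_conic_poly_le.
apply/andP; split; rewrite (leq_trans (size_polyD _ _)) // geq_max; apply/andP; split.
- by have := size_polyMleq b.1 z.1; lia.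
- have [->|b20] := eqVneq b.2 0; first by rewrite mul0r mulr0 size_poly0.
  have [->|z20] := eqVneq z.2 0; first by rewrite !mulr0 size_poly0.
  have sb : (0 < size b.2)%N by rewrite size_poly_gt0.
  have sz : (0 < size z.2)%N by rewrite size_poly_gt0.
  by have := size_polyMleq conic_poly (b.2 * z.2); have := size_polyMleq b.2 z.2; lia.
- by have := size_polyMleq b.1 z.2; lia.
- by have := size_polyMleq b.2 z.1; lia.
Qed.

Lemma conic_deg_leD n b z : conic_deg_le n b -> conic_deg_le n z -> conic_deg_le n (b + z).
Proof.
by move=> /andP[b1 b2] /andP[z1 z2]; apply/andP; split;
  rewrite (leq_trans (size_polyD _ _)) // geq_max ?b1 ?b2.
Qed.

Lemma conic_deg_leN n b : conic_deg_le n (- b) = conic_deg_le n b.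
Proof. by rewrite /conic_deg_le !size_polyN. Qed.

Lemma conic_deg_le_cst n e : conic_deg_le n (conic_cst e).
Proof. by rewrite /conic_deg_le /= size_poly0 (leq_trans (size_polyC_leq1 _)). Qed.

Lemma conic_deg_leMcst n e b : conic_deg_le n b -> conic_deg_le n (conic_cst e * b).
Proof. exact: (conic_deg_leM (conic_deg_le_cst 0 e)). Qed.

Lemma conic_deg_le_norm_form n e b z :
  conic_deg_le n b -> conic_deg_le n z -> conic_deg_le (n + n) (norm_form (conic_cst e) b z).
Proof.
move=> hb hz; rewrite /norm_form !expr2 conic_deg_leD ?conic_deg_leN //.
  exact: conic_deg_leM.
by apply: conic_deg_leMcst; apply: conic_deg_leM.
Qed.

Lemma conic_deg_le_exists b : exists n, conic_deg_le n b.
Proof. by exists (maxn (size b.1) (size b.2)); rewrite /conic_deg_le; lia. Qed.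

Lemma conic_deg_leW n m b : (n <= m)%N -> conic_deg_le n b -> conic_deg_le m b.
Proof. by move=> nm /andP[b1 b2]; apply/andP; split; lia. Qed.

Lemma size_conic_norm_le n b : conic_deg_le n b -> (size (conic_norm b) <= (2 * n).+1)%N.
Proof.
move=> db; have dc : conic_deg_le n (conic_conj b) by rewrite /conic_deg_le /= size_polyN.
have := conic_deg_leM db dc; rewrite mul_conic_conj => /andP[/= + _].
by rewrite mul2n addnn.
Qed.

Lemma conic_deg_le_drop n b :
  conic_deg_le n.+1 b -> b.1`_n.+1 = 0 -> b.2`_n = 0 -> conic_deg_le n b.
Proof.
move=> /andP[b1 b2] e1 e2; apply/andP; split; apply/leq_sizeP => m; rewrite leq_eqVlt.
  by move=> /predU1P[<- //|]; apply/leq_sizeP: m; exact: b1.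
by move=> /predU1P[<- //|]; apply/leq_sizeP: m; exact: b2.
Qed.

Lemma conic_mul_top1 n m b z : conic_deg_le n.+1 b -> conic_deg_le m.+1 z ->
  (b * z).1`_(n.+1 + m.+1) = b.1`_n.+1 * z.1`_m.+1 + A * (b.2`_n * z.2`_m).
Proof.
move=> /andP[b1 b2] /andP[z1 z2]; rewrite /= coefD coefM_top //; congr (_ + _).
have s2 : (size (b.2 * z.2)%R <= (n + m).+1)%N by have := size_polyMleq b.2 z.2; lia.
rewrite (_ : (n.+1 + m.+1 = 2 + (n + m))%N); last by lia.
by rewrite coefM_top ?size_conic_poly_le // coefM_top // coef2_conic_poly.
Qed.

Lemma conic_mul_top2 n m b z : conic_deg_le n.+1 b -> conic_deg_le m.+1 z ->
  (b * z).2`_(n + m).+1 = b.1`_n.+1 * z.2`_m + b.2`_n * z.1`_m.+1.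
Proof.
move=> /andP[b1 b2] /andP[z1 z2].
by rewrite /= coefD -coefM_top // -coefM_top // addSn addnS.
Qed.

Section Evaluation.
Variables (R : fieldType) (f : {rmorphism E -> R}) (v w : R).

Definition on_conic : Prop := w ^+ 2 = f A * v ^+ 2 + f C.

Definition conic_eval_subdef of on_conic := fun b : B => eval_at f v b.1 + eval_at f v b.2 * w.

Hypothesis vw : on_conic.

Lemma eval_conic_poly : eval_at f v conic_poly = w ^+ 2.
Proof. by rewrite /conic_poly -mul_polyC rmorphD rmorphM rmorphXn !eval_atC eval_atX vw. Qed.

Fact conic_eval_zmod_morphism : zmod_morphism (conic_eval_subdef vw).
Proof. by move=> b z; rewrite /conic_eval_subdef [(b - z).1]/= [(b - z).2]/= !rmorphB; ring. Qed.

Fact conic_eval_monoid_morphism : monoid_morphism (conic_eval_subdef vw).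
Proof.
split=> [|b z]; first by rewrite /conic_eval_subdef rmorph1 rmorph0 mul0r addr0.
rewrite /conic_eval_subdef [(b * z).1]/= [(b * z).2]/= !rmorphD !rmorphM eval_conic_poly.
by ring.
Qed.

HB.instance Definition _ :=
  GRing.isZmodMorphism.Build B R (conic_eval_subdef vw) conic_eval_zmod_morphism.
HB.instance Definition _ :=
  GRing.isMonoidMorphism.Build B R (conic_eval_subdef vw) conic_eval_monoid_morphism.

Definition conic_eval : {rmorphism B -> R} := conic_eval_subdef vw.

Lemma conic_evalE b : conic_eval b = eval_at f v b.1 + eval_at f v b.2 * w.
Proof. by []. Qed.

Lemma conic_eval_of_poly p : conic_eval (conic_of_poly p) = eval_at f v p.
Proof. by rewrite conic_evalE rmorph0 mul0r addr0. Qed.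

Lemma conic_eval_cst e : conic_eval (conic_cst e) = f e.
Proof. by rewrite conic_eval_of_poly eval_atC. Qed.

Lemma eval_conic_norm b :
  eval_at f v (conic_norm b) = conic_eval b * conic_eval (conic_conj b).
Proof. by rewrite -rmorphM mul_conic_conj conic_eval_of_poly. Qed.
End Evaluation.

Section Anisotropic.
Hypothesis A_nonsquare : ~ is_square A.

Lemma size_conic_poly : size conic_poly = 3%N.
Proof.
rewrite size_polyDl size_scale ?nonsquare_neq0 ?size_polyXn //.
by rewrite (leq_ltn_trans (size_polyC_leq1 _)).
Qed.

Lemma conic_norm_eq0 b : (conic_norm b == 0) = (b == 0).
Proof.
apply/eqP/eqP => [|->]; last by rewrite /conic_norm /norm_form /= !expr0n mulr0 subr0.
case: b => p q /eqP; rewrite subr_eq0 => /eqP /= e.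
have [q0|q0] := eqVneq q 0.
  by congr (_, _) => //; apply/eqP; rewrite -sqrf_eq0 e q0 expr0n mulr0.
case: A_nonsquare; have lq0 : lead_coef q != 0 by rewrite lead_coef_eq0.
apply/(is_squareM_sqr _ lq0); exists (lead_coef p).
rewrite -!lead_coef_exp e lead_coefM; congr (_ * _).
by rewrite lead_coefE size_conic_poly coef2_conic_poly.
Qed.

Lemma conic_norm_const b : (size (conic_norm b) <= 1)%N -> conic_deg_le 0 b.
Proof.
move=> sb; have [n] := conic_deg_le_exists b; elim: n => // n IH db; apply: IH.
have dc : conic_deg_le n.+1 (conic_conj b).
  by case/andP: db => b1 b2; rewrite /conic_deg_le /= size_polyN b1.
have top0 : (conic_norm b)`_(n.+1 + n.+1) = 0 by move/leq_sizeP: sb => ->.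
have [b10 b20] : b.1`_n.+1 = 0 /\ b.2`_n = 0.
  apply: (norm_form_anisotropic A_nonsquare).
  rewrite -[RHS]top0 -[conic_norm b]/((conic_of_poly (conic_norm b)).1) -mul_conic_conj.
  by rewrite (conic_mul_top1 db dc) /norm_form /= coefN; ring.
exact: conic_deg_le_drop.
Qed.
End Anisotropic.
End ConicRing.

Lemma size_norm_form (F : idomainType) (x : F) (P Q : {poly F}) : x != 0 ->
  lead_coef P ^+ 2 != x * lead_coef Q ^+ 2 ->
  size (norm_form x%:P P Q) = (2 * maxn (size P) (size Q)).-1.
Proof.
move=> x0 lPQ; have sqr_size (p : {poly F}) : size (p ^+ 2) = (2 * size p).-1.
  have [->|p0] := eqVneq p 0; first by rewrite expr0n size_poly0.
  by rewrite expr2 size_mul // addnn mul2n.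
have sP := sqr_size P; have sQ : size (x%:P * Q ^+ 2) = (2 * size Q).-1.
  by rewrite mul_polyC size_scale // sqr_size.
rewrite /norm_form; have [h|h|sPQ] := ltngtP (size P) (size Q).
- by rewrite addrC size_polyDl size_polyN ?sP ?sQ; lia.
- by rewrite size_polyDl ?size_polyN ?sP ?sQ; lia.
have P0 : (0 < size P)%N.
  rewrite lt0n size_poly_eq0; apply: contra lPQ => /eqP P0.
  have -> : Q = 0 by apply/eqP; rewrite -size_poly_eq0 -sPQ P0 size_poly0.
  by rewrite P0 lead_coef0 expr0n mulr0.
apply/eqP; rewrite eqn_leq (leq_trans (size_polyD _ _)) ?size_polyN ?sP ?sQ -?sPQ ?maxnn //=.
have : (P ^+ 2 - x%:P * Q ^+ 2)`_((size P).-1 + (size P).-1) != 0.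
  rewrite coefB coefCM !expr2 !coefM_top ?prednK // -?sPQ //.
  by rewrite [in Q`_ _]sPQ -!lead_coefE -!expr2 subr_eq0.
move=> top0; rewrite leqNgt; apply: contra top0 => h.
by rewrite nth_default //; move: (size _) (size P) P0 h => m n; lia.
Qed.

(** * Points of a conic over finite extensions *)

Definition conic_anisotropic (E : fieldType) (A C : E) (k : fieldExtType E) (U : {vspace k}) :=
  forall x y z : k, x \in U -> y \in U -> z \in U ->
  x ^+ 2 = in_alg k A * y ^+ 2 + in_alg k C * z ^+ 2 -> y = 0 /\ z = 0.

Lemma linear_relation (E : fieldType) (V : vectType E) (U : {vspace V}) (I : finType) (e : I -> V) :
  (forall i, e i \in U) -> (\dim U < #|I|)%N ->
  exists c : I -> E, (exists i, c i != 0) /\ \sum_i c i *: e i = 0.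
Proof.
move=> eU dU; apply: NNPP => none.
pose X := [tuple of map e (enum I)].
suff /eqnP freeX : free X.
  have : (\dim <<X>> <= \dim U)%N.
    by apply/dimvS/span_subvP => y /mapP[i _ ->].
  by rewrite freeX size_map -cardE leqNgt dU.
apply/freeP => c cX i; apply/eqP/negPn/negP => ci; apply: none.
exists (c \o enum_rank); split; first by exists (enum_val i); rewrite /= enum_valK.
rewrite (reindex _ (onW_bij _ (@enum_val_bij I))) -[RHS]cX; apply: eq_bigr => j _ /=.
by rewrite enum_valK (nth_map (enum_val j)) -?enum_val_nth // -cardE.
Qed.

Lemma minPoly_over_base (E : fieldType) (k : fieldExtType E) (v : k) :
  exists2 p : {poly E}, size p = (adjoin_degree 1%AS v).+1 &
    forall q, (eval_at (in_alg k) v q == 0) = (p %| q).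
Proof.
have /polyOver1P[p pE] := minPolyOver 1%AS v.
exists p => [|q]; first by rewrite -(size_map_poly (in_alg k)) -pE size_minPoly.
rewrite -(dvdp_map (in_alg k)) -pE; apply/idP/idP => [qv|/dvdpP[y yE]].
  by apply: minPoly_dvdp => //; apply/polyOver1P; exists q.
by rewrite /= /horner_eval yE hornerM (eqP (root_minPoly _ _)) mulr0.
Qed.

Section Point.
Variables (E : fieldType) (A C : E) (k : fieldExtType E) (v w : k).
Hypothesis vw : on_conic A C (in_alg k) v w.
Local Notation ev := (conic_eval vw).
Local Notation kv := <<1; v>>%AS.
Local Notation kvw := <<<<1; v>>; w>>%AS.

Lemma eval_at_mem p : eval_at (in_alg k) v p \in kv.
Proof.
apply/Fadjoin_polyP; exists (map_poly (in_alg k) p) => //.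
by apply/polyOver1P; exists p.
Qed.

Lemma conic_eval_mem b : ev b \in kvw.
Proof.
have sub := subvP (subv_adjoin kv w).
rewrite conic_evalE; apply: rpredD; last apply: rpredM; last exact: memv_adjoin;
  by apply: sub; apply: eval_at_mem.
Qed.

Lemma sqr_w_mem (K' : {subfield k}) : v \in K' -> w ^+ 2 \in K'.
Proof. by move=> vK; rewrite vw rpredD ?rpredM ?rpredX ?scalar_mem. Qed.

Section Ideal.
Hypothesis A_nonsquare : ~ is_square A.

Lemma point_ideal_principal P z : P != 0 -> ev P = 0 -> ev z = 0 ->
  (size (conic_norm P) <= (\dim kvw).+1)%N -> exists z', z = P * z'.
Proof.
move=> P0 evP evz sP; have [p sp pP] := minPoly_over_base v.
have NP0 : conic_norm P != 0 by rewrite conic_norm_eq0.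
have dim_kv : \dim kv = (size p).-1 by rewrite dim_Fadjoin sp dimv1 muln1.
have sp0 : (0 < size p)%N by rewrite sp.
have [win|wnin] := boolP (w \in kv).
  have [P1v z1v] : eval_at (in_alg k) v P.1 = - (eval_at (in_alg k) v P.2 * w) /\
      eval_at (in_alg k) v z.1 = - (eval_at (in_alg k) v z.2 * w).
    by split; apply/eqP; rewrite -addr_eq0 -(conic_evalE vw) ?evP ?evz.
  apply: (@conic_dvd _ _ _ p) => //.
  - by rewrite -pP (eval_conic_norm vw) evP mul0r.
  - by rewrite (leq_trans sP) // dim_adjoin_sqrt ?sqr_w_mem ?memv_adjoin // win dim_kv mul1n prednK.
  - by rewrite -pP rmorphD !rmorphM (eval_conic_poly vw) rmorphN P1v z1v; apply/eqP; ring.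
  - by rewrite -pP rmorphD !rmorphM rmorphN P1v z1v; apply/eqP; ring.
have dvd_coords y : ev y = 0 -> p %| y.1 /\ p %| y.2.
  rewrite conic_evalE => evy; have y2 : eval_at (in_alg k) v y.2 = 0.
    apply/eqP; apply: contraNT wnin => y20.
    have -> : w = - eval_at (in_alg k) v y.1 / eval_at (in_alg k) v y.2.
      by move/eqP: evy; rewrite addrC addr_eq0 => /eqP <-; rewrite mulrC mulKf.
    by rewrite rpredM ?rpredN ?rpredV ?eval_at_mem.
  by rewrite -!pP y2 eqxx; move: evy; rewrite y2 mul0r addr0 => ->.
have [/dvdpP[P1 P1E] /dvdpP[P2 P2E]] := dvd_coords P evP.
have [/dvdpP[z1 z1E] /dvdpP[z2 z2E]] := dvd_coords z evz.
apply: (@conic_dvd _ _ _ (p * p)) => //.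
- by rewrite /conic_norm P1E P2E ![_ * p]mulrC norm_form_scale expr2 dvdp_mulIl.
- rewrite (leq_trans sP) // dim_adjoin_sqrt ?sqr_w_mem ?memv_adjoin // (negPf wnin) /= dim_kv.
  by rewrite size_mul -?size_poly_gt0 //; move: (size p) sp0 => n; lia.
- by rewrite /= P1E P2E z1E z2E; apply/dvdpP; exists (z1 * P1 - conic_poly A C * (z2 * P2)); ring.
- by rewrite /= P1E P2E z1E z2E; apply/dvdpP; exists (z2 * P1 - z1 * P2); ring.
Qed.

Section Parity.
Variable K' : {subfield k}.
Hypothesis aniso : conic_anisotropic A C K'.
Local Notation cm := (map_poly (in_alg k) (conic_poly A C)).

Lemma map_conic_poly : cm = (in_alg k A)%:P * 'X^2 + (in_alg k C)%:P.
Proof. by rewrite rmorphD /= map_polyZ /= map_polyXn map_polyC mul_polyC. Qed.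

Lemma sqr_sub_conic_over R : R \is a polyOver K' -> R ^+ 2 - cm \is a polyOver K'.
Proof.
move=> RK; rewrite map_conic_poly; apply: rpredB; first exact: rpredX.
by rewrite rpredD ?rpredM ?rpredX ?polyOverX // polyOverC scalar_mem.
Qed.

Lemma size_sqr_sub_conic R : R \is a polyOver K' ->
  size (R ^+ 2 - cm) = (2 * maxn (size R) 2).-1.
Proof.
move=> RK; have A0 : in_alg k A != 0 by rewrite fmorph_eq0 nonsquare_neq0.
have lR : lead_coef R ^+ 2 != in_alg k A * lead_coef 'X ^+ 2.
  rewrite lead_coefX; apply/eqP => e.
  have [|/eqP + _] := aniso (polyOverP RK _ : lead_coef R \in K') (rpred1 K') (rpred0 K').
    by rewrite e expr0n mulr0 addr0.
  by rewrite oner_eq0.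
have -> : R ^+ 2 - cm = norm_form (in_alg k A)%:P R 'X - (in_alg k C)%:P.
  by rewrite map_conic_poly /norm_form; ring.
have sN := size_norm_form A0 lR; rewrite size_polyX in sN.
rewrite size_polyDl ?sN // size_polyN (leq_ltn_trans (size_polyC_leq1 _)) //.
by rewrite (leq_trans (_ : 1 < (2 * 2).-1)%N) //; lia.
Qed.

Lemma sqr_sub_conic_no_linear_divisor p R : p \is a polyOver K' -> R \is a polyOver K' ->
  size p = 2%N -> ~~ (p %| R ^+ 2 - cm).
Proof.
move=> pK RK sp; apply/negP => /dvdpP[q qE].
have p1 : p`_1 != 0 by rewrite -[1%N]/(2.-1) -sp -lead_coefE lead_coef_eq0 -size_poly_eq0 sp.
pose r := - p`_0 / p`_1.
have rK : r \in K' by rewrite rpredM ?rpredN ?rpredV ?(polyOverP pK).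
have pr : p.[r] = 0 by rewrite horner_coef sp !big_ord_recl big_ord0 /= /r; field.
have /eqP : (R ^+ 2 - cm).[r] = 0 by rewrite qE hornerM pr mulr0.
rewrite map_conic_poly hornerD horner_exp hornerN hornerD hornerM hornerXn !hornerC subr_eq0 =>
  /eqP e.
have [] := aniso (rpred_horner RK rK) rK (rpred1 K').
  by rewrite expr1n mulr1.
by move=> _ /eqP; rewrite oner_eq0.
Qed.

Lemma sqr_sub_conic_no_odd_divisor n p R : p \is a polyOver K' -> R \is a polyOver K' ->
  size p = n.+1 -> odd n -> ~~ (p %| R ^+ 2 - cm).
Proof.
elim/ltn_ind: n p R => n IH p R pK; wlog sR : R / (size R <= n)%N.
  move=> reduced RK sp on; have p0 : p != 0 by rewrite -size_poly_eq0 sp.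
  have := reduced (R %% p) _ (modp_polyOver RK pK) sp on; rewrite -ltnS -sp ltn_modp => /(_ p0).
  apply: contra => pR; have -> : (R %% p) ^+ 2 - cm =
     R ^+ 2 - cm - p * ((R %/ p) * (R + R %% p)).
    by move: (R %/ p) (R %% p) (divp_eq R p) => q r ->; ring.
  by rewrite dvdp_sub // dvdp_mulr.
move=> RK sp on; have [n1|n1] := eqVneq n 1%N.
  by apply: sqr_sub_conic_no_linear_divisor; rewrite // sp n1.
apply/negP => pT; have := pT => /dvdpP[q qE].
have sT := size_sqr_sub_conic RK.
have q0 : q != 0 by apply/eqP => q0; move: sT; rewrite qE q0 mul0r size_poly0; lia.
have p0 : p != 0 by rewrite -size_poly_eq0 sp.
have qK : q \is a polyOver K' by rewrite -(mulpK q p0) -qE divp_polyOver ?sqr_sub_conic_over.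
have sq : (size q + n = (2 * maxn (size R) 2).-1)%N by rewrite -sT qE size_mul // sp addnS.
have q_gt0 : (0 < size q)%N by rewrite size_poly_gt0.
have [lt_qn odd_q] : ((size q).-1 < n)%N /\ odd (size q).-1 by split; lia.
by case/negP: (IH _ lt_qn q R qK RK (esym (prednK q_gt0)) odd_q); rewrite qE dvdp_mulr.
Qed.

Lemma dim_point_even : (K' <= kvw)%VS -> (2 * \dim K' %| \dim kvw)%N.
Proof.
move=> sub; have -> : kvw = <<<<K'; v>>; w>>%AS.
  apply/eqP; rewrite -val_eqE /= eqEsubv; apply/andP; split.
    apply/FadjoinP; split; last exact: memv_adjoin.
    apply/FadjoinP; split; first exact: sub1v.
    by apply: (subvP (subv_adjoin _ _)); apply: memv_adjoin.
  apply/FadjoinP; split; last exact: memv_adjoin.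
  apply/FadjoinP; split=> //.
  by apply: (subvP (subv_adjoin _ _)); apply: memv_adjoin.
rewrite dim_adjoin_sqrt ?sqr_w_mem ?memv_adjoin // dim_Fadjoin.
have [win|_] /= := boolP (w \in _); last by rewrite dvdn_mul // dvdn_mull.
rewrite mul1n dvdn_mul // dvdn2; apply/negP => odd_deg.
have [R RK wE] := Fadjoin_polyP win.
case/negP: (sqr_sub_conic_no_odd_divisor (minPolyOver K' v) RK (size_minPoly _ _) odd_deg).
apply: minPoly_dvdp; first exact: sqr_sub_conic_over.
by rewrite /root !hornerE -[cm.[v]]/(eval_at _ v _) (eval_conic_poly vw) wE subrr.
Qed.
End Parity.
End Ideal.

Lemma conic_relation r (e : 'I_r -> k) n : (forall l, e l \in kvw) ->
  (\dim kvw < r * (2 * n).+1)%N ->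
  exists b : 'I_r -> conic_ring A C, [/\ exists l, b l != 0, forall l, conic_deg_le n (b l)
    & \sum_l ev (b l) * e l = 0].
Proof.
move=> eU dk; pose m (i : 'I_n.+1 + 'I_n) := match i with inl i => v ^+ i | inr i => v ^+ i * w end.
have [|//|c [[[l i] cli] c0]] := @linear_relation E _ kvw
    ('I_r * ('I_n.+1 + 'I_n))%type (fun li => m li.2 * e li.1).
- have vU : v \in kvw by apply: (subvP (subv_adjoin _ _)); apply: memv_adjoin.
  have wU : w \in kvw by apply: memv_adjoin.
  by move=> [l [i|i]] /=; rewrite ?rpredM ?rpredX.
- by rewrite card_prod card_sum !card_ord; move: dk; rewrite (_ : (n.+1 + n = (2 * n).+1)%N) //;
  lia.
pose coords n' (j : 'I_n' -> 'I_n.+1 + 'I_n) l := rVpoly (\row_i c (l, j i)).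
have eval_coords n' (j : 'I_n' -> _) l' :
    eval_at (in_alg k) v (coords n' j l') = \sum_i c (l', j i) *: v ^+ i.
  rewrite /= /horner_eval (@horner_coef_wide _ n'); last by rewrite size_map_poly size_poly.
  by apply: eq_bigr => m' _; rewrite coef_map coef_rVpoly_ord mxE /= mulr_algl.
exists (fun l => (coords _ inl l, coords _ inr l)); split.
- exists l; apply: contra cli => /eqP[/(congr1 (poly_rV (d := n.+1))) h1
    /(congr1 (poly_rV (d := n))) h2].
  rewrite !rVpolyK !linear0 in h1 h2.
  by case: i => i; [move/rowP/(_ i): h1 | move/rowP/(_ i): h2]; rewrite !mxE => ->.
- by move=> l'; rewrite /conic_deg_le !size_poly.
- transitivity (\sum_l' \sum_i' c (l', i') *: (m i' * e l')); last first.
    by rewrite pair_bigA -[RHS]c0; apply: eq_bigr => -[].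
  apply: eq_bigr => l' _; rewrite big_sumType /= conic_evalE !eval_coords mulrDl !mulr_suml.
  by congr (_ + _); apply: eq_bigr => i' _; rewrite -!scalerAl.
Qed.
End Point.

(** * Products of norm forms *)

Section NormRelation.
Variables (R : comPzRingType) (I : finType) (x : I -> R).
Implicit Types (s g d : R) (p q : I -> R).

Definition norm_relation s g p q : Prop := s * g ^+ 2 = \prod_i norm_form (x i) (p i) (q i).

Lemma prod_norm_form_update p q i b c :
  \prod_l norm_form (x l) ([eta p with i |-> b] l) ([eta q with i |-> c] l) =
  norm_form (x i) b c * \prod_(l | l != i) norm_form (x l) (p l) (q l).
Proof. by rewrite (bigD1 i) //= eqxx; congr (_ * _); apply: eq_bigr => l /negPf->. Qed.

End NormRelation.

Lemma rmorph_norm_relation (R S : comPzRingType) (f : {rmorphism R -> S}) (I : finType)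
    (x : I -> R) s g p q :
  norm_relation x s g p q -> norm_relation (f \o x) (f s) (f g) (f \o p) (f \o q).
Proof.
rewrite /norm_relation -rmorphXn -rmorphM => ->; rewrite rmorph_prod.
by apply: eq_bigr => i _; rewrite rmorph_norm_form.
Qed.

Lemma exists_irreducible_factor (E : fieldType) (p : {poly E}) :
  (1 < size p)%N -> exists2 q, irreducible_poly q & q %| p.
Proof.
have [n] := ubnP (size p); elim: n p => // n IH p sp p1.
have [irr|red] := classic (irreducible_poly p); first by exists p.
have [q [q1 qp nqp]] : exists q : {poly E}, [/\ size q != 1%N, q %| p & ~ q %= p].
  apply: NNPP => none; apply: red; split=> // q q1 qp; apply: NNPP => nqp.
  by apply: none; exists q.
have p0 : p != 0 by rewrite -size_poly_gt0 ltnW.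
have sq : (size q < size p)%N.
  by rewrite ltn_neqAle dvdp_leq // andbT dvdp_size_eqp //; apply/negP.
have q0 : q != 0 by apply: contraNneq p0 => q0; move: qp; rewrite q0 dvd0p.
have [||r irr rq] := IH q; first exact: leq_trans sq sp.
  by rewrite ltn_neqAle eq_sym q1 size_poly_gt0.
by exists r => //; apply: dvdp_trans qp.
Qed.

(* For xi ^ 2 = x and eta ^ 2 = y, the norm of r_1 + r_2 xi + r_3 eta + r_4 xi eta from
   R(xi, eta) to R(xi) is biquad_norm0 + biquad_norm1 xi; the norm to R(eta) is obtained by
   exchanging x with y and r_2 with r_3. *)
Section BiquadraticNorm.
Variable R : comPzRingType.
Implicit Types x y r xi eta : R.

Definition biquad_norm0 x y r1 r2 r3 r4 : R :=
  r1 ^+ 2 + x * r2 ^+ 2 - y * (r3 ^+ 2 + x * r4 ^+ 2).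
Definition biquad_norm1 x y r1 r2 r3 r4 : R := 2%:R * (r1 * r2 - y * (r3 * r4)).

Lemma biquad_norm_form x y r1 r2 r3 r4 :
  norm_form x (biquad_norm0 x y r1 r2 r3 r4) (biquad_norm1 x y r1 r2 r3 r4) =
  norm_form y (biquad_norm0 y x r1 r3 r2 r4) (biquad_norm1 y x r1 r3 r2 r4).
Proof. by rewrite /norm_form /biquad_norm0 /biquad_norm1; ring. Qed.

Lemma biquad_norm_root xi eta r1 r2 r3 r4 :
  r1 + r2 * xi + r3 * eta + r4 * (xi * eta) = 0 ->
  biquad_norm0 (xi ^+ 2) (eta ^+ 2) r1 r2 r3 r4 =
  - xi * biquad_norm1 (xi ^+ 2) (eta ^+ 2) r1 r2 r3 r4.
Proof.
move=> e; have -> : r1 = - (r2 * xi + r3 * eta + r4 * (xi * eta)).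
  by apply/eqP; rewrite -addr_eq0 !addrA e.
by rewrite /biquad_norm0 /biquad_norm1; ring.
Qed.
End BiquadraticNorm.

Lemma rmorph_biquad_norm0 (R S : comPzRingType) (f : {rmorphism R -> S}) x y r1 r2 r3 r4 :
  f (biquad_norm0 x y r1 r2 r3 r4) = biquad_norm0 (f x) (f y) (f r1) (f r2) (f r3) (f r4).
Proof. by rewrite /biquad_norm0 !(rmorphB, rmorphD, rmorphM, rmorphXn). Qed.

Lemma rmorph_biquad_norm1 (R S : comPzRingType) (f : {rmorphism R -> S}) x y r1 r2 r3 r4 :
  f (biquad_norm1 x y r1 r2 r3 r4) = biquad_norm1 (f x) (f y) (f r1) (f r2) (f r3) (f r4).
Proof. by rewrite /biquad_norm1 !(rmorphB, rmorphM, rmorph_nat). Qed.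

Definition rmorph_biquad_norm := (rmorph_biquad_norm0, rmorph_biquad_norm1).

Lemma biquad_norm_anisotropic (F : fieldType) (x y r1 r2 r3 r4 : F) : (2%:R : F) != 0 ->
  ~ is_square y -> ~ is_square (x * y) ->
  biquad_norm0 x y r1 r2 r3 r4 = 0 -> biquad_norm1 x y r1 r2 r3 r4 = 0 ->
  [/\ r1 = 0, r2 = 0, r3 = 0 & r4 = 0].
Proof.
move=> two0 ny nxy /eqP; rewrite subr_eq0 => /eqP norm0 /eqP.
rewrite mulf_eq0 (negPf two0) subr_eq0 => /eqP norm1.
exact: square_ratio_quadratic ny nxy norm1 norm0.
Qed.

Lemma conic_deg_le_biquad_norm (E : fieldType) (A C : E) n (x y : E)
  (r1 r2 r3 r4 : conic_ring A C) :
  conic_deg_le n r1 -> conic_deg_le n r2 -> conic_deg_le n r3 -> conic_deg_le n r4 ->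
  conic_deg_le (n + n) (biquad_norm0 (conic_cst A C x) (conic_cst A C y) r1 r2 r3 r4) &&
  conic_deg_le (n + n) (biquad_norm1 (conic_cst A C x) (conic_cst A C y) r1 r2 r3 r4).
Proof.
move=> d1 d2 d3 d4; rewrite /biquad_norm0 /biquad_norm1 !expr2 -(rmorph_nat (conic_cst A C)).
by rewrite !(conic_deg_leD, conic_deg_leN, conic_deg_leMcst, conic_deg_leM).
Qed.

(** * Norm descent on a conic *)

Section Descent.
Variables (E F : fieldType) (j : {rmorphism E -> F}) (A C : E) (v w : F).
Hypothesis vw : on_conic A C j v w.
Hypothesis conic_inj : injective (conic_eval vw).
Variables (I : finType) (x : I -> E).
Hypothesis two_neq0 : (2%:R : E) != 0.
Hypothesis A_nonsquare : ~ is_square A.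
Hypothesis Ax_nonsquare : forall i, ~ is_square (A * x i).
Hypothesis x_nonsquare : forall i, ~ is_square (j (x i)).
Hypothesis xx_nonsquare : forall i l, i != l -> ~ is_square (j (x i * x l)).
Hypothesis other_index : forall i : I, exists l, i != l.
Hypothesis aniso_biquadratic : forall (k : fieldExtType E) (xi eta : k) i l, i != l ->
  xi ^+ 2 = in_alg k (x i) -> eta ^+ 2 = in_alg k (x l) ->
  conic_anisotropic A C <<<<1; xi>>; eta>>%AS.

Local Notation B := (conic_ring A C).
Local Notation cst := (conic_cst A C).
Local Notation nf i := (norm_form (cst (x i))).

Lemma x_nonsquare_base i : ~ is_square (x i).
Proof. by move=> /(rmorph_is_square j)/x_nonsquare. Qed.

Lemma xx_nonsquare_base i l : i != l -> ~ is_square (x i * x l).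
Proof. by move=> il /(rmorph_is_square j)/(xx_nonsquare il). Qed.

Lemma conic_mulI (D : B) : D != 0 -> GRing.lreg D.
Proof.
move=> D0 b z /(congr1 (conic_eval vw)); rewrite !rmorphM => e; apply: conic_inj.
by apply: mulfI e; rewrite -(rmorph0 (conic_eval vw)) (inj_eq conic_inj).
Qed.

Lemma conic_norm_form_anisotropic i (b c : B) : nf i b c = 0 -> b = 0 /\ c = 0.
Proof.
move=> /(congr1 (conic_eval vw)); rewrite rmorph_norm_form rmorph0 conic_eval_cst.
case/(norm_form_anisotropic (@x_nonsquare i)) => b0 c0.
by split; apply: conic_inj; rewrite rmorph0.
Qed.

Lemma conic_biquad_norm_anisotropic i l (r1 r2 r3 r4 : B) : i != l ->
  nf i (biquad_norm0 (cst (x i)) (cst (x l)) r1 r2 r3 r4)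
       (biquad_norm1 (cst (x i)) (cst (x l)) r1 r2 r3 r4) = 0 ->
  [/\ r1 = 0, r2 = 0, r3 = 0 & r4 = 0].
Proof.
have two0 : (2%:R : F) != 0 by rewrite -(rmorph_nat j) fmorph_eq0.
move=> il /conic_norm_form_anisotropic[/(congr1 (conic_eval vw)) + /(congr1 (conic_eval vw))].
rewrite !rmorph_biquad_norm !conic_eval_cst rmorph0 => norm0 norm1.
have [|r10 r20 r30 r40] := biquad_norm_anisotropic two0 (@x_nonsquare l) _ norm0 norm1.
  by rewrite -rmorphM; apply: xx_nonsquare.
by split; apply: conic_inj; rewrite rmorph0.
Qed.

Lemma conic_anisotropic_quadratic (k : fieldExtType E) (xi : k) i :
  xi ^+ 2 = in_alg k (x i) -> conic_anisotropic A C <<1; xi>>%AS.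
Proof.
move=> xiE a b c ha hb hc e; have [l il] := other_index i.
have [k' [f [eta [fE etaE]]]] := sqrt_step (in_alg k (x l)).
have f_mem y : y \in <<1; xi>>%VS -> f y \in <<<<1; f xi>>; eta>>%VS.
  have xi2 : xi ^+ 2 \in 1%AS by rewrite xiE scalar_mem.
  move=> /(mem_adjoin_sqrt xi2)[_ [_ [/vlineP[c0 ->] /vlineP[c1 ->] ->]]].
  apply: (subvP (subv_adjoin _ _)); rewrite rmorphD rmorphM !fE.
  by rewrite rpredD ?rpredM ?memv_adjoin ?(scalar_mem <<1; f xi>>%AS).
have [|||fb0 fc0] := aniso_biquadratic il _ _ (f_mem _ ha) (f_mem _ hb) (f_mem _ hc).
- by rewrite -rmorphXn xiE /= fE.
- by rewrite etaE /= fE.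
- by rewrite -!rmorphXn e rmorphD !rmorphM /= !fE.
by split; apply: (fmorph_inj f); rewrite rmorph0.
Qed.

Lemma conic_anisotropic_base (k : fieldExtType E) (i : I) :
  conic_anisotropic A C (1%AS : {subfield k}).
Proof.
move=> a b c ha hb hc e; have [k' [f [xi [fE xiE]]]] := sqrt_step (in_alg k (x i)).
have f_mem y : y \in 1%VS -> f y \in <<1; xi>>%VS.
  by move=> /vlineP[c0 ->]; rewrite fE (scalar_mem <<1; xi>>%AS).
have [||fb0 fc0] := conic_anisotropic_quadratic (i := i) _ (f_mem _ ha) (f_mem _ hb) (f_mem _ hc).
- by rewrite xiE /= fE.
- by rewrite -!rmorphXn e rmorphD !rmorphM /= !fE.
by split; apply: (fmorph_inj f); rewrite rmorph0.
Qed.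

Section AtPoint.
Variables (k : fieldExtType E) (v0 w0 : k).
Hypothesis vw0 : on_conic A C (in_alg k) v0 w0.
Local Notation ev := (conic_eval vw0).
Local Notation kvw := <<<<1; v0>>; w0>>%AS.

Lemma point_eval_cst e : ev (cst e) = in_alg k e.
Proof. exact: conic_eval_cst. Qed.

Definition point_generator (P : B) : Prop :=
  [/\ P != 0, ev P = 0 & forall z, ev z = 0 -> exists z', z = P * z'].

Lemma point_generatorP P n : P != 0 -> ev P = 0 -> conic_deg_le n P ->
  (2 * n <= \dim kvw)%N -> point_generator P.
Proof.
move=> P0 evP dP hn; split=> // z evz.
apply: (point_ideal_principal A_nonsquare P0 evP evz).
by apply: leq_trans (size_conic_norm_le dP) _; rewrite ltnS.
Qed.

Lemma point_generator_exists (i : I) : exists P, point_generator P.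
Proof.
have /dvdnP[n dimE] := dim_point_even vw0 A_nonsquare (conic_anisotropic_base (k := k) i) (sub1v _).
rewrite dimv1 muln1 in dimE.
have [_||b [[l bl0] db]] := @conic_relation _ _ _ _ _ _ vw0 1 (fun=> 1) n; first exact: rpred1.
  by rewrite dimE mul1n; lia.
rewrite big_ord1 mulr1 => evb; exists (b ord0).
by apply: (@point_generatorP _ n) => //; [rewrite (ord1 l) in bl0 | rewrite dimE mulnC].
Qed.

Lemma norm_form_generator xi i : xi \in kvw -> xi ^+ 2 = in_alg k (x i) ->
  exists r1 r2, point_generator (nf i r1 r2) /\ ev r1 = - xi * ev r2.
Proof.
move=> xi_in xiE.
have sub : (<<1; xi>>%AS <= kvw)%VS by apply/FadjoinP; split; rewrite ?sub1v.
have /dvdnP[n dimE] := dim_point_even vw0 A_nonsquare (conic_anisotropic_quadratic xiE) sub.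
rewrite (dim_adjoin1 (@x_nonsquare_base i) xiE) in dimE.
have [m||b [[l bl0] db]] := @conic_relation _ _ _ _ _ _ vw0 2 (fun m => xi ^+ m) n.
- exact: rpredX.
- by rewrite dimE; lia.
rewrite big_ord_recl big_ord1 expr0 mulr1 expr1 => evb.
have ev_b0 : ev (b ord0) = - xi * ev (b (lift ord0 ord0)).
  by move/eqP: evb; rewrite addr_eq0 => /eqP ->; ring.
exists (b ord0), (b (lift ord0 ord0)); split=> //; apply: (@point_generatorP _ (n + n)).
- apply: contraNneq bl0 => /conic_norm_form_anisotropic[b00 b10].
  by case: (unliftP ord0 l) => [m|] ->; rewrite ?(ord1 m) ?b00 ?b10.
- by rewrite rmorph_norm_form point_eval_cst -xiE ev_b0 /norm_form; ring.
- exact: conic_deg_le_norm_form.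
- by rewrite dimE; lia.
Qed.

Lemma eval_biquad_norm_root xi eta i l r1 r2 r3 r4 :
  xi ^+ 2 = in_alg k (x i) -> eta ^+ 2 = in_alg k (x l) ->
  ev r1 + ev r2 * xi + ev r3 * eta + ev r4 * (xi * eta) = 0 ->
  ev (biquad_norm0 (cst (x i)) (cst (x l)) r1 r2 r3 r4) =
  - xi * ev (biquad_norm1 (cst (x i)) (cst (x l)) r1 r2 r3 r4).
Proof.
move=> xiE etaE /biquad_norm_root.
by rewrite !rmorph_biquad_norm !point_eval_cst xiE etaE.
Qed.

Lemma common_norm_form_generator xi eta i l : i != l -> xi \in kvw -> eta \in kvw ->
  xi ^+ 2 = in_alg k (x i) -> eta ^+ 2 = in_alg k (x l) ->
  exists a1 a2 c1 c2, [/\ point_generator (nf i a1 a2), nf i a1 a2 = nf l c1 c2,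
    ev a1 = - xi * ev a2 & ev c1 = - eta * ev c2].
Proof.
move=> il xi_in eta_in xiE etaE.
have sub : (<<<<1; xi>>; eta>>%AS <= kvw)%VS.
  by apply/FadjoinP; split=> //; apply/FadjoinP; split; rewrite ?sub1v.
have /dvdnP[n dimE] := dim_point_even vw0 A_nonsquare (aniso_biquadratic il xiE etaE) sub.
have li : l != i by rewrite eq_sym.
rewrite (dim_adjoin2 two_neq0 (@x_nonsquare_base i) (@x_nonsquare_base l)
  (xx_nonsquare_base li) xiE etaE) in dimE.
pose e (m : 'I_4) : k := nth 0 [:: 1; xi; eta; xi * eta] m.
have [m||b [[m bm0] db]] := @conic_relation _ _ _ _ _ _ vw0 4 e n.
- by case: m => -[|[|[|[|m]]]] hm; rewrite /e /= ?rpredM ?rpred1.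
- by rewrite dimE; lia.
rewrite !big_ord_recl big_ord0 /e /= mulr1 addr0 !addrA.
set r1 := b _; set r2 := b _; set r3 := b _; set r4 := b _ => evb.
have r_neq0 : [/\ r1 = 0, r2 = 0, r3 = 0 & r4 = 0] -> False.
  move=> [r10 r20 r30 r40]; case/eqP: bm0.
  case: (unliftP ord0 m) => [m1 ->|-> //]; case: (unliftP ord0 m1) => [m2 ->|-> //].
  by case: (unliftP ord0 m2) => [m3 ->|-> //]; rewrite (ord1 m3).
have root_xi := eval_biquad_norm_root xiE etaE evb.
have root_eta := @eval_biquad_norm_root eta xi l i r1 r3 r2 r4 etaE xiE.
exists (biquad_norm0 (cst (x i)) (cst (x l)) r1 r2 r3 r4),
  (biquad_norm1 (cst (x i)) (cst (x l)) r1 r2 r3 r4),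
  (biquad_norm0 (cst (x l)) (cst (x i)) r1 r3 r2 r4),
  (biquad_norm1 (cst (x l)) (cst (x i)) r1 r3 r2 r4).
split=> //; last by apply: root_eta; rewrite -evb; ring.
- apply: (@point_generatorP _ (n + n + (n + n))).
  + by apply/eqP => /(conic_biquad_norm_anisotropic il).
  + by rewrite rmorph_norm_form root_xi point_eval_cst -xiE /norm_form; ring.
  + have /andP[d0 d1] := conic_deg_le_biquad_norm (x i) (x l) (db _ : conic_deg_le n r1)
      (db _ : conic_deg_le n r2) (db _ : conic_deg_le n r3) (db _ : conic_deg_le n r4).
    exact: conic_deg_le_norm_form.
  + by rewrite dimE; lia.
- exact: biquad_norm_form.
Qed.

Lemma divide_by_generator i r1 r2 f1 f2 xi :
  xi ^+ 2 = in_alg k (x i) -> point_generator (nf i r1 r2) ->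
  ev r1 = - xi * ev r2 -> ev f1 = - xi * ev f2 ->
  exists h1 h2, nf i f1 f2 = nf i r1 r2 * nf i h1 h2.
Proof.
move=> xiE [D0 _ gen] er ef.
have [|h1 h1E] := gen (f1 * r1 - cst (x i) * (f2 * r2)).
  by rewrite !(rmorphB, rmorphM ev) point_eval_cst er ef -xiE; ring.
have [|h2 h2E] := gen (f2 * r1 - f1 * r2).
  by rewrite !(rmorphB, rmorphM ev) er ef; ring.
exists h1, h2; apply: (conic_mulI D0).
transitivity (nf i (f1 * r1 - cst (x i) * (f2 * r2)) (f2 * r1 - f1 * r2)).
  by rewrite /norm_form; ring.
by rewrite h1E h2E norm_form_scale; ring.
Qed.
End AtPoint.

Lemma exists_conic_zero (g : B) : (1 < size (conic_norm g))%N ->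
  exists (k : fieldExtType E) (v0 w0 : k) (vw0 : on_conic A C (in_alg k) v0 w0),
    conic_eval vw0 g = 0.
Proof.
move=> /exists_irreducible_factor[p irr pg].
have [k1 _ [v1 rv1 _]] := irredp_FAdjoin irr.
have [k [f [w0 [fE w0E]]]] := sqrt_step (in_alg k1 A * v1 ^+ 2 + in_alg k1 C).
have vw1 : on_conic A C (in_alg k) (f v1) w0.
  by rewrite /on_conic w0E rmorphD rmorphM rmorphXn /= !fE.
have : eval_at (in_alg k) (f v1) (conic_norm g) = 0.
  rewrite /= /horner_eval.
  have -> : map_poly (in_alg k) (conic_norm g) = map_poly f (map_poly (in_alg k1) (conic_norm g)).
    by apply/polyP => i; rewrite !coef_map /= fE.
  by rewrite horner_map; move/dvdpP: pg => [q ->]; rewrite rmorphM hornerM (eqP rv1) mulr0 rmorph0.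
rewrite (eval_conic_norm vw1) => /eqP; rewrite mulf_eq0 => /orP[]/eqP g0.
  by exists k, (f v1), w0, vw1.
have vw2 : on_conic A C (in_alg k) (f v1) (- w0) by rewrite /on_conic sqrrN.
exists k, (f v1), (- w0), vw2; rewrite -{}g0 !conic_evalE /=.
by rewrite !rmorphN /= mulrN mulNr.
Qed.

Lemma conic_norm_factor_lt (k : fieldExtType E) (v0 w0 : k) (vw0 : on_conic A C (in_alg k) v0 w0)
    (P g g' : B) :
  P != 0 -> conic_eval vw0 P = 0 -> g != 0 -> g = P * g' ->
  g' != 0 /\ (size (conic_norm g') < size (conic_norm g))%N.
Proof.
move=> P0 evP g0 gE.
have g'0 : g' != 0 by apply: contra_neq g0 => g'0; rewrite gE g'0 mulr0.
split=> //; rewrite gE conic_normM size_mul ?conic_norm_eq0 //.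
have size_P : (1 < size (conic_norm P))%N.
  rewrite -(size_map_poly (in_alg k)); apply: (@root_size_gt1 _ v0).
    by rewrite map_poly_eq0 conic_norm_eq0.
  by rewrite /root -[X in X == 0]/(eval_at _ v0 _) (eval_conic_norm vw0) evP mul0r.
have : (0 < size (conic_norm g'))%N by rewrite size_poly_gt0 conic_norm_eq0.
by move: size_P; move: (size _) (size _) => n1 n2; lia.
Qed.

Lemma norm_form_const i (b c : B) :
  conic_deg_le 0 (nf i b c) -> conic_deg_le 0 b /\ conic_deg_le 0 c.
Proof.
move=> hN; have [n hb hc] : exists2 n, conic_deg_le n b & conic_deg_le n c.
  have [n hb] := conic_deg_le_exists b; have [m hc] := conic_deg_le_exists c.
  exists (maxn n m).
    exact: conic_deg_leW (leq_maxl _ _) hb.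
  exact: conic_deg_leW (leq_maxr _ _) hc.
elim: n hb hc => // n IH hb hc; case/andP: hN => /leq_sizeP hN1 /leq_sizeP hN2.
have top1 : (nf i b c).1`_(n.+1 + n.+1) = 0 by apply: hN1; lia.
have top2 : (nf i b c).2`_(n + n).+1 = 0 by apply: hN2.
have nfE : nf i b c = b * b - conic_of_poly A C (x i)%:P * (c * c) by rewrite /norm_form !expr2.
rewrite nfE conic_of_polyM /= in top1 top2.
rewrite !coefB !coefCM !(conic_mul_top1, conic_mul_top2) // in top1 top2.
have [||b1 b2 c1 c2] := square_ratio_quadratic (x_nonsquare_base (i := i)) (Ax_nonsquare (i := i))
  (a0 := b.1`_n.+1) (a1 := b.2`_n) (b0 := c.1`_n.+1) (b1 := c.2`_n).
- by apply: (mulfI two_neq0); apply/eqP; rewrite -subr_eq0; apply/eqP; rewrite -[RHS]top2; ring.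
- by apply/eqP; rewrite -subr_eq0; apply/eqP; rewrite -[RHS]top1; ring.
by apply: IH; apply: conic_deg_le_drop.
Qed.

Lemma conic_deg_le0_cst (b : B) : conic_deg_le 0 b -> b = cst b.1`_0.
Proof.
case: b => p q /andP[/= /size1_polyC {1}-> ]; rewrite leqn0 size_poly_eq0 => /eqP->.
by [].
Qed.

Local Notation relation s := (norm_relation (cst \o x) (cst s)).

Lemma norm_relation_const s (g : B) (P Q : I -> B) : s != 0 -> g != 0 -> relation s g P Q ->
  (size (conic_norm g) <= 1)%N ->
  exists (g0 : E) (p q : I -> E), g0 != 0 /\ norm_relation x s g0 p q.
Proof.
move=> s0 g0 rel sg; have g_const := conic_deg_le0_cst (conic_norm_const A_nonsquare sg).
have norm_g0 : conic_norm g != 0 by rewrite conic_norm_eq0.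
have norm_rel : (s ^+ 2)%:P * conic_norm g ^+ 2 = \prod_i conic_norm (nf i (P i) (Q i)).
  by rewrite -conic_norm_prod -rel !conic_normM conic_norm_of_poly polyC_exp expr2.
have size_rel : (size (\prod_i conic_norm (nf i (P i) (Q i)))%R <= 1)%N.
  rewrite -norm_rel mul_polyC (leq_trans (size_scale_leq _ _)) //.
  by rewrite (leq_trans (size_polyMleq _ _)) //; lia.
have prod0 : \prod_i conic_norm (nf i (P i) (Q i)) != 0.
  by rewrite -norm_rel mulf_neq0 ?expf_neq0 // polyC_eq0 expf_neq0.
have PQ_const i : P i = cst (P i).1`_0 /\ Q i = cst (Q i).1`_0.
  have dvd_i : conic_norm (nf i (P i) (Q i)) %| \prod_l conic_norm (nf l (P l) (Q l)).
    by rewrite (bigD1 i) //= dvdp_mulIl.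
  have /norm_form_const[dP dQ] :=
    conic_norm_const A_nonsquare (leq_trans (dvdp_leq prod0 dvd_i) size_rel).
  by split; apply: conic_deg_le0_cst.
exists g.1`_0, (fun i => (P i).1`_0), (fun i => (Q i).1`_0); split.
  by apply: contraNneq g0 => g10; rewrite g_const g10 rmorph0.
apply: (fmorph_inj cst); rewrite rmorphM rmorphXn -g_const [LHS]rel rmorph_prod.
by apply: eq_bigr => i _; rewrite rmorph_norm_form -(PQ_const i).1 -(PQ_const i).2.
Qed.

Section DescentStep.
Variables (s : E) (g : B) (P Q : I -> B).
Hypotheses (g0 : g != 0) (rel : relation s g P Q).
Variables (k : fieldExtType E) (v0 w0 : k) (vw0 : on_conic A C (in_alg k) v0 w0).
Local Notation ev := (conic_eval vw0).
Hypothesis ev_g : ev g = 0.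

Definition smaller_relation : Prop := exists g' P' Q',
  [/\ g' != 0, (size (conic_norm g') < size (conic_norm g))%N & relation s g' P' Q'].

Lemma divide_by_square D P' Q' : point_generator vw0 D ->
  \prod_i nf i (P i) (Q i) = D ^+ 2 * \prod_i nf i (P' i) (Q' i) -> smaller_relation.
Proof.
move=> [D0 evD gen] prodE; have [g' gE] := gen g ev_g.
have [g'0 lt_g'] := conic_norm_factor_lt D0 evD g0 gE; exists g', P', Q'; split=> //.
apply: (conic_mulI D0); apply: (conic_mulI D0).
transitivity (cst s * g ^+ 2); first by rewrite gE; ring.
by rewrite rel prodE; ring.
Qed.

Lemma smaller_of_common_zero i : ev (P i) = 0 -> ev (Q i) = 0 -> smaller_relation.
Proof.
move=> Pi0 Qi0; have [D genD] := point_generator_exists vw0 i; have [_ _ gen] := genD.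
have [p pE] := gen _ Pi0; have [q qE] := gen _ Qi0.
apply: (@divide_by_square D [eta P with i |-> p] [eta Q with i |-> q] genD).
by rewrite (prod_norm_form_update (cst \o x)) (bigD1 i) //= pE qE norm_form_scale mulrA.
Qed.

Lemma smaller_of_two_zeros i l xi eta : i != l ->
  xi \in <<<<1; v0>>; w0>>%VS -> eta \in <<<<1; v0>>; w0>>%VS ->
  xi ^+ 2 = in_alg k (x i) -> eta ^+ 2 = in_alg k (x l) ->
  ev (P i) = - xi * ev (Q i) -> ev (P l) = - eta * ev (Q l) -> smaller_relation.
Proof.
move=> il xi_in eta_in xiE etaE Pi Pl.
have [a1 [a2 [c1 [c2 [genD DE root_a root_c]]]]] :=
  common_norm_form_generator vw0 il xi_in eta_in xiE etaE.
have [p1 [q1 e1]] := divide_by_generator xiE genD root_a Pi.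
rewrite DE in genD; have [p2 [q2 e2]] := divide_by_generator etaE genD root_c Pl.
apply: (@divide_by_square _ [eta [eta P with i |-> p1] with l |-> p2]
         [eta [eta Q with i |-> q1] with l |-> q2] genD).
rewrite (prod_norm_form_update (cst \o x)) (bigD1 i) //= (bigD1 l) 1?eq_sym //= e1 e2 DE.
rewrite [X in _ = _ * (_ * X)](bigD1 i) //= eqxx.
rewrite [X in _ = _ * (_ * (_ * X))](eq_bigr (fun m => nf m (P m) (Q m))); last first.
  by move=> m /andP[_ /negPf->].
rewrite [X in _ = _ * (_ * (_ * X))](eq_bigl (fun m => (m != i) && (m != l))); last first.
  by move=> m; rewrite andbC.
by ring.
Qed.

Lemma smaller_of_single_zero i xi : (forall l, l != i -> ev (nf l (P l) (Q l)) != 0) ->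
  xi \in <<<<1; v0>>; w0>>%VS -> xi ^+ 2 = in_alg k (x i) ->
  ev (P i) = - xi * ev (Q i) -> smaller_relation.
Proof.
move=> others xi_in xiE Pi; have [r1 [r2 [genD root_r]]] := norm_form_generator vw0 xi_in xiE.
have [p1 [q1 e1]] := divide_by_generator xiE genD root_r Pi.
set D := nf i r1 r2 in genD e1; have [D0 evD gen] := genD; have [g' gE] := gen g ev_g.
have rel1 : cst s * (D * g' ^+ 2) = nf i p1 q1 * \prod_(l | l != i) nf l (P l) (Q l).
  apply: (conic_mulI D0); transitivity (cst s * g ^+ 2); first by rewrite gE; ring.
  by rewrite rel (bigD1 i) //= e1 mulrA.
have [q2 [nf_q2 p1E]] : exists q2, nf i p1 q1 = nf i p1 q2 /\ ev p1 = - xi * ev q2.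
  have : ev (nf i p1 q1) == 0.
    have /eqP := congr1 ev rel1; rewrite !(rmorphM ev) evD mul0r mulr0 eq_sym mulf_eq0.
    case/orP => //; rewrite rmorph_prod prodf_seq_eq0 => /hasP[l _ /andP[li evl]].
    by case/negP: (others l li).
  rewrite rmorph_norm_form point_eval_cst -xiE subr_eq0 -exprMn eqf_sqr => /orP[]/eqP->.
    by exists (- q1); split; rewrite ?rmorphN ?mulrNN // /norm_form sqrrN.
  by exists q1; rewrite mulNr.
have [p3 [q3 e3]] := divide_by_generator xiE genD root_r p1E.
apply: (@divide_by_square D [eta P with i |-> p3] [eta Q with i |-> q3] genD).
by rewrite (prod_norm_form_update (cst \o x)) (bigD1 i) //= e1 nf_q2 e3 -/D; ring.
Qed.

Lemma descent_step : smaller_relation.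
Proof.
have [i evi] : exists i, ev (nf i (P i) (Q i)) = 0.
  have /eqP := congr1 ev rel; rewrite (rmorphM ev) (rmorphXn ev)
    ev_g expr0n mulr0 rmorph_prod eq_sym.
  by rewrite prodf_seq_eq0 => /hasP[i _ /andP[_ /eqP]]; exists i.
have [[l [Pl0 Ql0]]|no_common] := classic (exists l, ev (P l) = 0 /\ ev (Q l) = 0).
  exact: smaller_of_common_zero Pl0 Ql0.
have root l : ev (nf l (P l) (Q l)) = 0 -> exists xi,
    [/\ xi \in <<<<1; v0>>; w0>>%VS, xi ^+ 2 = in_alg k (x l) & ev (P l) = - xi * ev (Q l)].
  rewrite rmorph_norm_form point_eval_cst => /eqP; rewrite subr_eq0 => /eqP evl.
  have Ql0 : ev (Q l) != 0.
    apply/eqP => Ql0; apply: no_common; exists l; split=> //.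
    by apply/eqP; rewrite -sqrf_eq0 evl Ql0 expr0n mulr0.
  exists (- ev (P l) / ev (Q l)); split.
  - by rewrite rpredM ?rpredN ?rpredV ?conic_eval_mem.
  - by rewrite expr_div_n sqrrN evl mulfK // expf_neq0.
  - by field.
have [xi [xi_in xiE Pi]] := root i evi.
have [[l [il evl]]|no_other] := classic (exists l, i != l /\ ev (nf l (P l) (Q l)) = 0).
  have [eta [eta_in etaE Pl]] := root l evl.
  exact: smaller_of_two_zeros il xi_in eta_in xiE etaE Pi Pl.
apply: (smaller_of_single_zero _ xi_in xiE Pi) => l li; apply/eqP => evl.
by apply: no_other; exists l; rewrite eq_sym.
Qed.
End DescentStep.

Lemma conic_norm_descent s (g : B) (P Q : I -> B) : s != 0 -> g != 0 -> relation s g P Q ->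
  exists (g0 : E) (p q : I -> E), g0 != 0 /\ norm_relation x s g0 p q.
Proof.
move=> s0; have [n] := ubnP (size (conic_norm g)).
elim: n g P Q => // n IH g P Q sg g0 rel.
have [sg1|/exists_conic_zero[k [v0 [w0 [vw0 ev_g]]]]] := leqP (size (conic_norm g)) 1.
  exact: norm_relation_const s0 g0 rel sg1.
have [g' [P' [Q' [g'0 lt_g' rel']]]] := descent_step g0 rel ev_g.
by apply: IH g'0 rel'; apply: leq_trans lt_g' _; rewrite -ltnS.
Qed.
End Descent.

(** * Products of norms from quadratic extensions *)

Section Norms.
Variables (F : fieldType) (x : F).
Implicit Types f g : F.

Definition is_norm f : Prop := exists p q, f = norm_form x p q.

Lemma is_normM f g : is_norm f -> is_norm g -> is_norm (f * g).
Proof. by move=> [p [q ->]] [p' [q' ->]]; rewrite norm_formM; do 2!eexists. Qed.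

Lemma is_normV f : is_norm f -> is_norm f^-1.
Proof.
move=> [p [q fE]]; exists (f^-1 * p), (f^-1 * q); rewrite norm_form_scale -fE.
by have [->|f0] := eqVneq f 0; [rewrite invr0 mulr0 | field].
Qed.

Lemma is_norm_of_square f y : (2%:R : F) != 0 -> y != 0 -> x = y ^+ 2 -> is_norm f.
Proof.
move=> two0 y0 xE; exists ((f + 1) / 2%:R), ((f - 1) / (2%:R * y)).
by rewrite /norm_form xE; field; rewrite two0 y0.
Qed.
End Norms.

Section NormProducts.
Variables (F : fieldType) (I : finType) (x : I -> F).
Implicit Types f g : F.

Definition norm_product f : Prop :=
  f != 0 /\ exists g p q, g != 0 /\ norm_relation x f g p q.

Lemma norm_productM f g : norm_product f -> norm_product g -> norm_product (f * g).
Proof.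
move=> [f0 [h [p [q [h0 e]]]]] [g0 [h' [p' [q' [h'0 e']]]]]; split; first exact: mulf_neq0.
exists (h * h'), (fun i => p i * p' i + x i * (q i * q' i)), (fun i => p i * q' i + q i * p' i).
split; first exact: mulf_neq0.
rewrite /norm_relation exprMn mulrACA e e' -big_split.
by apply: eq_bigr => i _; apply: norm_formM.
Qed.

Lemma norm_product_sqr f : f != 0 -> norm_product (f ^+ 2).
Proof.
move=> f0; split; first exact: expf_neq0.
exists f^-1, (fun=> 1), (fun=> 0); split; first by rewrite invr_eq0.
by rewrite /norm_relation -exprMn divff // expr1n big1 // => i _; rewrite /norm_form; ring.
Qed.

Lemma norm_product_norm i f : f != 0 -> is_norm (x i) f -> norm_product f.
Proof.
move=> f0 [p [q fE]]; split=> //.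
exists 1, [eta (fun=> 1) with i |-> p], [eta (fun=> 0) with i |-> q]; split; first exact: oner_neq0.
rewrite /norm_relation prod_norm_form_update -fE expr1n big1 // => l _.
by rewrite /norm_form; ring.
Qed.

Lemma norm_product_divr f g : norm_product (f * g) -> norm_product g -> norm_product f.
Proof.
move=> fg g_; have [g0 _] := g_; have -> : f = f * g * g * (g^-1) ^+ 2 by field.
by apply: norm_productM; [apply: norm_productM | apply: norm_product_sqr; rewrite invr_eq0].
Qed.

Lemma norm_productM_sqr f g : g != 0 -> norm_product (f * g ^+ 2) <-> norm_product f.
Proof.
move=> g0; have sqr := norm_product_sqr g0; split=> h; first exact: norm_product_divr h sqr.
exact: norm_productM.
Qed.
End NormProducts.

Lemma eq_norm_product (F : fieldType) (I : finType) (x y : I -> F) f :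
  x =1 y -> norm_product x f -> norm_product y f.
Proof.
move=> xy [f0 [g [p [q [g0 rel]]]]]; split=> //; exists g, p, q; split=> //.
by rewrite /norm_relation rel; apply: eq_bigr => i _; rewrite xy.
Qed.

Lemma rmorph_norm_product (F G : fieldType) (h : {rmorphism F -> G}) (I : finType) (x : I -> F) f :
  norm_product x f -> norm_product (h \o x) (h f).
Proof.
move=> [f0 [g [p [q [g0 rel]]]]]; split; first by rewrite fmorph_eq0.
by exists (h g), (h \o p), (h \o q); rewrite fmorph_eq0; split=> //; apply: rmorph_norm_relation.
Qed.

Lemma norm_product_clear_denominators (R : comNzRingType) (F : fieldType) (ev : {rmorphism R -> F})
    (I : finType) (x : I -> R) (s : R) (i0 : I) :
  is_fraction_field ev -> norm_product (ev \o x) (ev s) ->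
  exists g p q, g != 0 /\ norm_relation x s g p q.
Proof.
move=> [inj frac] [_ [g [p [q [g0 rel]]]]].
have [D D0 hD] := common_denominator (fun f (_ : f \in g :: codom p ++ codom q) => frac f).
have [G gE] := hD g (mem_head _ _).
have /fin_all_exists[P pE] i : exists n, p i = ev n / ev D.
  by apply: hD; rewrite inE mem_cat codom_f orbT.
have /fin_all_exists[Q qE] i : exists n, q i = ev n / ev D.
  by apply: hD; rewrite inE mem_cat codom_f !orbT.
exists (D ^+ #|I| * G), [eta P with i0 |-> D * P i0], [eta Q with i0 |-> D * Q i0]; split.
  rewrite -(inj_eq inj) rmorph0 rmorphM rmorphXn mulf_neq0 ?expf_neq0 //.
  by apply: contra_neq g0 => G0; rewrite gE G0 mul0r.
apply: inj; rewrite prod_norm_form_update norm_form_scale.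
have prodE := bigD1 (P := xpredT) (F := fun l => norm_form (x l) (P l) (Q l)) i0 isT.
rewrite -mulrA -[X in _ = ev (_ * X)]prodE.
have relPQ : \prod_i norm_form (ev (x i)) (ev (P i)) (ev (Q i))
    = ev D ^+ (2 * #|I|) * (ev s * g ^+ 2).
  rewrite rel exprM -prodr_const -big_split; apply: eq_bigr => i _ /=.
  by rewrite -norm_form_scale pE qE; congr norm_form; field.
rewrite !(rmorphM, rmorphXn, rmorph_prod).
under [in RHS]eq_bigr do rewrite rmorph_norm_form.
by rewrite relPQ gE mulnC exprM; field.
Qed.

Lemma irreducible_dvdpM (k : fieldType) (p a b : {poly k}) :
  irreducible_poly p -> (p %| a * b) = (p %| a) || (p %| b).
Proof.
move=> irr; have [pa|npa] := boolP (p %| a); first exact: dvdp_mulr.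
by rewrite Gauss_dvdpr // irreducible_poly_coprime.
Qed.

Lemma irreducible_dvdpX (k : fieldType) (p q : {poly k}) n :
  irreducible_poly p -> p %| q ^+ n -> p %| q.
Proof.
move=> irr; elim: n => [|n IH]; last by rewrite exprS irreducible_dvdpM // => /orP[].
by rewrite expr0 dvdp1 => /eqP p1; case: irr; rewrite p1.
Qed.

Lemma irreducible_cofactor (k : fieldType) (p p' s : {poly k}) m m' :
  irreducible_poly p -> irreducible_poly p' -> (0 < m')%N ->
  ~~ (p %| p' ^+ m' * s) -> ~~ (p' %| s) -> ~~ (p' %| p ^+ m * s).
Proof.
move=> irr irr' m'_gt0 ps p's; rewrite irreducible_dvdpM // (negPf p's) orbF.
apply: contra ps => /(irreducible_dvdpX irr') p'p.
have /andP[_ pp'] : p' %= p by case: irr => _; apply=> //; case: irr' => /gtn_eqF ->.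
by apply: dvdp_trans pp' _; rewrite -(prednK m'_gt0) exprS -mulrA dvdp_mulr.
Qed.

Lemma ltn_size_cofactor (k : fieldType) (p s : {poly k}) m :
  irreducible_poly p -> (0 < m)%N -> s != 0 -> (size s < size (p ^+ m * s)%R)%N.
Proof.
move=> irr m_gt0 s0; have p0 := irredp_neq0 irr; have [p_gt1 _] := irr.
rewrite -(prednK m_gt0) exprSr -mulrA mulrC size_mul ?mulf_neq0 ?expf_neq0 // size_mul //.
have : (0 < size (p ^+ m.-1)%R)%N by rewrite size_poly_gt0 expf_neq0.
by move: (size _) (size p) (size s) p_gt1 => x y z; lia.
Qed.

Lemma irreducible_multiplicity (k : fieldType) (p s : {poly k}) : irreducible_poly p -> s != 0 ->
  exists m s', s = p ^+ m * s' /\ ~~ (p %| s').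
Proof.
move=> [p1 _]; have [n] := ubnP (size s); elim: n s => // n IH s sn s0.
have [/dvdpP[q sE]|ps] := boolP (p %| s); last by exists 0%N, s; rewrite expr0 mul1r.
have q0 : q != 0 by apply: contra_neq s0 => q0; rewrite sE q0 mul0r.
have p0 : p != 0 by rewrite -size_poly_gt0 ltnW.
have [||m [s' [qE ps']]] := IH q => //.
  by move: sn; rewrite sE size_mul //; move: (size q) (size p) p1 => y z; lia.
by exists m.+1, s'; rewrite sE qE exprS; split=> //; ring.
Qed.

Definition pencil_eq (R : pzRingType) (a b c S u v w : R) : Prop :=
  w ^+ 2 = (S + a) * (u ^+ 2 * S + b) * (v ^+ 2 * S + c).

Definition norm_types (R : pzRingType) (a b c : R) (i : 'I_4) : R := [:: a; b; c; a * b * c]`_i.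

Lemma rmorph_norm_types (R S : pzRingType) (f : {rmorphism R -> S}) a b c :
  f \o norm_types a b c =1 norm_types (f a) (f b) (f c).
Proof. by case=> -[|[|[|[|i]]]] //= lti; rewrite /norm_types /= ?rmorphM. Qed.

Lemma norm_types_neq0 (R : idomainType) (a b c : R) i :
  a != 0 -> b != 0 -> c != 0 -> norm_types a b c i != 0.
Proof. by case: i => -[|[|[|[|i]]]] //= lti *; rewrite /norm_types /= ?mulf_neq0. Qed.

Lemma odd_abszD (m n : int) : odd `|(m + n)%R|%N = odd `|m|%N (+) odd `|n|%N.
Proof. by lia. Qed.

Section FractionField.
Variables (k Fr : fieldType) (tf : {rmorphism {poly k} -> Fr}).
Hypothesis tf_frac : is_fraction_field tf.
Local Notation cst := (tf \o polyC).
Implicit Types (p q r s : {poly k}).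

Lemma fraction_field_eq0 p : (tf p == 0) = (p == 0).
Proof. by rewrite -(rmorph0 tf) (inj_eq tf_frac.1). Qed.

(* If x is a square modulo p, say r^2 - x = p q with r reduced, then q has smaller degree than p
   and x is a square modulo q. *)
Lemma divisor_is_norm (x : k) p r : x != 0 -> (2%:R : k) != 0 -> p != 0 ->
  p %| r ^+ 2 - x%:P -> exists2 e : k, e != 0 & is_norm (cst x) (cst e * tf p).
Proof.
move=> x0 two0; have [n] := ubnP (size p); elim: n p r => // n IH p r sp p0.
have [/size1_polyC pE|p_gt1] := leqP (size p) 1.
  have c0 : p`_0 != 0 by apply: contra_neq p0 => c0; rewrite pE c0 polyC0.
  move=> _; exists (p`_0)^-1; first by rewrite invr_eq0.
  exists 1, 0; rewrite {2}pE -[tf _%:P]/(cst _) -rmorphM mulVf // rmorph1.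
  by rewrite /norm_form; ring.
wlog sr : r / (size r < size p)%N.
  move=> reduced pr; apply: (reduced (r %% p)); first by rewrite ltn_modp.
  have -> : (r %% p) ^+ 2 - x%:P = r ^+ 2 - x%:P - p * ((r %/ p) * (r + r %% p)).
    by move: (r %/ p) (r %% p) (divp_eq r p) => q y ->; ring.
  by rewrite dvdp_sub // dvdp_mulr.
move=> /dvdpP[q rE]; have norm_r : is_norm (cst x) (tf p * tf q).
  by exists (tf r), 1; rewrite -rmorphM mulrC -rE rmorphB rmorphXn /norm_form expr1n mulr1.
have [q0|q0] := eqVneq q 0.
  have cx : cst x = tf r ^+ 2.
    by apply/esym/eqP; rewrite -subr_eq0 -rmorphXn -rmorphB rE q0 mul0r rmorph0.
  exists 1; first exact: oner_neq0.
  apply: (is_norm_of_square _ _ _ cx); first by rewrite -(rmorph_nat cst) fmorph_eq0.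
  by rewrite -sqrf_eq0 -cx fmorph_eq0.
have sq : (size q < size p)%N.
  have : (size (r ^+ 2 - x%:P)%R <= maxn (2 * (size p).-1).-1 1)%N.
    rewrite (leq_trans (size_polyD _ _)) // size_polyN geq_max; apply/andP; split.
      by have := size_polyMleq r r; rewrite -expr2; lia.
    by rewrite (leq_trans (size_polyC_leq1 _)) // leq_maxr.
  by rewrite rE size_mul //; move: (size q) (size p) p_gt1 => y z; lia.
have [||e e0 norm_q] := IH q r _ q0 _; first exact: leq_trans sq _.
  by rewrite rE dvdp_mulIl.
exists e^-1; rewrite ?invr_eq0 //.
have -> : cst e^-1 * tf p = tf p * tf q * (cst e * tf q)^-1.
  by rewrite fmorphV; field; rewrite fraction_field_eq0 q0 fmorph_eq0.
by apply: is_normM => //; apply: is_normV.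
Qed.

Lemma norm_product_prime_power (I : finType) (x : I -> k) p m :
  (forall i, x i != 0) -> (2%:R : k) != 0 -> p != 0 ->
  (odd m -> exists i r, p %| r ^+ 2 - (x i)%:P) ->
  exists2 e : k, e != 0 & norm_product (cst \o x) (cst e * tf p ^+ m).
Proof.
move=> x0 two0 p0 odd_m; have tp0 : tf p != 0 by rewrite fraction_field_eq0.
have even_power l : norm_product (cst \o x) (tf p ^+ l.*2).
  by rewrite -muln2 exprM; apply: norm_product_sqr; apply: expf_neq0.
case om : (odd m); last first.
  exists 1; first exact: oner_neq0.
  by rewrite rmorph1 mul1r -(odd_double_half m) om; apply: even_power.
have [i [r pr]] := odd_m om; have [e e0 norm_p] := divisor_is_norm (x0 i) two0 p0 pr.
exists e => //; rewrite -(odd_double_half m) om exprD mulrA expr1; apply: norm_productM => //.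
by apply: (norm_product_norm (i := i)); rewrite // mulf_neq0 // fmorph_eq0.
Qed.

Lemma norm_product_poly (I : finType) (x : I -> k) s :
  (forall i, x i != 0) -> (2%:R : k) != 0 -> s != 0 ->
  (forall p m s', irreducible_poly p -> s = p ^+ m * s' -> ~~ (p %| s') -> odd m ->
     exists i r, p %| r ^+ 2 - (x i)%:P) ->
  exists2 e : k, e != 0 & norm_product (cst \o x) (cst e * tf s).
Proof.
move=> x0 two0; have [n] := ubnP (size s); elim: n s => // n IH s sn s0 odd_part.
have [/size1_polyC sE|s_gt1] := leqP (size s) 1.
  have c0 : s`_0 != 0 by apply: contra_neq s0 => c0; rewrite sE c0 polyC0.
  exists s`_0; rewrite // {2}sE -[tf _%:P]/(cst _) -expr2.
  by apply: norm_product_sqr; rewrite fmorph_eq0.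
have [p irr ps] := exists_irreducible_factor s_gt1.
have [m [s' [sE ps']]] := irreducible_multiplicity irr s0.
have p0 := irredp_neq0 irr.
have s'0 : s' != 0 by apply: contra_neq s0 => s'0; rewrite sE s'0 mulr0.
have m_gt0 : (0 < m)%N.
  by case: m sE => // sE; move: ps'; rewrite -[s']mul1r -(expr0 p) -sE ps.
have [||e' e'0 norm_s'] := IH s' _ s'0.
- by move: sn; rewrite sE ltnS; apply: leq_trans; apply: ltn_size_cofactor.
- move=> p' m' s'' irr' s'E p's'' om'; apply: (odd_part p' m' (p ^+ m * s'')) => //.
    by rewrite sE s'E mulrCA.
  by apply: (irreducible_cofactor m irr irr' (odd_gt0 om') _ p's''); rewrite -s'E.
have [e e0 norm_p] := norm_product_prime_power x0 two0 p0 (odd_part _ _ _ irr sE ps').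
exists (e * e'); first exact: mulf_neq0.
by rewrite sE !rmorphM rmorphXn mulrACA; apply: norm_productM.
Qed.

Section LeadingCoefficients.
Variables (p : {poly k}) (L : fieldExtType k) (th : L).
Hypotheses (p_irr : irreducible_poly p) (p_root : root (map_poly (in_alg L) p) th).
Let ev : {rmorphism {poly k} -> L} := eval_at (in_alg L) th.
Implicit Types (f g S u v w : Fr) (n m : int) (y z : L).

Lemma eval_at_root : ev p = 0.
Proof. exact: eqP p_root. Qed.

Lemma eval_at_root_eq0 q : (ev q == 0) = (p %| q).
Proof.
apply/idP/idP => [|/dvdpP[r ->]]; last by rewrite rmorphM eval_at_root mulr0.
apply: contraLR => npq; have /Bezout_eq1_coprimepP[rs bezout] : coprimep p q.
  by rewrite irreducible_poly_coprime.
apply/eqP => q0; have := congr1 ev bezout.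
by rewrite rmorphD !rmorphM eval_at_root q0 !mulr0 add0r rmorph1 => /esym/eqP; rewrite oner_eq0.
Qed.

(* The p-adic valuation of f is n, and z is the residue of f / p ^ n. *)
Definition leading f n z : Prop :=
  exists q r, [/\ ev q != 0, ev r != 0, f = tf p ^ n * (tf q / tf r) & z = ev q / ev r].

Lemma uniformizer_neq0 : tf p != 0.
Proof. by rewrite fraction_field_eq0 irredp_neq0. Qed.

Lemma tf_ev_neq0 q : ev q != 0 -> tf q != 0.
Proof. by rewrite fraction_field_eq0; apply: contra_neq => ->; rewrite rmorph0. Qed.

Lemma leading_neq0 f n z : leading f n z -> f != 0 /\ z != 0.
Proof.
move=> [q [r [q0 r0 -> ->]]]; have tq0 := tf_ev_neq0 q0; have tr0 := tf_ev_neq0 r0.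
by rewrite !mulf_neq0 ?invr_eq0 // expfz_neq0 // uniformizer_neq0.
Qed.

Lemma leading_poly (m : nat) q : ~~ (p %| q) -> leading (tf (p ^+ m * q)) m (ev q).
Proof.
rewrite -eval_at_root_eq0 => q0; exists q, 1.
by rewrite !rmorph1 !divr1 rmorphM rmorphXn -exprnP q0 oner_neq0.
Qed.

Lemma leading_const (e : k) : e != 0 -> leading (cst e) 0 (in_alg L e).
Proof.
move=> e0; rewrite -(eval_atC (in_alg L) th); have := @leading_poly 0 e%:P.
by rewrite expr0 mul1r; apply; rewrite -eval_at_root_eq0 eval_atC fmorph_eq0.
Qed.

Lemma leading_mul f g n m y z :
  leading f n y -> leading g m z -> leading (f * g) (n + m) (y * z).
Proof.
move=> [q [r [q0 r0 -> ->]]] [q' [r' [q'0 r'0 -> ->]]]; exists (q * q'), (r * r').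
rewrite !rmorphM !mulf_neq0 //; split=> //; last by rewrite mulf_div.
by rewrite expfzDr ?uniformizer_neq0 // -mulf_div mulrACA.
Qed.

Lemma leading_inv f n z : leading f n z -> leading f^-1 (- n) z^-1.
Proof.
move=> [q [r [q0 r0 -> ->]]]; exists r, q; rewrite !invf_div; split=> //.
by rewrite invfM invf_div -exprN1 exprz_exp mulrN1.
Qed.

Lemma leading_exists f : f != 0 -> exists n z, leading f n z.
Proof.
have [q [r [tr0 ->]]] := tf_frac.2 f.
rewrite mulf_eq0 invr_eq0 negb_or tr0 andbT fraction_field_eq0 => q0.
move: tr0; rewrite fraction_field_eq0 => r0.
have [m [q' [-> nq']]] := irreducible_multiplicity p_irr q0.
have [l [r' [-> nr']]] := irreducible_multiplicity p_irr r0.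
do 2!eexists; apply: leading_mul (leading_poly m nq') (leading_inv (leading_poly l nr')).
Qed.

Lemma leading_add f g n m y z : leading f n y -> leading g m z -> n < m -> leading (f + g) n y.
Proof.
move=> [q [r [q0 r0 -> ->]]] [q' [r' [q'0 r'0 -> _]]] nm.
have [d mE] : exists d : nat, m = n + d.+1%:Z by exists `|m - n|%N.-1; lia.
exists (q * r' + p ^+ d.+1 * (q' * r)), (r * r').
have evE : ev (q * r' + p ^+ d.+1 * (q' * r)) = ev q * ev r'.
  by rewrite rmorphD !rmorphM rmorphXn eval_at_root exprS !mul0r addr0.
rewrite evE rmorphM !mulf_neq0 //; split=> //; last by field; rewrite r0 r'0.
rewrite mE expfzDr ?uniformizer_neq0 // -exprnP rmorphD !rmorphM rmorphXn.
by have tr0 := tf_ev_neq0 r0; have tr'0 := tf_ev_neq0 r'0; field; rewrite tr0 tr'0.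
Qed.

Lemma leading1 n z : leading 1 n z -> 0 <= n -> n = 0 /\ z = 1.
Proof.
case: n => // d [q [r [q0 r0 rE ->]]] _; have tr0 := tf_ev_neq0 r0.
have {}rE : r = p ^+ d * q.
  apply: tf_frac.1; rewrite rmorphM rmorphXn -[LHS]mul1r rE -exprnP; field; exact: tr0.
case: d rE => [|d] rE; first by rewrite rE mul1r divff.
by move: r0; rewrite rE rmorphM rmorphXn eval_at_root exprS !mul0r eqxx.
Qed.

Lemma leading_uniq f n m y z : leading f n y -> leading f m z -> n = m /\ y = z.
Proof.
wlog mn : n m y z / m <= n.
  move=> ordered lf lf'; have [mn|/ltW nm] := lerP m n; first exact: ordered.
  by have [-> ->] := ordered _ _ _ _ nm lf' lf.
move=> lf lf'; have [f0 _] := leading_neq0 lf.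
have := leading_mul lf (leading_inv lf'); rewrite divff // => /leading1.
by rewrite subr_ge0 => /(_ mn)[/subr0_eq -> /divr1_eq ->].
Qed.

(* If S has odd valuation, then u^2 S + e has either even valuation and residue e up to squares,
   or odd valuation and the residue of S up to squares. *)
Lemma leading_affine S n t u e : leading S n t -> odd `|n|%N -> e != 0 ->
  exists m y, leading (u ^+ 2 * S + cst e) m y /\
    exists2 h, h != 0 & y = (if odd `|m|%N then t else in_alg L e) * h ^+ 2.
Proof.
move=> lS odd_n e0; have le := leading_const e0.
have residue_e : exists2 h : L, h != 0 & in_alg L e = in_alg L e * h ^+ 2.
  by exists 1; rewrite ?oner_neq0 // expr1n mulr1.
have [->|u0] := eqVneq u 0; first by exists 0, (in_alg L e); rewrite expr0n mul0r add0r.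
have [m [z lu]] := leading_exists u0; have [_ z0] := leading_neq0 lu.
have luS := leading_mul (leading_mul lu lu) lS; rewrite -!expr2 in luS.
have [neg|pos] := ltrP (m + m + n) 0.
  exists (m + m + n), (z ^+ 2 * t); split; first exact: leading_add luS le neg.
  have -> : odd `|(m + m + n)%R|%N by lia.
  by exists z; rewrite // mulrC.
exists 0, (in_alg L e); split=> //; rewrite addrC; apply: leading_add le luS _; lia.
Qed.

Lemma odd_valuation_square (a b c : k) S u v w n t : a != 0 -> b != 0 -> c != 0 ->
  pencil_eq (cst a) (cst b) (cst c) S u v w -> leading S n t -> odd `|n|%N ->
  exists i, is_square (in_alg L (norm_types a b c i)).
Proof.
move=> a0 b0 c0; rewrite /pencil_eq => wE lS odd_n; have [_ t0] := leading_neq0 lS.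
have [m1 [y1 [l1 [h1 h10 y1E]]]] := leading_affine 1 lS odd_n a0.
have [m2 [y2 [l2 [h2 h20 y2E]]]] := leading_affine u lS odd_n b0.
have [m3 [y3 [l3 [h3 h30 y3E]]]] := leading_affine v lS odd_n c0.
rewrite expr1n mul1r in l1.
have l123 := leading_mul (leading_mul l1 l2) l3; rewrite -wE in l123.
have [m [z lw]] : exists m z, leading w m z.
  by apply: leading_exists; have [] := leading_neq0 l123; rewrite expf_eq0.
have [mE] := leading_uniq (leading_mul lw lw) l123.
have := congr1 (fun n => odd `|n|%N) mE; rewrite !odd_abszD addbb => parity.
have square_type i (h : L) : h != 0 -> z * z = in_alg L (norm_types a b c i) * h ^+ 2 ->
    exists i, is_square (in_alg L (norm_types a b c i)).
  by move=> h0 zE; exists i; apply/(is_squareM_sqr _ h0); exists z; rewrite expr2.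
have h0 : h1 * h2 * h3 != 0 by rewrite !mulf_neq0.
rewrite y1E y2E y3E; move: parity.
case: (odd `|m1|%N); case: (odd `|m2|%N); case: (odd `|m3|%N) => // _.
- move=> zE; apply: (square_type (inord 2) (t * (h1 * h2 * h3))); rewrite ?mulf_neq0 // zE.
  by rewrite /norm_types inordK //=; ring.
- move=> zE; apply: (square_type (inord 1) (t * (h1 * h2 * h3))); rewrite ?mulf_neq0 // zE.
  by rewrite /norm_types inordK //=; ring.
- move=> zE; apply: (square_type (inord 0) (t * (h1 * h2 * h3))); rewrite ?mulf_neq0 // zE.
  by rewrite /norm_types inordK //=; ring.
move=> zE; apply: (square_type (inord 3) (h1 * h2 * h3)); rewrite // zE.
by rewrite /norm_types inordK // !(rmorphM (in_alg L)); ring.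
Qed.
End LeadingCoefficients.

Lemma pencil_odd_factor (a b c : k) (S u v w : Fr) p m s q r :
  a != 0 -> b != 0 -> c != 0 -> pencil_eq (cst a) (cst b) (cst c) S u v w ->
  S = tf q / tf r -> tf r != 0 ->
  irreducible_poly p -> q * r = p ^+ m * s -> ~~ (p %| s) -> odd m ->
  exists i t, p %| t ^+ 2 - (norm_types a b c i)%:P.
Proof.
move=> a0 b0 c0 wE SE tr0 irr qrE ps odd_m.
have [L _ [th p_root full]] := irredp_FAdjoin irr.
have [l [y lr]] := leading_exists irr p_root tr0.
have lS := leading_mul irr (leading_poly irr p_root m ps)
  (leading_inv (leading_mul irr lr lr)).
have {lS} lS : leading p th S (m%:Z - (l + l)) (eval_at (in_alg L) th s / (y * y)).
  by move: lS; rewrite -qrE SE rmorphM -mulf_div divff // mulr1.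
have [|i [z zE]] := odd_valuation_square irr p_root a0 b0 c0 wE lS; first by lia.
have /Fadjoin_polyP[t /polyOver1P[t' ->] zt] : z \in <<1; th>>%VS by rewrite full memvf.
exists i, t'; rewrite -(eval_at_root_eq0 irr p_root) rmorphB rmorphXn eval_atC subr_eq0.
by rewrite -[eval_at _ th t']zt; apply/eqP.
Qed.

Lemma norm_class_over_base (a b c : k) (S u v w : Fr) :
  a != 0 -> b != 0 -> c != 0 -> (2%:R : k) != 0 -> S != 0 ->
  pencil_eq (cst a) (cst b) (cst c) S u v w ->
  exists2 d : k, d != 0 & norm_product (cst \o norm_types a b c) (cst d * S).
Proof.
move=> a0 b0 c0 two0 S0 wE; have [q [r [tr0 SE]]] := tf_frac.2 S.
have r0 : r != 0 by rewrite -fraction_field_eq0.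
have q0 : q != 0 by apply: contra_neq S0 => q0; rewrite SE q0 rmorph0 mul0r.
have types0 i := norm_types_neq0 i a0 b0 c0.
have [|d d0 norm_qr] := norm_product_poly types0 two0 (mulf_neq0 q0 r0).
  by move=> p m s irr qrE; apply: pencil_odd_factor wE SE tr0 irr qrE.
exists d => //; apply/(norm_productM_sqr _ _ tr0); move: norm_qr.
by rewrite rmorphM SE; congr norm_product; field.
Qed.
End FractionField.

(** * Square classes on the pencil *)

Section NormClass.
Variables (K : fieldType) (a b c : K).
Hypotheses (a0 : a != 0) (b0 : b != 0) (c0 : c != 0) (two_neq0 : (2%:R : K) != 0).
Hypothesis K_infinite : forall n, exists2 s : seq K, uniq s & size s = n.
Local Notation types := (norm_types a b c).

Definition norm_class_is_constant (k : fieldType) (j : {rmorphism K -> k}) : Prop :=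
  forall S u v w : k, S != 0 -> pencil_eq (j a) (j b) (j c) S u v w ->
  exists2 d : K, d != 0 & norm_product (j \o types) (j d * S).

Lemma norm_class_is_constant_id : norm_class_is_constant idfun.
Proof. by move=> S u v w S0 _; exists S; rewrite //= -expr2; apply: norm_product_sqr. Qed.

Lemma exists_nonroot (k : fieldType) (j : {rmorphism K -> k}) (q : {poly k}) :
  q != 0 -> exists t, q.[t] != 0.
Proof.
move=> q0; have [s us ss] := K_infinite (size q); apply: NNPP => all_roots.
have := @max_poly_roots _ q (map j s) q0.
rewrite size_map ss ltnn (map_inj_uniq (fmorph_inj j)) us => bound.
suff roots : all (root q) (map j s) by have := bound roots isT.
by apply/allP => t _; apply/negPn/negP => qt; apply: all_roots; exists t.
Qed.

Lemma pencil_eq_div (k : fieldType) (a' b' c' D S u v w : k) : D != 0 ->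
  pencil_eq a' b' c' (S / D) (u / D) (v / D) (w / D) <->
  w ^+ 2 * D ^+ 5 = (S + a' * D) * (u ^+ 2 * S + b' * D ^+ 3) * (v ^+ 2 * S + c' * D ^+ 3).
Proof.
move=> D0; have D7 : D ^+ 7 != 0 by apply: expf_neq0.
have -> : w ^+ 2 * D ^+ 5 = (w / D) ^+ 2 * D ^+ 7 by field.
have -> : (S + a' * D) * (u ^+ 2 * S + b' * D ^+ 3) * (v ^+ 2 * S + c' * D ^+ 3) =
    (S / D + a') * ((u / D) ^+ 2 * (S / D) + b') * ((v / D) ^+ 2 * (S / D) + c') * D ^+ 7 by field.
by split=> [->|/(mulIf D7)].
Qed.

Section Step.
Variables (k Fr : fieldType) (j : {rmorphism K -> k}) (tf : {rmorphism {poly k} -> Fr}).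
Hypothesis tf_frac : is_fraction_field tf.
Local Notation cst := (tf \o polyC).

Lemma norm_product_specialize (s : {poly k}) : norm_product (cst \o (j \o types)) (tf s) ->
  exists2 g : {poly k}, g != 0 &
    forall t, g.[t] != 0 -> s.[t] != 0 -> norm_product (j \o types) s.[t].
Proof.
move=> /(norm_product_clear_denominators (x := polyC \o (j \o types)) ord0 tf_frac).
move=> [g [p [q [g0 rel]]]]; exists g => // t gt st; split=> //.
exists g.[t], (fun i => (p i).[t]), (fun i => (q i).[t]); split=> //.
have := rmorph_norm_relation (horner_eval t) rel; rewrite /norm_relation /= /horner_eval => ->.
by apply: eq_bigr => i _; rewrite /= /horner_eval hornerC.
Qed.

Lemma norm_class_is_constant_step :
  norm_class_is_constant j -> norm_class_is_constant (cst \o j).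
Proof.
move=> const_j S u v w S0 wE.
have [d d0 norm_dS] : exists2 d : k, d != 0 & norm_product (cst \o (j \o types)) (cst d * S).
  have [||||d d0 h] := norm_class_over_base tf_frac _ _ _ _ S0 wE; rewrite ?fmorph_eq0 //.
    by rewrite -(rmorph_nat j) fmorph_eq0.
  by exists d => //; apply: eq_norm_product h => i; rewrite /= -(rmorph_norm_types j).
have [D D0 hD] := common_denominator (fun f (_ : f \in [:: S; u; v; w]) => tf_frac.2 f).
have [[S' SE] [u' uE] [v' vE] [w' wE']] :
  [/\ exists n, S = tf n / tf D, exists n, u = tf n / tf D,
      exists n, v = tf n / tf D & exists n, w = tf n / tf D].
  by split; apply: hD; rewrite !inE eqxx ?orbT.
have norm_dSD : norm_product (cst \o (j \o types)) (tf (d%:P * (S' * D))).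
  move: norm_dS; rewrite -(norm_productM_sqr _ _ D0) SE !rmorphM.
  by congr norm_product; rewrite /=; field.
have [g g0 spec] := norm_product_specialize norm_dSD.
have D0' : D != 0 by rewrite -(fraction_field_eq0 tf_frac).
have S'0 : S' != 0 by apply: contra_neq S0 => S'0; rewrite SE S'0 rmorph0 mul0r.
have [t] : exists t, (D * S' * g).[t] != 0 by apply: (exists_nonroot j); rewrite !mulf_neq0.
rewrite !hornerM !mulf_eq0 !negb_or => /andP[/andP[Dt St] gt].
have norm_t : norm_product (j \o types) (d * (S'.[t] * D.[t])).
  by have := spec t gt; rewrite !hornerM hornerC; apply; rewrite !mulf_neq0.
have [||e e0 norm_e] := const_j (S'.[t] / D.[t]) (u'.[t] / D.[t]) (v'.[t] / D.[t]) (w'.[t] / D.[t]).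
- by rewrite mulf_neq0 ?invr_eq0.
- apply/pencil_eq_div => //; have := wE; rewrite SE uE vE wE' => /(pencil_eq_div _ _ _ _ _ _ _ D0).
  rewrite /= -!(rmorphM, rmorphXn, rmorphD) => /tf_frac.1 polyE.
  by have := congr1 (horner^~ t) polyE; rewrite !(hornerM, hornerD, horner_exp, hornerC).
have norm_ed : norm_product (j \o types) (j e * d).
  apply/(norm_productM_sqr _ _ St); have := norm_productM norm_e norm_t.
  by congr norm_product; field.
exists e => //; have cd0 : cst d != 0 by rewrite fmorph_eq0.
apply/(norm_productM_sqr _ _ cd0); have := norm_productM (rmorph_norm_product cst norm_ed) norm_dS.
by congr norm_product; rewrite rmorphM /=; ring.
Qed.
End Step.
End NormClass.

Lemma finite_nonsquareM (K : finFieldType) (a b : K) :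
  ~ is_square a -> ~ is_square b -> is_square (a * b).
Proof.
move=> na nb; have /cyclicP[g gE] := field_unit_group_cyclic [set: {unit K}]%G.
have powers d : ~ is_square d -> exists n, odd n /\ d = val g ^+ n.
  move=> nd; have d0 : d \is a GRing.unit.
    by rewrite unitfE; apply/eqP => d0; apply: nd; exists 0; rewrite d0 expr0n.
  have /cycleP[n nE] : FinRing.unit K d0 \in <[g]>%g by rewrite -gE inE.
  have dE : d = val g ^+ n by rewrite -FinRing.val_unitX -nE.
  exists n; split=> //; apply/negPn/negP => en; apply: nd; exists (val g ^+ n./2).
  by rewrite -exprM muln2 even_halfK.
have [n [on ->]] := powers a na; have [m [om ->]] := powers b nb.
exists (val g ^+ (n + m)./2); rewrite -exprM -exprD muln2 even_halfK //.
by rewrite oddD on om.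
Qed.

Lemma finite_field (K : fieldType) (s : seq K) : (forall z, z \in s) ->
  exists (E : finFieldType) (f : {rmorphism K -> E}), bijective f.
Proof.
move=> sK; have pickleK : pcancel (index^~ s) (onth s).
  by move=> z; rewrite onthE (nth_map z) ?nth_index ?index_mem.
have enumP : Finite.axiom (undup s).
  by move=> z; rewrite count_uniq_mem ?undup_uniq // mem_undup sK.
pose E := HB.pack_for finFieldType K (isCountable.Build K pickleK) (isFinite.Build K enumP).
by exists E, idfun, id.
Qed.

Lemma infinite_of_square_classes (K : fieldType) (a b : K) :
  ~ is_square a -> ~ is_square b -> ~ is_square (a * b) ->
  forall n, exists2 s : seq K, uniq s & size s = n.
Proof.
move=> na nb nab; elim=> [|n [s us sn]]; first by exists [::].
have [[z zs]|all_in] := classic (exists z, z \notin s).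
  by exists (z :: s); rewrite /= ?zs ?us ?sn.
have [|E [f [g fK gK]]] := @finite_field K s.
  by move=> z; apply/negPn/negP => zs; apply: all_in; exists z.
have square_of d : is_square (f d) -> is_square d.
  by move=> [e eE]; exists (g e); apply: (fmorph_inj f); rewrite rmorphXn gK.
case: nab; apply: (square_of (a * b)); rewrite rmorphM.
by apply: finite_nonsquareM; [move/square_of/na | move/square_of/nb].
Qed.

(** * Non-rationality of the pencil *)

Section Towers.
Variables (K F : fieldType) (iota : {rmorphism K -> F}).
Local Notation adj := (adjoin iota).
Local Notation subfield := (subfield_of iota).
Local Notation indep := (indep_over iota (@no_element F)).

Definition sf_base A : {rmorphism K -> subfield A} := sf_lift (@adjoin_base _ _ iota A).

Definition sf_incl A A' (sub : forall f, adj A f -> adj A' f) :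
  {rmorphism subfield A -> subfield A'} :=
  sf_lift (fun z => sub _ (sf_valP z)).

Lemma eval_at_in A A' t : (forall f, adj A f -> adj A' f) -> adj A' t ->
  forall q, adj A' (eval_at (sf_val iota A) t q).
Proof.
move=> sub A't q; apply: adjoin_horner => // i.
by rewrite coef_map; apply: sub; apply: sf_valP.
Qed.

Lemma sf_eval_fraction_field A A' t (A't : forall q, adj A' (eval_at (sf_val iota A) t q)) :
  ~ alg_over iota A t -> (forall f, adj A' f -> adj (with_list A [:: t]) f) ->
  is_fraction_field (sf_lift A't).
Proof.
move=> nt sub.
have inj := transcendental_eval (fmorph_inj (sf_val iota A)) (@sf_valP _ _ iota A) nt.
split=> [q r qr|f]; first by apply: inj; rewrite -!(sf_liftK A't) qr.
have [n [d [d0 fE]]] := adjoin_with_fraction (sub _ (sf_valP f)).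
exists n, d; split; first by rewrite -(fmorph_eq0 (sf_val iota A')).
by apply: (fmorph_inj (sf_val iota A')); rewrite fmorph_div.
Qed.

Section NormClassTower.
Variables (a b c : K).
Hypotheses (a0 : a != 0) (b0 : b != 0) (c0 : c != 0) (two_neq0 : (2%:R : K) != 0).
Hypothesis K_infinite : forall n, exists2 s : seq K, uniq s & size s = n.

Lemma norm_class_is_constant_image (k k' : fieldType) (j : {rmorphism K -> k})
    (j' : {rmorphism K -> k'}) (h : {rmorphism k -> k'}) :
  h \o j =1 j' -> (forall z, exists y, h y = z) ->
  norm_class_is_constant a b c j -> norm_class_is_constant a b c j'.
Proof.
move=> hj surj const_j S' u' v' w' S0 wE.
have [S SE] := surj S'; have [u uE] := surj u'; have [v vE] := surj v'; have [w wE'] := surj w'.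
have [||d d0 norm_d] := const_j S u v w; first by rewrite -(fmorph_eq0 h) SE.
  by apply: (fmorph_inj h); rewrite !(rmorphM, rmorphXn, rmorphD) SE uE vE wE' -!hj in wE *.
exists d => //; have := rmorph_norm_product h norm_d; rewrite rmorphM SE -hj.
by apply: eq_norm_product => i; apply: hj.
Qed.

Lemma norm_class_is_constant_adjoin l : indep l ->
  norm_class_is_constant a b c (sf_base (in_list l)).
Proof.
elim/last_ind: l => [_|l t IH /indep_rcons[/IH const_l nt]].
  apply: (norm_class_is_constant_image (j := idfun) (h := sf_base _)) => // [z|]; last first.
    exact: norm_class_is_constant_id.
  have [y yE] := adjoin_no_generator (fun _ => notF) (sf_valP z).
  by exists y; apply: (fmorph_inj (sf_val iota _)).
have sub : forall f, adj (in_list l) f -> adj (in_list (rcons l t)) f.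
  by move=> f; apply: adjoin_in_list_sub => g gl; rewrite mem_rcons inE gl orbT.
have tA : adj (in_list (rcons l t)) t.
  by apply: adjoin_gen; rewrite /in_list mem_rcons mem_head.
have frac : is_fraction_field (sf_lift (eval_at_in sub tA)).
  apply: sf_eval_fraction_field nt _ => f; apply: adjoin_mono => g.
  by rewrite /in_list mem_rcons inE => /orP[/eqP->|]; [right; rewrite mem_head | left].
have step := norm_class_is_constant_step a0 b0 c0 two_neq0 K_infinite frac const_l.
apply: (norm_class_is_constant_image (h := idfun)) step => z; last by exists z.
by apply: (fmorph_inj (sf_val iota _)); apply: (eval_atC (sf_val iota (in_list l))).
Qed.

Lemma norm_class_is_constant_purely_transcendental A :
  purely_transcendental iota (adj A) -> norm_class_is_constant a b c (sf_base A).
Proof.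
move=> [T iT AT] S u v w S0 wE; pose val := sf_val iota A.
have [|l [ul lT hl]] := @adjoin_finite_seq _ _ iota T (map val [:: S; u; v; w]).
  by move=> f /mapP[z _ ->]; apply/AT; apply: sf_valP.
have il := algebraically_independent_indep iT ul lT.
have sub : forall f, adj (in_list l) f -> adj A f by move=> f lf; apply/AT; apply: adjoin_mono lf.
have lift z : z \in [:: S; u; v; w] -> exists y, sf_incl sub y = z.
  move=> zin; have [y yE] := sf_val_exists (hl _ (map_f val zin)).
  by exists y; apply: (fmorph_inj val); rewrite -yE.
have [[S' SE] [u' uE] [v' vE] [w' wE']] :
  [/\ exists y, sf_incl sub y = S, exists y, sf_incl sub y = u,
    exists y, sf_incl sub y = v & exists y, sf_incl sub y = w].
  by split; apply: lift; rewrite !inE eqxx ?orbT.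
have incl_base z : sf_incl sub (sf_base (in_list l) z) = sf_base A z by apply: (fmorph_inj val).
have [||d d0 norm_d] := @norm_class_is_constant_adjoin l il S' u' v' w'.
- by rewrite -(fmorph_eq0 (sf_incl sub)) SE.
- by apply: (fmorph_inj (sf_incl sub)); move: wE;
    rewrite -SE -uE -vE -wE' -!incl_base !(rmorphM, rmorphXn, rmorphD).
exists d => //; have := rmorph_norm_product (sf_incl sub) norm_d.
by rewrite rmorphM SE incl_base; apply: eq_norm_product => i; apply: incl_base.
Qed.
End NormClassTower.
End Towers.

Lemma square_product_neq0 (F : fieldType) (a b c : F) : ~ square_product a b c ->
  [/\ a != 0, b != 0 & c != 0].
Proof.
move=> nsq; split; apply/eqP => e; apply: nsq.
- by exists true, false, false; split=> //; exists 0; rewrite e expr0n !mul0r.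
- by exists false, true, false; split=> //; exists 0; rewrite e expr0n mulr0 mul0r.
- by exists false, false, true; split=> //; exists 0; rewrite e expr0n mulr0.
Qed.

Lemma rmorph_square_product (F G : fieldType) (f : {rmorphism F -> G}) a b c :
  square_product a b c -> square_product (f a) (f b) (f c).
Proof.
move=> [i [j [l [ijl /(rmorph_is_square f)]]]]; rewrite !rmorphM !rmorphXn => sq.
by exists i, j, l.
Qed.

Section NormTypes.
Variables (F : fieldType) (a b c : F).
Hypothesis nsq : ~ square_product a b c.
Local Notation types := (norm_types a b c).

Lemma monomial_nonsquare (i j l : nat) d :
  odd i || odd j || odd l -> d = a ^+ i * b ^+ j * c ^+ l -> ~ is_square d.
Proof.
move=> ijl -> sq; have [a0 b0 c0] := square_product_neq0 nsq.
by apply: nsq; apply: square_product_odd sq.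
Qed.

Definition norm_type_exponents (i : 'I_4) : bool * bool * bool :=
  nth (false, false, false) [:: (true, false, false); (false, true, false); (false, false, true);
    (true, true, true)] i.
Local Notation exps := norm_type_exponents.

Lemma norm_typesE i : types i = a ^+ (exps i).1.1 * b ^+ (exps i).1.2 * c ^+ (exps i).2.
Proof. by case: i => -[|[|[|[|i]]]] //= lti; rewrite /norm_types /exps /= ?expr0 ?mulr1 ?mul1r. Qed.

Lemma norm_types_nonsquare i : ~ is_square (types i).
Proof.
apply: (monomial_nonsquare _ (norm_typesE i)).
by case: i => -[|[|[|[|i]]]].
Qed.

Lemma norm_types_pair_nonsquare i l : i != l -> ~ is_square (types i * types l).
Proof.
move=> il; apply: (@monomial_nonsquare ((exps i).1.1 + (exps l).1.1) ((exps i).1.2 + (exps l).1.2)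
  ((exps i).2 + (exps l).2)); last by rewrite !norm_typesE !exprD; ring.
by case: i l il => -[|[|[|[|i]]]] // lti [[|[|[|[|l]]]]] // ltl.
Qed.

Lemma norm_types_witness i l : exists z, [/\ z = a * c \/ z = b * c,
  ~ is_square z, ~ is_square (z * types i), ~ is_square (z * types l)
  & ~ is_square (z * types l * types i)].
Proof.
pose s := ~~ (((exps i).1.1 (+) (exps l).1.1) && ((exps i).2 (+) (exps l).2)).
have odd_exps : [/\ odd s || odd (~~ s) || odd 1,
    odd (s + (exps i).1.1) || odd (~~ s + (exps i).1.2) || odd (1 + (exps i).2),
    odd (s + (exps l).1.1) || odd (~~ s + (exps l).1.2) || odd (1 + (exps l).2)
  & odd (s + (exps l).1.1 + (exps i).1.1) || odd (~~ s + (exps l).1.2 + (exps i).1.2)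
    || odd (1 + (exps l).2 + (exps i).2)].
  by rewrite /s; case: i l @s => -[|[|[|[|i]]]] // lti [[|[|[|[|l]]]]] // ltl.
exists (a ^+ s * b ^+ (~~ s) * c); split.
- by case: s odd_exps => _ /=; [left | right]; rewrite expr0 expr1 ?mulr1 ?mul1r.
- by case: odd_exps => h _ _ _; apply: (monomial_nonsquare h).
- by case: odd_exps => _ h _ _; apply: (monomial_nonsquare h); rewrite norm_typesE !exprD; ring.
- by case: odd_exps => _ _ h _; apply: (monomial_nonsquare h); rewrite norm_typesE !exprD; ring.
- by case: odd_exps => _ _ _ h; apply: (monomial_nonsquare h); rewrite !norm_typesE !exprD; ring.
Qed.
End NormTypes.

Section PencilAnisotropic.
Variables (k : fieldType) (a b c u : k).

Definition pencil_factor : {poly k} := ('X + a%:P) * ((u ^+ 2)%:P * 'X + b%:P).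

Lemma polyXsubC_dvd r (p : {poly k}) : p.[r] = 0 -> exists q, p = ('X - r%:P) * q.
Proof. by move=> /eqP/factor_theorem[q ->]; exists q; rewrite mulrC. Qed.

Lemma size_polyXsubC_mul r (p : {poly k}) : size (('X - r%:P) * p) = (size p + (p != 0%R))%N.
Proof.
have [->|p0] := eqVneq p 0; first by rewrite mulr0 size_poly0.
by rewrite size_mul ?polyXsubC_eq0 // size_XsubC add2n addn1.
Qed.

(* At the root r of f, the equation reads r V(r)^2 + c T(r)^2 = 0, so X - r divides V and T and then
   also W; infinite descent. *)
Lemma simple_root_anisotropic (r : k) (h W V T : {poly k}) : c != 0 -> ~ is_square (- r * c) ->
  h.[r] != 0 -> W ^+ 2 = ('X - r%:P) * h * ('X * V ^+ 2 + c%:P * T ^+ 2) -> V = 0 /\ T = 0.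
Proof.
move=> c0 nrc hr; have [n] := ubnP (size V + size T).
elim: n W V T => // n IH W V T sn e; have X0 : 'X - r%:P != 0 by rewrite polyXsubC_eq0.
have [W1 WE] : exists W1, W = ('X - r%:P) * W1.
  apply: polyXsubC_dvd; have := congr1 (horner^~ r) e.
  by rewrite horner_exp !hornerM hornerXsubC subrr !mul0r => /eqP; rewrite sqrf_eq0 => /eqP.
have {e} e : ('X - r%:P) * W1 ^+ 2 = h * ('X * V ^+ 2 + c%:P * T ^+ 2).
  by apply: (mulfI X0); rewrite [RHS]mulrA -e WE; ring.
have norm0 : norm_form (- r * c) (c * T.[r]) V.[r] = 0.
  have := congr1 (horner^~ r) e; rewrite !hornerM hornerXsubC subrr mul0r => /esym/eqP.
  rewrite mulf_eq0 (negPf hr) /= hornerD !hornerM hornerX hornerC -!expr2 => /eqP eV.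
  transitivity (c * (r * V.[r] ^+ 2 + c * T.[r] ^+ 2)); first by rewrite /norm_form; ring.
  by rewrite eV mulr0.
have [/eqP] := norm_form_anisotropic nrc norm0; rewrite mulf_eq0 (negPf c0) => /eqP Tr Vr.
have [V1 VE] := polyXsubC_dvd Vr; have [T1 TE] := polyXsubC_dvd Tr.
have [[V10 T10]|VT] := classic (V1 = 0 /\ T1 = 0); first by rewrite VE TE V10 T10 mulr0.
have [||V10 T10] := IH W1 V1 T1; last by case: VT.
  move: sn VT; rewrite VE TE !size_polyXsubC_mul.
  have [->|V10] := eqVneq V1 0; have [->|T10] := eqVneq T1 0; rewrite ?size_poly0; try lia.
  by move=> _ [].
by apply: (mulfI X0); rewrite e VE TE; ring.
Qed.

Lemma pencil_factor_anisotropic (W V T : {poly k}) : c != 0 -> u != 0 -> u ^+ 2 * a != b ->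
  ~ is_square (a * c) \/ ~ is_square (b * c) ->
  W ^+ 2 = pencil_factor * ('X * V ^+ 2 + c%:P * T ^+ 2) -> V = 0 /\ T = 0.
Proof.
move=> c0 u0 uab nsq e; case: nsq => nsq.
  apply: (@simple_root_anisotropic (- a) ((u ^+ 2)%:P * 'X + b%:P) W) => //.
  - by rewrite opprK.
  - by rewrite !hornerE mulrN addrC subr_eq0 eq_sym.
  - by rewrite e polyCN opprK.
apply: (@simple_root_anisotropic (- b / u ^+ 2) ((u ^+ 2)%:P * ('X + a%:P)) W) => //.
- have -> : - (- b / u ^+ 2) * c = b * c * u^-1 ^+ 2 by field.
  by rewrite is_squareM_sqr // invr_eq0.
- rewrite !hornerE mulf_neq0 ?expf_neq0 //; apply: contra_neq uab => e0.
  transitivity (u ^+ 2 * (- b / u ^+ 2 + a) + b); first by field.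
  by rewrite e0; ring.
rewrite e /pencil_factor; have -> : b%:P = (u ^+ 2)%:P * (b / u ^+ 2)%:P.
  by rewrite -polyCM mulrC divfK ?expf_neq0.
by rewrite mulNr polyCN; ring.
Qed.
End PencilAnisotropic.

Lemma eval_pencil_factor (k k' : fieldType) (h : {rmorphism k -> k'}) a b u S :
  eval_at h S (pencil_factor a b u) = (S + h a) * (h u ^+ 2 * S + h b).
Proof. by rewrite /pencil_factor rmorphM !rmorphD rmorphM eval_atX !eval_atC rmorphXn. Qed.

Lemma even_size_nonsquare (k E : fieldType) (tf : {rmorphism {poly k} -> E}) (q : {poly k}) :
  is_fraction_field tf -> q != 0 -> ~~ odd (size q) -> ~ is_square (tf q).
Proof.
move=> tf_frac q0 even_q [f fE]; have [n [d [d0 fnd]]] := tf_frac.2 f.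
have dq : n ^+ 2 = d ^+ 2 * q.
  apply: tf_frac.1; rewrite !(rmorphXn, rmorphM) -fE fnd expr_div_n mulrC divfK //.
  exact: expf_neq0.
have {}d0 : d != 0 by apply: contra_neq d0 => ->; rewrite rmorph0.
have n0 : n != 0.
  by apply: contra_neq (mulf_neq0 (expf_neq0 2 d0) q0) => n0; rewrite -dq n0 expr0n.
move: dq even_q => /(congr1 (fun p : {poly k} => size p)); rewrite !expr2 !size_mul ?mulf_neq0 //.
move: n0 d0 q0; rewrite -!size_poly_gt0.
by move: (size n) (size d) (size q) => y z t; lia.
Qed.

Section PencilConic.
Variables (k1 E : fieldType) (tf : {rmorphism {poly k1} -> E}) (a b c u : k1).
Hypothesis tf_frac : is_fraction_field tf.
Local Notation cst := (tf \o polyC).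
Hypothesis nsq : ~ square_product (cst a) (cst b) (cst c).
Hypothesis u0 : u != 0.
Local Notation x := (cst \o norm_types a b c).
Local Notation A := (tf (pencil_factor a b u * 'X)).
Local Notation C := (tf (pencil_factor a b u * c%:P)).

Lemma pencil_coefs_neq0 : [/\ a != 0, b != 0 & c != 0].
Proof. by have := square_product_neq0 nsq; rewrite !fmorph_eq0. Qed.

Lemma pencil_point_neq : u ^+ 2 * a != b.
Proof.
apply/eqP => uab; apply: nsq; exists true, true, false; split=> //; exists (cst (u * a)).
by rewrite -rmorphXn -!rmorphXn -!rmorphM -uab; congr (tf _%:P); ring.
Qed.

Lemma pencil_nonsquare e : e != 0 -> ~ is_square (A * cst e).
Proof.
move=> e0; rewrite -rmorphM; have [a0 b0 _] := pencil_coefs_neq0.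
have s1 : size ('X + a%:P) = 2%N by rewrite size_XaddC.
have s2 : size ((u ^+ 2)%:P * 'X + b%:P) = 2%N.
  rewrite size_polyDl ?size_Cmul ?size_polyX ?expf_neq0 //.
  by rewrite (leq_ltn_trans (size_polyC_leq1 _)).
have f0 : pencil_factor a b u != 0 by rewrite mulf_neq0 // -size_poly_eq0 (s1, s2).
have sizeA : size (pencil_factor a b u * 'X * e%:P) = 4%N.
  by rewrite mulrC mul_polyC size_scale // size_mulX // size_mul ?s1 ?s2 // -size_poly_eq0 (s1, s2).
by apply: even_size_nonsquare; rewrite ?sizeA // -size_poly_eq0 sizeA.
Qed.
Hypothesis two_neq0 : (2%:R : k1) != 0.

Section Biquadratic.
Variables (k : fieldExtType E) (xi eta : k) (i l : 'I_4).
Hypotheses (xiE : xi ^+ 2 = in_alg k (x i)) (etaE : eta ^+ 2 = in_alg k (x l)).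

Let io : {rmorphism k1 -> k} := in_alg k \o cst.
Local Notation roots := (in_list [:: xi; eta]).
Local Notation base := (subfield_of io roots).
Let S : k := in_alg k (tf 'X).
Let ev : {rmorphism {poly base} -> k} := eval_at (sf_val io roots) S.

Lemma biquadratic_eval_inj : injective ev.
Proof.
apply: (transcendental_eval (fmorph_inj _) (@sf_valP _ _ io roots)) => alg_S.
have : ~ alg_over io (@no_element k) S.
  apply: (eval_at_inj_transcendental (phi := io)) => [f|q r].
    exact: (adjoin_no_generator (fun _ => id)).
  rewrite -![eval_at io S _](eval_at_uniq (in_alg k \o tf)) => /fmorph_inj; apply: tf_frac.1.
apply; apply: alg_over_trans alg_S => f; rewrite /in_list !inE => /orP[]/eqP->;
  by apply: alg_over_sqrt; rewrite (xiE, etaE); apply: adjoin_alg_over; apply: adjoin_base.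
Qed.

Lemma biquadratic_base_root t : t \in [:: xi; eta] -> exists z : base, sf_val io roots z = t.
Proof. by move=> tin; apply: sf_val_exists; apply: adjoin_gen. Qed.

Lemma biquadratic_fraction f : f \in <<<<1; xi>>; eta>>%VS -> fraction_of ev f.
Proof.
have ev_poly q : in_alg k (tf q) = ev (map_poly (sf_base io roots) q).
  apply: etrans (eval_at_uniq (in_alg k \o tf) q) _.
  exact: esym (eval_at_map (sf_base io roots) (sf_val io roots) S q).
have scalar e : fraction_of ev (in_alg k e).
  have [n [d [d0 ->]]] := tf_frac.2 e.
  exists (map_poly (sf_base io roots) n), (map_poly (sf_base io roots) d); rewrite -!ev_poly.
  by split; [rewrite fmorph_eq0 | apply: (fmorph_div (in_alg k))].
have root t : t \in [:: xi; eta] -> fraction_of ev t.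
  move=> /biquadratic_base_root[z <-]; rewrite -(eval_atC (sf_val io roots) S);
    exact: fraction_of_eval.
have xi_sq : xi ^+ 2 \in 1%VS by rewrite xiE (scalar_mem 1%AS).
have eta_sq : eta ^+ 2 \in <<1; xi>>%VS by rewrite etaE scalar_mem.
case/(mem_adjoin_sqrt eta_sq) => f0 [f1 [f0_in f1_in ->]].
have linear t : t \in <<1; xi>>%VS -> fraction_of ev t.
  case/(mem_adjoin_sqrt xi_sq) => _ [_ [/vlineP[e0 ->] /vlineP[e1 ->] ->]].
  apply: fraction_ofD; first exact: (scalar e0).
  by apply: fraction_ofM; [apply: (scalar e1) | apply: root; rewrite mem_head].
apply: fraction_ofD; first exact: linear.
by apply: fraction_ofM; [apply: linear | apply: root; rewrite !inE eqxx orbT].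
Qed.

Lemma adjoin_roots_biquadratic f : adjoin io roots f -> f \in <<<<1; xi>>; eta>>%VS.
Proof.
elim=> [e|g|g g' _ h1 _ h2|g _ h1|g g' _ h1 _ h2|g _ h1].
- exact: scalar_mem.
- rewrite /in_list !inE => /orP[]/eqP->; last exact: memv_adjoin.
  by apply: (subvP (subv_adjoin _ _)); apply: memv_adjoin.
- exact: rpredD.
- by rewrite rpredN.
- exact: rpredM.
- by rewrite rpredV.
Qed.

Lemma biquadratic_base_nonsquare d : ~ is_square (cst d) -> ~ is_square (cst d * x i) ->
  ~ is_square (cst d * x l) -> ~ is_square (cst d * x l * x i) ->
  ~ is_square (sf_base io roots d).
Proof.
move=> nd ndi ndl ndli [t tE]; have [a0 b0 c0] := pencil_coefs_neq0.
have x0 m : x m != 0 by rewrite fmorph_eq0 norm_types_neq0.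
have two0 : (2%:R : E) != 0 by rewrite -(rmorph_nat cst) fmorph_eq0.
have tE' : sf_val io roots t ^+ 2 = in_alg k (cst d).
  by rewrite -rmorphXn tE.
have /(sqrt_mem_adjoin2 two0 (x0 i) (x0 l) xiE etaE tE') := adjoin_roots_biquadratic (sf_valP t).
by case=> -[].
Qed.

Lemma biquadratic_base_nonsquare_product :
  let h := sf_base io roots in ~ is_square (h a * h c) \/ ~ is_square (h b * h c).
Proof.
have [z [z_cases nz nzi nzl nzli]] := norm_types_witness nsq i l.
rewrite -!(rmorph_norm_types cst) in nzi nzl nzli.
by case: z_cases => zE; [left | right]; rewrite -rmorphM; apply: biquadratic_base_nonsquare;
  rewrite rmorphM -zE.
Qed.
End Biquadratic.

Lemma pencil_conic_anisotropic (k : fieldExtType E) (xi eta : k) i l :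
  xi ^+ 2 = in_alg k (x i) -> eta ^+ 2 = in_alg k (x l) ->
  conic_anisotropic A C <<<<1; xi>>; eta>>%AS.
Proof.
move=> xiE etaE f0 f1 f2 f0_in f1_in f2_in e.
have [a0 b0 c0] := pencil_coefs_neq0.
pose io : {rmorphism k1 -> k} := in_alg k \o cst.
pose roots := in_list [:: xi; eta]; pose S : k := in_alg k (tf 'X).
pose ev : {rmorphism {poly subfield_of io roots} -> k} := eval_at (sf_val io roots) S.
have inj : injective ev := biquadratic_eval_inj xiE etaE.
have [|D D0 hD] := @common_denominator _ _ ev [:: f0; f1; f2].
  by move=> f; rewrite !inE => /or3P[]/eqP->; apply: (biquadratic_fraction xiE etaE).
have [[W WE] [V VE] [T TE]] :
  [/\ exists n, f0 = ev n / ev D, exists n, f1 = ev n / ev D & exists n, f2 = ev n / ev D].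
  by split; apply: hD; rewrite !inE eqxx ?orbT.
pose h := sf_base io roots.
have tf_factor : in_alg k (tf (pencil_factor a b u)) = ev (pencil_factor (h a) (h b) (h u)).
  apply: etrans (eval_at_uniq (in_alg k \o tf) _) _.
  by rewrite !eval_pencil_factor.
have eqWVT : ev (W ^+ 2) = ev (pencil_factor (h a) (h b) (h u) * ('X * V ^+ 2 + (h c)%:P * T ^+ 2)).
  have AE : in_alg k A = in_alg k (tf (pencil_factor a b u)) * S.
    by rewrite -(rmorphM (in_alg k)) -(rmorphM tf).
  have CE : in_alg k C = in_alg k (tf (pencil_factor a b u)) * sf_val io roots (h c).
    by rewrite -[sf_val _ _ _]/(in_alg k (cst c)) -(rmorphM (in_alg k)) -(rmorphM tf).
  rewrite (rmorphXn ev) [RHS](rmorphM ev) -tf_factor (rmorphD ev).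
  rewrite (rmorphM ev 'X) (rmorphM ev _%:P) !(rmorphXn ev) eval_atX eval_atC.
  have -> : ev W ^+ 2 = (ev W / ev D) ^+ 2 * ev D ^+ 2 by field.
  by rewrite -WE e AE CE VE TE; field.
have uab : h u ^+ 2 * h a != h b.
  by rewrite -rmorphXn -rmorphM (inj_eq (fmorph_inj _)) pencil_point_neq.
have [||V0 T0] := pencil_factor_anisotropic _ _ uab
  (biquadratic_base_nonsquare_product xiE etaE) (inj _ _ eqWVT).
- by rewrite fmorph_eq0.
- by rewrite fmorph_eq0.
by rewrite VE TE V0 T0 rmorph0 mul0r.
Qed.

End PencilConic.

Lemma odd_size_norm_form (k : fieldType) (x : k) (p q : {poly k}) : ~ is_square x ->
  norm_form x%:P p q != 0 -> odd (size (norm_form x%:P p q)).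
Proof.
move=> nx pq0; have x0 := nonsquare_neq0 nx.
have [q0|q0] := eqVneq q 0.
  move: pq0; rewrite q0 /norm_form expr0n mulr0 subr0 sqrf_eq0 -size_poly_gt0 => p_gt0.
  by rewrite expr2 size_mul -?size_poly_gt0 //; move: (size p) p_gt0 => n; lia.
rewrite size_norm_form //; first by move: q0; rewrite -size_poly_gt0;
  move: (size p) (size q) => m n; lia.
apply: contra_not_neq nx => lead; exists (lead_coef p / lead_coef q).
by rewrite expr_div_n lead mulfK // expf_neq0 // lead_coef_eq0.
Qed.

Lemma odd_size_norm_relation (k : fieldType) (I : finType) (x : I -> k) (s g : {poly k})
    (p q : I -> {poly k}) :
  (forall i, ~ is_square (x i)) -> s != 0 -> g != 0 -> norm_relation (polyC \o x) s g p q ->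
  odd (size s).
Proof.
move=> nx s0 g0 rel; have factor0 i : norm_form (x i)%:P (p i) (q i) != 0.
  have : \prod_i norm_form (x i)%:P (p i) (q i) != 0 by rewrite -rel mulf_neq0 ?expf_neq0.
  by move/prodf_neq0; apply.
have [_] : \prod_i norm_form (x i)%:P (p i) (q i) != 0 /\
    odd (size (\prod_i norm_form (x i)%:P (p i) (q i))).
  elim/big_ind: _ => [|f h [f0 odd_f] [h0 odd_h]|i _]; first by rewrite oner_neq0 size_poly1.
    by rewrite mulf_neq0 // size_mul //; split=> //;
      move: (size f) (size h) odd_f odd_h => m n; lia.
  by split; last exact: odd_size_norm_form.
rewrite -rel size_mul ?expf_neq0 // expr2 size_mul //.
by move: s0 g0; rewrite -!size_poly_gt0; move: (size s) (size g) => m n; lia.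
Qed.

Lemma pencil_base_not_norm (k1 E F : fieldType) (tf : {rmorphism {poly k1} -> E})
    (phi : {rmorphism E -> F}) (a b c u d : k1) (v w : F)
    (vw : on_conic (tf (pencil_factor a b u * 'X)) (tf (pencil_factor a b u * c%:P)) phi v w) :
  is_fraction_field tf -> is_fraction_field (conic_eval vw) -> (2%:R : k1) != 0 ->
  u != 0 -> d != 0 ->
  ~ square_product (phi (tf a%:P)) (phi (tf b%:P)) (phi (tf c%:P)) ->
  ~ norm_product (phi \o (tf \o (polyC \o norm_types a b c))) (phi (tf (d%:P * 'X))).
Proof.
move=> tf_frac ev_frac two0 u0 d0 nsqF; pose x := tf \o (polyC \o norm_types a b c).
have nsq : ~ square_product (tf a%:P) (tf b%:P) (tf c%:P).
  by move=> /(rmorph_square_product phi).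
have [a0 b0 c0] := pencil_coefs_neq0 nsq.
have typesE i : norm_types (phi (tf a%:P)) (phi (tf b%:P)) (phi (tf c%:P)) i = phi (x i).
  by rewrite -(rmorph_norm_types (phi \o tf \o polyC)).
have nx i : ~ is_square (phi (x i)) by rewrite -typesE; apply: norm_types_nonsquare.
have nxx i l : i != l -> ~ is_square (phi (x i * x l)).
  by rewrite rmorphM -!typesE; apply: norm_types_pair_nonsquare.
have twoE : (2%:R : E) != 0 by rewrite -(rmorph_nat (tf \o polyC)) fmorph_eq0.
have nAe e := @pencil_nonsquare _ _ _ _ _ _ _ tf_frac nsq u0 e.
have nA : ~ is_square (tf (pencil_factor a b u * 'X)).
  by have := nAe 1 (oner_neq0 _); rewrite rmorph1 mulr1.
have nAx i := nAe _ (norm_types_neq0 i a0 b0 c0).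
have other (i : 'I_4) : exists l, i != l.
  by exists (if i == ord0 then ord_max else ord0); have [->|] := eqVneq i ord0.
have aniso (k : fieldExtType E) (xi eta : k) i l (_ : i != l) :=
  @pencil_conic_anisotropic _ _ _ _ _ _ _ tf_frac nsq u0 two0 k xi eta i l.
have dX0 : d%:P * 'X != 0 by rewrite mulf_neq0 ?polyC_eq0 ?polyX_eq0.
have s0 : tf (d%:P * 'X) != 0 by rewrite fraction_field_eq0.
rewrite -(conic_eval_cst vw) => norm_dX.
have {norm_dX} norm_dX : norm_product (conic_eval vw \o (conic_cst _ _ \o x))
    (conic_eval vw (conic_cst _ _ (tf (d%:P * 'X)))).
  by apply: eq_norm_product norm_dX => i; rewrite /= conic_eval_cst.
have [g [p [q [g0 rel]]]] := norm_product_clear_denominators ord0 ev_frac norm_dX.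
have [g1 [p1 [q1 [g10 rel1]]]] :=
  conic_norm_descent ev_frac.1 twoE nA nAx nx nxx other aniso s0 g0 rel.
have norm_dX1 : norm_product x (tf (d%:P * 'X)) by split=> //; exists g1, p1, q1.
have [g2 [p2 [q2 [g20 rel2]]]] := norm_product_clear_denominators ord0 tf_frac norm_dX1.
have nx1 i : ~ is_square (norm_types a b c i).
  by move=> /(rmorph_is_square (phi \o tf \o polyC))/nx.
by have := odd_size_norm_relation nx1 dX0 g20 rel2; rewrite size_Cmul // size_polyX.
Qed.

Lemma pencil_eq_on_conic (k1 E F : fieldType) (tf : {rmorphism {poly k1} -> E})
    (phi : {rmorphism E -> F}) a b c u v w :
  let g : {rmorphism {poly k1} -> F} := phi \o tf in
  pencil_eq (g a%:P) (g b%:P) (g c%:P) (g 'X) (g u%:P) v w ->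
  on_conic (tf (pencil_factor a b u * 'X)) (tf (pencil_factor a b u * c%:P)) phi v w.
Proof.
move=> g; rewrite /pencil_eq /on_conic => ->; rewrite -![phi (tf _)]/(g _).
have -> : g (pencil_factor a b u * 'X) = g (pencil_factor a b u) * g 'X by apply: rmorphM.
have -> : g (pencil_factor a b u * c%:P) = g (pencil_factor a b u) * g c%:P by apply: rmorphM.
by rewrite /pencil_factor (rmorphM g) !(rmorphD g) (rmorphM g) polyC_exp (rmorphXn g); ring.
Qed.

Lemma conic_eval_inj (E F : fieldType) (j : {rmorphism E -> F}) (A C : E) (v w : F)
    (vw : on_conic A C j v w) :
  ~ is_square A -> injective (eval_at j v) -> injective (conic_eval vw).
Proof.
move=> nA inj; apply: raddf_inj => b b0; apply/eqP; rewrite -(conic_norm_eq0 nA); apply/eqP.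
by apply: inj; rewrite (eval_conic_norm vw) b0 mul0r rmorph0.
Qed.

Lemma sf_fraction_field (K F : fieldType) (iota : {rmorphism K -> F}) (A : F -> Prop)
    (R : comNzRingType) (ev : {rmorphism R -> subfield_of iota A}) :
  injective ev -> (forall z, exists r, sf_val iota A (ev r) = iota z) ->
  (forall f, A f -> exists r, sf_val iota A (ev r) = f) -> is_fraction_field ev.
Proof.
move=> inj base gen; split=> // f; pose val_ev := sf_val iota A \o ev.
have [|g Ag|n [d [d0 fE]]] := @adjoin_fraction _ _ iota _ val_ev A _ _ _ (sf_valP f).
- by move=> z; have [r <-] := base z; apply: (fraction_of_eval val_ev).
- by have [r <-] := gen g Ag; apply: (fraction_of_eval val_ev).
exists n, d; split; first by rewrite -(fmorph_eq0 (sf_val iota A)).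
by apply: (fmorph_inj (sf_val iota A)); rewrite fmorph_div.
Qed.

Section PencilNonrational.
Variables (K F : fieldType) (iota : {rmorphism K -> F}) (a b c : K) (S u v w : F).
Hypothesis two_neq0 : (2%:R : K) != 0.
Hypothesis nsq : ~ square_product (iota a) (iota b) (iota c).
Hypothesis uSv_indep : indep_over iota (@no_element F) [:: u; S; v].
Hypothesis wE : pencil_eq (iota a) (iota b) (iota c) S u v w.
Local Notation adj l := (adjoin iota (in_list l)).
Local Notation gens := (in_list [:: S; u; v; w]).
Local Notation L := (subfield_of iota gens).
Local Notation val_L := (sf_val iota gens).

Lemma gens_sf_val f : f \in [:: S; u; v; w] -> exists z : L, val_L z = f.
Proof. by move=> fin; apply: sf_val_exists; apply: adjoin_gen. Qed.

Lemma pencil_tower (SL uL vL : L) : val_L SL = S -> val_L uL = u -> val_L vL = v ->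
  exists (k1 E : fieldType) (h : {rmorphism K -> k1}) (tf : {rmorphism {poly k1} -> E})
         (phi : {rmorphism E -> L}) (uk : k1),
  [/\ is_fraction_field tf, injective (eval_at phi vL), phi (tf 'X) = SL, phi (tf uk%:P) = uL
    & forall z, phi (tf (h z)%:P) = sf_base iota gens z].
Proof.
move=> SLE uLE vLE.
have /indep_rcons[uS_indep nv] : indep_over iota (@no_element F) (rcons [:: u; S] v) by [].
have /indep_rcons[_ nS] : indep_over iota (@no_element F) (rcons [:: u] S) by [].
have sub1 f : adj [:: u] f -> adj [:: u; S] f.
  by apply: adjoin_in_list_sub => g; rewrite !inE => ->.
have sub2 f : adj [:: u; S] f -> adj [:: S; u; v; w] f.
  by apply: adjoin_in_list_sub => g; rewrite !inE => /orP[]->; rewrite ?orbT.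
have S_in : adj [:: u; S] S by apply: adjoin_gen; rewrite /in_list !inE eqxx orbT.
have [uk ukE] : exists uk, sf_val iota (in_list [:: u]) uk = u.
  by apply: sf_val_exists; apply: adjoin_gen; rewrite /in_list inE.
exists (subfield_of iota (in_list [:: u])), (subfield_of iota (in_list [:: u; S])).
exists (sf_base iota _), (sf_lift (eval_at_in sub1 S_in)), (sf_incl sub2), uk; split.
- apply: sf_eval_fraction_field nS _ => f; apply: adjoin_mono => g.
  by rewrite /in_list !inE => /orP[]/eqP->; [left; rewrite /in_list inE | right; rewrite inE].
- move=> q r /(congr1 val_L); rewrite !rmorph_eval_at vLE.
  exact: (transcendental_eval (fmorph_inj (sf_val iota _)) (@sf_valP _ _ iota _) nv).
- by apply: (fmorph_inj val_L); rewrite SLE; apply: (eval_atX (sf_val iota (in_list [:: u]))).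
- apply: (fmorph_inj val_L); rewrite uLE -[RHS]ukE.
  exact: (eval_atC (sf_val iota (in_list [:: u]))).
- move=> z; apply: (fmorph_inj val_L).
  exact: (eval_atC (sf_val iota (in_list [:: u])) S (sf_base iota _ z)).
Qed.

Lemma pencil_parameter_not_norm (SL uL vL wL : L) d :
  val_L SL = S -> val_L uL = u -> val_L vL = v -> val_L wL = w -> d != 0 ->
  ~ norm_product (sf_base iota gens \o norm_types a b c) (sf_base iota gens d * SL).
Proof.
move=> SLE uLE vLE wLE d0.
have [k1 [E [h [tf [phi [uk [tf_frac v_inj phiX phi_u phiC]]]]]]] := pencil_tower SLE uLE vLE.
have nsqL : ~ square_product (phi (tf (h a)%:P)) (phi (tf (h b)%:P)) (phi (tf (h c)%:P)).
  by rewrite !phiC => /(rmorph_square_product val_L).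
have vw : on_conic (tf (pencil_factor (h a) (h b) uk * 'X))
    (tf (pencil_factor (h a) (h b) uk * (h c)%:P)) phi vL wL.
  apply: pencil_eq_on_conic; rewrite /= !phiC phiX phi_u; apply: (fmorph_inj val_L).
  by rewrite !(rmorphM, rmorphD, rmorphXn) SLE uLE vLE wLE.
have uk0 : uk != 0.
  have : ~ alg_over iota (@no_element F) u by apply: (indep_mem uSv_indep); rewrite mem_head.
  apply: contra_not_neq => uk0; rewrite -uLE -phi_u uk0 !rmorph0.
  by apply: adjoin_alg_over; apply: adjoin0.
have nsqE : ~ square_product (tf (h a)%:P) (tf (h b)%:P) (tf (h c)%:P).
  by move=> /(rmorph_square_product phi).
have nA := pencil_nonsquare tf_frac nsqE uk0 (oner_neq0 _); rewrite rmorph1 mulr1 in nA.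
have ev_frac : is_fraction_field (conic_eval vw).
  apply: sf_fraction_field (conic_eval_inj nA v_inj) _ _ => [z|f].
    by exists (conic_cst _ _ (tf (h z)%:P)); rewrite conic_eval_cst phiC.
  rewrite /in_list !inE => /or4P[]/eqP->.
  - by exists (conic_cst _ _ (tf 'X)); rewrite conic_eval_cst phiX.
  - by exists (conic_cst _ _ (tf uk%:P)); rewrite conic_eval_cst phi_u.
  - by exists (conic_of_poly _ _ 'X); rewrite conic_eval_of_poly eval_atX.
  - by exists (0, 1); rewrite conic_evalE rmorph0 rmorph1 add0r mul1r.
have two0 : (2%:R : k1) != 0 by rewrite -(rmorph_nat h) fmorph_eq0.
have hd0 : h d != 0 by rewrite fmorph_eq0.
move=> norm_d; apply: (pencil_base_not_norm tf_frac ev_frac two0 uk0 hd0 nsqL).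
have -> : phi (tf ((h d)%:P * 'X)) = sf_base iota gens d * SL.
  by rewrite (rmorphM tf) (rmorphM phi) phiC phiX.
apply: eq_norm_product norm_d => i.
by rewrite /= -(rmorph_norm_types h) /= phiC.
Qed.

Lemma pencil_nonrational : ~ purely_transcendental iota (adj [:: S; u; v; w]).
Proof.
move=> pt; have nsqK : ~ square_product a b c by move=> /(rmorph_square_product iota).
have [a0 b0 c0] := square_product_neq0 nsqK.
have K_infinite : forall n, exists2 s : seq K, uniq s & size s = n.
  apply: (@infinite_of_square_classes K a b).
  - by apply: (@monomial_nonsquare _ _ _ _ nsqK 1 0 0); rewrite // ?expr0 ?mulr1.
  - by apply: (@monomial_nonsquare _ _ _ _ nsqK 0 1 0); rewrite // ?expr0 ?mulr1 ?mul1r.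
  - by apply: (@monomial_nonsquare _ _ _ _ nsqK 1 1 0); rewrite // ?expr0 ?mulr1.
have [[SL SLE] [uL uLE] [vL vLE] [wL wLE]] : [/\ exists z, val_L z = S, exists z, val_L z = u,
    exists z, val_L z = v & exists z, val_L z = w].
  by split; apply: gens_sf_val; rewrite !inE eqxx ?orbT.
have [||d d0] := norm_class_is_constant_purely_transcendental a0 b0 c0 two_neq0 K_infinite pt
  (S := SL) (u := uL) (v := vL) (w := wL).
- have : ~ alg_over iota (@no_element F) S by apply: (indep_mem uSv_indep); rewrite !inE eqxx orbT.
  apply: contra_not_neq => SL0; rewrite -SLE SL0 rmorph0.
  by apply: adjoin_alg_over; apply: adjoin0.
- by apply: (fmorph_inj val_L); rewrite !(rmorphM, rmorphD, rmorphXn) SLE uLE vLE wLE.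
exact: (pencil_parameter_not_norm SLE uLE vLE wLE d0).
Qed.
End PencilNonrational.

(** * Fields with three generators *)

Ltac adjoin_mem := repeat first [ assumption
  | by apply: adjoin_gen; rewrite /in_list !inE !eqxx ?orbT
  | apply: adjoin_base | apply: adjoin0 | apply: adjoin1 | apply: adjoin_nat | apply: adjoin_exp
  | apply: adjoin_sub | apply: adjoin_add | apply: adjoin_opp | apply: adjoin_div
  | apply: adjoin_mul | apply: adjoin_inv ].
Ltac nonzero := by repeat (apply/andP; split).

Section ThreeGenerators.
Variables (K F : fieldType) (iota : {rmorphism K -> F}).
Local Notation adj l := (adjoin iota (in_list l)).
Local Notation indep := (indep_over iota (@no_element F)).
Implicit Types (l : seq F) (f t : F).

Fixpoint all_adjoin (A : F -> Prop) l : Prop :=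
  if l is f :: l' then adjoin iota A f /\ all_adjoin A l' else True.

Lemma all_adjoinP A l f : all_adjoin A l -> f \in l -> adjoin iota A f.
Proof. by elim: l => //= g l IH [Ag Al]; rewrite inE => /orP[/eqP->|/IH]; auto. Qed.

Lemma adjoin_eq l l' : all_adjoin (in_list l') l -> all_adjoin (in_list l) l' ->
  forall f, adj l f <-> adj l' f.
Proof. by move=> ll' l'l f; split; apply: adjoin_trans => g; apply: all_adjoinP. Qed.

Lemma indep_neq l t f : indep (rcons l t) -> adj l f -> t != f.
Proof.
by move=> /indep_rcons[_ nt] lf; apply/eqP => tf; apply: nt; rewrite tf; apply: adjoin_alg_over.
Qed.

Lemma indep_adjoin l l' : indep l -> (size l' <= size l)%N -> all_adjoin (in_list l') l -> indep l'.
Proof.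
move=> il sl' all; apply: (indep_exchange il sl') => f fl.
by apply: adjoin_alg_over; apply: all_adjoinP fl.
Qed.

Lemma indep_perm l l' : perm_eq l l' -> indep l -> indep l'.
Proof.
move=> pll' il; apply: (indep_exchange il); first by rewrite (perm_size pll').
by move=> f; rewrite (perm_mem pll') => fl'; apply: adjoin_alg_over; apply: adjoin_gen.
Qed.

Lemma indep3_neq z1 z2 z3 : indep [:: z1; z2; z3] ->
  [/\ forall f, adj [:: z2; z3] f -> z1 != f, forall f, adj [:: z1; z3] f -> z2 != f
    & forall f, adj [:: z1; z2] f -> z3 != f].
Proof.
move=> iz; split=> f; apply: indep_neq; apply: indep_perm iz => //.
  by rewrite -[[:: z1; _; _]]/([:: z1] ++ [:: z2; z3]) perm_catC.
by rewrite /= perm_cons -[[:: z2; _]]/([:: z2] ++ [:: z3]) perm_catC.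
Qed.

Definition three_generated (L : F -> Prop) : Prop :=
  exists y1 y2 y3, forall f, L f <-> adj [:: y1; y2; y3] f.

Lemma three_generated_eq (L L' : F -> Prop) : (forall f, L f <-> L' f) ->
  three_generated L -> three_generated L'.
Proof. by move=> LL' [y1 [y2 [y3 yE]]]; exists y1, y2, y3 => f; rewrite -LL'. Qed.

Lemma three_generated_list l y1 y2 y3 : all_adjoin (in_list l) [:: y1; y2; y3] ->
  all_adjoin (in_list [:: y1; y2; y3]) l -> three_generated (adj l).
Proof. by move=> ly yl; exists y1, y2, y3; apply: adjoin_eq. Qed.

(** * Elimination in triangular systems *)

Lemma adjoin_solve_pair M (a b m n y z : F) (e e' : bool) :
  adj M a -> adj M b -> adj M m -> adj M n -> a != 0 -> b != 0 -> y != 0 -> z != 0 -> z != 1 - y ->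
  a * (1 - y) = m * z ^+ e -> b * (1 - z) = n * y ^+ e' -> adj M y /\ adj M z.
Proof.
move=> Ma Mb Mm Mn a0 b0 y0 z0 yz ya zb.
have yE : y = 1 - m * z ^+ e / a by rewrite -ya; field.
have zE : z = 1 - n * y ^+ e' / b by rewrite -zb; field.
case: e ya yE => ya yE; last first.
  have My : adj M y by rewrite yE; adjoin_mem.
  by split=> //; rewrite zE; adjoin_mem.
case: e' zb zE => zb zE; last first.
  have Mz : adj M z by rewrite zE; adjoin_mem.
  by split=> //; rewrite yE; adjoin_mem.
have mE : m = a * (1 - y) / z by rewrite ya expr1 mulfK.
have nE : n = b * (1 - z) / y by rewrite zb expr1 mulfK.
have det : a * b - m * n != 0.
  have -> : a * b - m * n = a * b * (z - (1 - y)) / (y * z) by rewrite mE nE; field; nonzero.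
  by rewrite !mulf_neq0 ?invr_neq0 ?subr_eq0 ?mulf_neq0.
have My : adj M y.
  have -> : y = b * (a - m) / (a * b - m * n).
    by apply: (mulIf det); rewrite divfK // mE nE; field; nonzero.
  by adjoin_mem.
by split=> //; rewrite zE; adjoin_mem.
Qed.

(* The element t = W r E / (1 - z) satisfies t^2 (1 - z) = c be (al0 - al1 z), which is linear
   in z. *)
Lemma adjoin_solve_last M (c be W B E r z al0 al1 : F) :
  c * (1 - z) = W * r ^+ 2 -> W * E = be * B -> B * E = al0 - al1 * z ->
  1 - z != 0 -> c * be != 0 -> al0 != al1 ->
  adj M (c * be) -> adj M al0 -> adj M al1 -> adj M (W * r * E / (1 - z)) -> adj M z.
Proof.
move=> cz WE BE z0 cb0 al01 Mcb M0 M1; set t := _ / _ => Mt.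
have t_sq : t ^+ 2 * (1 - z) = c * be * (al0 - al1 * z).
  have -> : t ^+ 2 * (1 - z) = W * E * E * (W * r ^+ 2 / (1 - z)) by rewrite /t; field.
  by rewrite -cz WE -BE; field.
have det : t ^+ 2 - c * be * al1 != 0.
  apply: contra_neq al01 => det; apply/eqP; rewrite -subr_eq0 -(mulrI_eq0 _ (mulfI cb0)).
  have -> : c * be * (al0 - al1) = (t ^+ 2 - c * be * al1) * (1 - z) by rewrite mulrBl t_sq; ring.
  by rewrite det mul0r.
have -> : z = (t ^+ 2 - c * be * al0) / (t ^+ 2 - c * be * al1).
  apply: (mulIf det); rewrite divfK //; apply/eqP; rewrite -subr_eq0; apply/eqP.
  transitivity (c * be * (al0 - al1 * z) - t ^+ 2 * (1 - z)); first by ring.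
  by rewrite t_sq subrr.
by adjoin_mem.
Qed.

Section Elimination.
Variables (a b c : K) (Z1 Z2 Z3 r1 r2 r3 : F).
Hypotheses (a_neq0 : a != 0) (b_neq0 : b != 0) (c_neq0 : c != 0).
Hypothesis Z_indep : indep [:: Z1; Z2; Z3].
Local Notation a' := (iota a).
Local Notation b' := (iota b).
Local Notation c' := (iota c).
Local Notation L := (adj [:: Z1; Z2; Z3; r1; r2; r3]).

Lemma coefs_neq0 : [/\ a' != 0, b' != 0 & c' != 0].
Proof. by rewrite !fmorph_eq0. Qed.

Lemma indep3_neq0 : [/\ Z1 != 0, Z2 != 0 & Z3 != 0].
Proof. by have [n1 n2 n3] := indep3_neq Z_indep; split; rewrite ?n1 ?n2 ?n3 //; adjoin_mem. Qed.

Lemma indep3_subr1_neq0 : [/\ 1 - Z1 != 0, 1 - Z2 != 0 & 1 - Z3 != 0].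
Proof.
have [n1 n2 n3] := indep3_neq Z_indep; rewrite !subr_eq0 ![1 == _]eq_sym.
by split; rewrite ?n1 ?n2 ?n3 //; adjoin_mem.
Qed.

Lemma roots_neq0 m1 m2 m3 : a' * (1 - Z1) = m1 * r1 ^+ 2 -> b' * (1 - Z2) = m2 * r2 ^+ 2 ->
  c' * (1 - Z3) = m3 * r3 ^+ 2 -> [/\ r1 != 0, r2 != 0 & r3 != 0].
Proof.
have [a0 b0 c0] := coefs_neq0; have [y1 y2 y3] := indep3_subr1_neq0.
have root_neq0 (d y m r : F) : d != 0 -> y != 0 -> d * y = m * r ^+ 2 -> r != 0.
  move=> d0 y0 e; have := mulf_neq0 d0 y0; rewrite e mulf_eq0 negb_or expf_eq0.
  by case/andP.
by move=> e1 e2 e3; split; [apply: root_neq0 a0 y1 e1 | apply: root_neq0 b0 y2 e2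
                           | apply: root_neq0 c0 y3 e3].
Qed.

Lemma generated_by_roots :
  adj [:: r1; r2; r3] Z1 -> adj [:: r1; r2; r3] Z2 -> adj [:: r1; r2; r3] Z3 -> three_generated L.
Proof.
by move=> M1 M2 M3; apply: (@three_generated_list _ r1 r2 r3); rewrite /=; do !split; adjoin_mem.
Qed.

Lemma source_three_generated (e12 e13 e23 e32 : bool) :
  a' * (1 - Z1) = r1 ^+ 2 -> b' * (1 - Z2) = Z1 ^+ e12 * Z3 ^+ e32 * r2 ^+ 2 ->
  c' * (1 - Z3) = Z1 ^+ e13 * Z2 ^+ e23 * r3 ^+ 2 -> three_generated L.
Proof.
move=> Z1a Z2b Z3c; have [a0 b0 c0] := coefs_neq0; have [z1 z2 z3] := indep3_neq0.
have M1 : adj [:: r1; r2; r3] Z1.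
  have -> : Z1 = 1 - r1 ^+ 2 / a' by rewrite -Z1a; field.
  by adjoin_mem.
have [M2 M3] : adj [:: r1; r2; r3] Z2 /\ adj [:: r1; r2; r3] Z3.
  apply: (@adjoin_solve_pair _ b' c' (Z1 ^+ e12 * r2 ^+ 2)
    (Z1 ^+ e13 * r3 ^+ 2) Z2 Z3 e32 e23) => //.
  1-4: by adjoin_mem.
  - by have [_ _ n3] := indep3_neq Z_indep; apply: n3; adjoin_mem.
  - by rewrite Z2b; ring.
  - by rewrite Z3c; ring.
exact: generated_by_roots.
Qed.

Lemma sink_three_generated (e21 e23 e31 e32 : bool) :
  a' * (1 - Z1) = Z2 ^+ e21 * Z3 ^+ e31 * r1 ^+ 2 -> b' * (1 - Z2) = Z3 ^+ e32 * r2 ^+ 2 ->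
  c' * (1 - Z3) = Z2 ^+ e23 * r3 ^+ 2 -> three_generated L.
Proof.
move=> Z1a Z2b Z3c; have [a0 b0 c0] := coefs_neq0; have [z1 z2 z3] := indep3_neq0.
have [M2 M3] : adj [:: r1; r2; r3] Z2 /\ adj [:: r1; r2; r3] Z3.
  apply: (@adjoin_solve_pair _ b' c' (r2 ^+ 2) (r3 ^+ 2) Z2 Z3 e32 e23) => //.
  1-4: by adjoin_mem.
  - by have [_ _ n3] := indep3_neq Z_indep; apply: n3; adjoin_mem.
  - by rewrite Z2b mulrC.
  - by rewrite Z3c mulrC.
have M1 : adj [:: r1; r2; r3] Z1.
  have -> : Z1 = 1 - Z2 ^+ e21 * Z3 ^+ e31 * r1 ^+ 2 / a' by rewrite -Z1a; field.
  by adjoin_mem.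
exact: generated_by_roots.
Qed.

Lemma cycle_three_generated :
  a' * (1 - Z1) = Z3 * r1 ^+ 2 -> b' * (1 - Z2) = Z1 * r2 ^+ 2 -> c' * (1 - Z3) = Z2 * r3 ^+ 2 ->
  three_generated L.
Proof.
move=> Z1a Z2b Z3c; have [a0 b0 c0] := coefs_neq0; have [z1 z2 z3] := indep3_neq0.
have [y1 y2 y3] := indep3_subr1_neq0; have [n1 _ n3] := indep3_neq Z_indep.
have [r10 r20 r30] := roots_neq0 Z1a Z2b Z3c.
have aE : a' = Z3 * r1 ^+ 2 / (1 - Z1) by rewrite -Z1a mulfK.
have bE : b' = Z1 * r2 ^+ 2 / (1 - Z2) by rewrite -Z2b mulfK.
have cE : c' = Z2 * r3 ^+ 2 / (1 - Z3) by rewrite -Z3c mulfK.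
have sum0 : Z2 + Z3 - 1 != 0.
  have -> : Z2 + Z3 - 1 = Z3 - (1 - Z2) by ring.
  by rewrite subr_eq0; apply: n3; adjoin_mem.
have det : a' * b' * c' + (r1 * r2 * r3) ^+ 2 != 0.
  have -> : a' * b' * c' + (r1 * r2 * r3) ^+ 2 =
      (r1 * r2 * r3) ^+ 2 * (Z2 + Z3 - 1) * (Z1 - (Z2 + Z3 - 1 - Z2 * Z3) / (Z2 + Z3 - 1)) /
      ((1 - Z1) * (1 - Z2) * (1 - Z3)).
    by rewrite aE bE cE; field; nonzero.
  rewrite !mulf_neq0 ?expf_neq0 ?invr_neq0 ?mulf_neq0 // subr_eq0.
  by apply: n1; adjoin_mem.
have M1 : adj [:: r1; r2; r3] Z1.
  have -> : Z1 = b' * (a' * c' - c' * r1 ^+ 2 + r1 ^+ 2 * r3 ^+ 2) /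
      (a' * b' * c' + (r1 * r2 * r3) ^+ 2).
    by apply: (mulIf det); rewrite divfK // aE bE cE; field; nonzero.
  by adjoin_mem.
have M2 : adj [:: r1; r2; r3] Z2.
  have -> : Z2 = 1 - Z1 * r2 ^+ 2 / b' by rewrite -Z2b; field.
  by adjoin_mem.
have M3 : adj [:: r1; r2; r3] Z3.
  have -> : Z3 = 1 - Z2 * r3 ^+ 2 / c' by rewrite -Z3c; field.
  by adjoin_mem.
exact: generated_by_roots.
Qed.

Lemma indegrees211_three_generated :
  a' * (1 - Z1) = Z2 * Z3 * r1 ^+ 2 -> b' * (1 - Z2) = Z1 * r2 ^+ 2 ->
  c' * (1 - Z3) = Z2 * r3 ^+ 2 -> three_generated L.
Proof.
move=> Z1a Z2b Z3c; have [a0 b0 c0] := coefs_neq0; have [z1 z2 z3] := indep3_neq0.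
have [y1 y2 y3] := indep3_subr1_neq0; have [n1 _ n3] := indep3_neq Z_indep.
have [r10 r20 r30] := roots_neq0 Z1a Z2b Z3c.
have aE : a' = Z2 * Z3 * r1 ^+ 2 / (1 - Z1) by rewrite -Z1a mulfK.
have bE : b' = Z1 * r2 ^+ 2 / (1 - Z2) by rewrite -Z2b mulfK.
pose rho := r1 * r2; pose E := a' * b' - Z3 * rho ^+ 2; pose B := b' - r2 ^+ 2.
have B0 : B != 0.
  have -> : B = r2 ^+ 2 * (Z1 - (1 - Z2)) / (1 - Z2) by rewrite /B bE; field.
  by rewrite !mulf_neq0 ?expf_neq0 ?invr_neq0 // subr_eq0; apply: n1; adjoin_mem.
have Z2E : Z2 * E = a' * B by rewrite /E /B /rho aE bE; field; nonzero.
have E0 : E != 0 by have := mulf_neq0 a0 B0; rewrite -Z2E mulf_eq0 negb_or => /andP[].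
have ab_rho : a' * b' - rho ^+ 2 != 0.
  have -> : a' * b' - rho ^+ 2 =
      rho ^+ 2 * Z1 * Z2 * (Z3 - (1 - Z1) * (1 - Z2) / (Z1 * Z2)) / ((1 - Z1) * (1 - Z2)).
    by rewrite /rho aE bE; field; nonzero.
  rewrite !mulf_neq0 ?expf_neq0 ?invr_neq0 ?mulf_neq0 // subr_eq0.
  by apply: n3; adjoin_mem.
pose t := Z2 * r3 * E / (1 - Z3); pose M := [:: r2; rho; t].
have M3 : adj M Z3.
  apply: (adjoin_solve_last (al0 := B * (a' * b')) (al1 := B * rho ^+ 2) Z3c Z2E) => //.
  - by rewrite /E; ring.
  - exact: mulf_neq0.
  - by rewrite -subr_eq0 -mulrBr mulf_neq0.
  1-4: by rewrite /B; adjoin_mem.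
have ME : adj M E by rewrite /E; adjoin_mem.
have M2 : adj M Z2.
  have -> : Z2 = a' * B / E by rewrite -Z2E mulfK.
  by rewrite /B; adjoin_mem.
have M1 : adj M Z1.
  have -> : Z1 = b' * (1 - Z2) / r2 ^+ 2 by rewrite Z2b mulfK ?expf_neq0.
  by adjoin_mem.
have Mr1 : adj M r1.
  have -> : r1 = rho / r2 by rewrite /rho mulfK.
  by adjoin_mem.
have Mr3 : adj M r3.
  have -> : r3 = t * (1 - Z3) / (Z2 * E) by rewrite /t; field; nonzero.
  by adjoin_mem.
apply: (@three_generated_list _ r2 rho t); rewrite /=; do !split; adjoin_mem.
Qed.

Lemma indegrees221_three_generated :
  a' * (1 - Z1) = Z2 * Z3 * r1 ^+ 2 -> b' * (1 - Z2) = Z1 * Z3 * r2 ^+ 2 ->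
  c' * (1 - Z3) = Z1 * r3 ^+ 2 -> three_generated L.
Proof.
move=> Z1a Z2b Z3c; have [a0 b0 c0] := coefs_neq0; have [z1 z2 z3] := indep3_neq0.
have [y1 y2 y3] := indep3_subr1_neq0; have [n1 _ _] := indep3_neq Z_indep.
have [r10 r20 r30] := roots_neq0 Z1a Z2b Z3c.
have aE : a' = Z2 * Z3 * r1 ^+ 2 / (1 - Z1) by rewrite -Z1a mulfK.
have bE : b' = Z1 * Z3 * r2 ^+ 2 / (1 - Z2) by rewrite -Z2b mulfK.
pose rho := Z3 * r1 * r2; pose E := a' * b' - rho ^+ 2; pose B := a' - Z3 * r1 ^+ 2.
have E0 : E != 0.
  have -> : E = rho ^+ 2 * (Z1 - (1 - Z2)) / ((1 - Z1) * (1 - Z2)).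
    by rewrite /E /rho aE bE; field; nonzero.
  rewrite !mulf_neq0 ?expf_neq0 ?invr_neq0 ?mulf_neq0 // subr_eq0.
  by apply: n1; adjoin_mem.
have Z1E : Z1 * E = b' * B by rewrite /E /B /rho aE bE; field; nonzero.
have a_r1 : a' - r1 ^+ 2 != 0.
  have -> : a' - r1 ^+ 2 = r1 ^+ 2 * (Z1 - (1 - Z2 * Z3)) / (1 - Z1) by rewrite aE; field.
  by rewrite !mulf_neq0 ?expf_neq0 ?invr_neq0 // subr_eq0; apply: n1; adjoin_mem.
pose t := Z1 * r3 * E / (1 - Z3); pose M := [:: r1; rho; t].
have M3 : adj M Z3.
  apply: (adjoin_solve_last (al0 := a' * E) (al1 := r1 ^+ 2 * E) Z3c Z1E) => //.
  - by rewrite /B; ring.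
  - exact: mulf_neq0.
  - by rewrite -subr_eq0 -mulrBl mulf_neq0.
  1-4: by rewrite /E; adjoin_mem.
have ME : adj M E by rewrite /E; adjoin_mem.
have M1 : adj M Z1.
  have -> : Z1 = b' * B / E by rewrite -Z1E mulfK.
  by rewrite /B; adjoin_mem.
have Mr2 : adj M r2.
  have -> : r2 = rho / (Z3 * r1) by rewrite /rho; field; nonzero.
  by adjoin_mem.
have M2 : adj M Z2.
  have -> : Z2 = 1 - Z1 * Z3 * r2 ^+ 2 / b' by rewrite -Z2b; field.
  by adjoin_mem.
have Mr3 : adj M r3.
  have -> : r3 = t * (1 - Z3) / (Z1 * E) by rewrite /t; field; nonzero.
  by adjoin_mem.
apply: (@three_generated_list _ r1 rho t); rewrite /=; do !split; adjoin_mem.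
Qed.
End Elimination.

Definition twist_system (I : finType) (b : rel I) (a : I -> K) (Z r : I -> F) : Prop :=
  [/\ forall i, a i != 0, indep (codom Z)
    & forall i, iota (a i) * (1 - Z i) = (\prod_(l | l != i) Z l ^+ b l i) * r i ^+ 2].

Definition complete_graph (I : eqType) (b : rel I) (i j l : I) : bool :=
  [&& b i j, b j i, b i l, b l i, b j l & b l j].

Definition path_graph (I : eqType) (b : rel I) (i j l : I) : bool :=
  [&& ~~ b i j, ~~ b j i, b i l, b l i, b j l & b l j].

Section ThreeVertices.
Variables (b : rel 'I_3) (a : 'I_3 -> K) (Z r : 'I_3 -> F).
Hypothesis sys : twist_system b a Z r.
Local Notation L := (adj (codom Z ++ codom r)).

Definition exceptional_graph : bool :=
  [|| complete_graph b 0 1 2, path_graph b 0 1 2, path_graph b 0 2 1 | path_graph b 1 2 0].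

Lemma uniq3_perm (i j l : 'I_3) (s : seq 'I_3) :
  uniq [:: i; j; l] -> uniq s -> (forall m, m \in s) -> perm_eq s [:: i; j; l].
Proof.
move=> u us s_all; apply: uniq_perm => // m; rewrite s_all; apply/esym.
have [|_ ->] := uniq_min_size u (s2 := enum 'I_3) (fun m _ => mem_enum _ m).
  by rewrite size_enum_ord.
by rewrite mem_enum.
Qed.

Lemma twist_equation (i j l : 'I_3) : uniq [:: i; j; l] ->
  iota (a i) * (1 - Z i) = Z j ^+ b j i * Z l ^+ b l i * r i ^+ 2.
Proof.
move=> u; have [_ _ ->] := sys; congr (_ * _).
rewrite (perm_big _ (uniq3_perm u (index_enum_uniq _) (@mem_index_enum _))).
rewrite /= !big_cons big_nil eqxx.
by move: u; rewrite /= !inE !negb_or => /and3P[/andP[ij il] _ _];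
  rewrite ![_ == i]eq_sym ij il mulr1.
Qed.

Lemma twist_equations (i j l : 'I_3) : uniq [:: i; j; l] ->
  [/\ iota (a i) * (1 - Z i) = Z j ^+ b j i * Z l ^+ b l i * r i ^+ 2,
      iota (a j) * (1 - Z j) = Z i ^+ b i j * Z l ^+ b l j * r j ^+ 2
    & iota (a l) * (1 - Z l) = Z i ^+ b i l * Z j ^+ b j l * r l ^+ 2].
Proof.
by move=> u; split; apply: twist_equation; move: u;
  rewrite /= !inE !negb_or ?[j == i]eq_sym ?[l == i]eq_sym ?[l == j]eq_sym =>
    /and3P[/andP[-> ->] -> _].
Qed.

Lemma twist_indep (i j l : 'I_3) : uniq [:: i; j; l] -> indep [:: Z i; Z j; Z l].
Proof.
move=> u; have [_ iZ _] := sys; apply: indep_perm iZ.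
rewrite -[[:: Z i; Z j; Z l]]/(map Z [:: i; j; l]) perm_map //.
by rewrite (uniq3_perm u) ?enum_uniq // => m; rewrite mem_enum.
Qed.

Lemma twist_generators (i j l : 'I_3) f : uniq [:: i; j; l] ->
  adj [:: Z i; Z j; Z l; r i; r j; r l] f <-> L f.
Proof.
move=> u; have perm : perm_eq (codom Z ++ codom r) [:: Z i; Z j; Z l; r i; r j; r l].
  rewrite -[[:: Z i; _; _; _; _; _]]/(map Z [:: i; j; l] ++ map r [:: i; j; l]).
  by rewrite perm_cat // perm_map // (uniq3_perm u) ?enum_uniq // => m; rewrite mem_enum.
by split; apply: adjoin_in_list_sub => g; rewrite (perm_mem perm).
Qed.

Definition eliminable (i j l : 'I_3) : bool :=
  [|| ~~ b j i && ~~ b l i, ~~ b i j && ~~ b i l,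
      [&& b i j, b j l, b l i, ~~ b j i, ~~ b l j & ~~ b i l],
      [&& b i j, b j i, b j l, b l i, ~~ b i l & ~~ b l j]
    | [&& b i j, b i l, b j i, b l i, b l j & ~~ b j l]].

Lemma eliminable_three_generated (i j l : 'I_3) : uniq [:: i; j; l] -> eliminable i j l ->
  three_generated L.
Proof.
move=> u; have [a0 _ _] := sys; have iZ := twist_indep u.
have [Zi Zj Zl] := twist_equations u.
move=> elim; apply: three_generated_eq (fun f => twist_generators f u) _.
case/orP: elim => [/andP[/negPf ji /negPf li]|elim].
  rewrite ji li mul1r mul1r in Zi.
  exact: (source_three_generated (a0 i) (a0 j) (a0 l) iZ Zi Zj Zl).
case/orP: elim => [/andP[/negPf ij /negPf il]|elim].
  rewrite ij mul1r in Zj; rewrite il mul1r in Zl.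
  exact: (sink_three_generated (a0 i) (a0 j) (a0 l) iZ Zi Zj Zl).
case/or3P: elim => [/and5P[ij jl li ji /andP[lj il]]|/and5P[ij ji jl li /andP[il lj]]
                   |/and5P[ij il ji li /andP[lj jl]]].
- rewrite (negPf ji) li mul1r expr1 in Zi; rewrite ij (negPf lj) mulr1 expr1 in Zj.
  rewrite (negPf il) jl mul1r expr1 in Zl.
  exact: (cycle_three_generated (a0 i) (a0 j) (a0 l) iZ Zi Zj Zl).
- rewrite ji li !expr1 in Zi; rewrite ij (negPf lj) mulr1 expr1 in Zj.
  rewrite (negPf il) jl mul1r expr1 in Zl.
  exact: (indegrees211_three_generated (a0 i) (a0 j) (a0 l) iZ Zi Zj Zl).
rewrite ji li !expr1 in Zi; rewrite ij lj !expr1 in Zj; rewrite il (negPf jl) mulr1 expr1 in Zl.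
exact: (indegrees221_three_generated (a0 i) (a0 j) (a0 l) iZ Zi Zj Zl).
Qed.

Lemma nonexceptional_three_generated : ~~ exceptional_graph -> three_generated L.
Proof.
move=> nexc; have elim : [|| eliminable 0 1 2, eliminable 0 2 1, eliminable 1 0 2,
    eliminable 1 2 0, eliminable 2 0 1 | eliminable 2 1 0].
  move: nexc; rewrite /exceptional_graph /complete_graph /path_graph /eliminable.
  by case: (b 0 1) (b 0 2) (b 1 0) (b 1 2) (b 2 0) (b 2 1) => [] [] [] [] [] [].
by case/or4P: elim => [|||/or3P[]]; apply: eliminable_three_generated.
Qed.
End ThreeVertices.
End ThreeGenerators.

(** * Rational pencils *)

Section Pencil.
Variables (K F : fieldType) (iota : {rmorphism K -> F}).
Local Notation adj l := (adjoin iota (in_list l)).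
Local Notation indep := (indep_over iota (@no_element F)).
Implicit Types (L : F -> Prop) (S u v w : F).

Definition pencil_presentation L (a b c : K) S u v w : Prop :=
  [/\ indep [:: S; u; v], pencil_eq (iota a) (iota b) (iota c) S u v w
    & forall f, L f <-> adj [:: S; u; v; w] f].

Lemma pencil_presentation_eq L L' a b c S u v w : (forall f, L f <-> L' f) ->
  pencil_presentation L a b c S u v w -> pencil_presentation L' a b c S u v w.
Proof. by move=> LL' [iSuv wE LE]; split=> // f; rewrite -LL'. Qed.

Lemma pencil_neq0 L a b c S u v w : pencil_presentation L a b c S u v w ->
  [/\ S != 0, u != 0, v != 0, S + iota a != 0 & [/\ u ^+ 2 * S + iota b != 0,
      v ^+ 2 * S + iota c != 0 & w != 0]].
Proof.
move=> [/indep3_neq[nS nu nv] wE _].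
have u0 : u != 0 by apply: nu; adjoin_mem.
have v0 : v != 0 by apply: nv; adjoin_mem.
have shift y d : y != 0 -> adj [:: u; v] y -> y ^+ 2 * S + iota d != 0.
  move=> y0 My; have -> : y ^+ 2 * S + iota d = y ^+ 2 * (S - - iota d / y ^+ 2) by field.
  by rewrite mulf_neq0 ?expf_neq0 // subr_eq0; apply: nS; adjoin_mem.
have Sa : S + iota a != 0 by rewrite addr_eq0; apply: nS; adjoin_mem.
have Sb : u ^+ 2 * S + iota b != 0 by apply: shift u0 _; adjoin_mem.
have Sc : v ^+ 2 * S + iota c != 0 by apply: shift v0 _; adjoin_mem.
split=> //; first by apply: nS; adjoin_mem.
by split=> //; rewrite -sqrf_eq0 wE !mulf_neq0.
Qed.

Lemma pencil_swap12 L a b c S u v w : pencil_presentation L a b c S u v w ->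
  pencil_presentation L b a c (u ^+ 2 * S) u^-1 (v / u) w.
Proof.
move=> pres; have [S0 u0 v0 _ _] := pencil_neq0 pres; case: pres => iSuv wE LE.
have recover M : adj M (u ^+ 2 * S) -> adj M u^-1 -> adj M (v / u) ->
    [/\ adj M S, adj M u & adj M v].
  move=> MS Mu Mv; have {}Mu : adj M u by rewrite -[u]invrK; adjoin_mem.
  split=> //.
    have -> : S = u ^+ 2 * S / u ^+ 2 by field.
    by adjoin_mem.
  have -> : v = v / u * u by rewrite divfK.
  by adjoin_mem.
split.
- apply: (indep_adjoin iSuv) => //=.
  by have [|||MS Mu Mv] := recover [:: u ^+ 2 * S; u^-1; v / u]; first 3 last; do ?split;
    adjoin_mem.
- by rewrite /pencil_eq wE; field.
move=> f; rewrite LE; apply: adjoin_eq => /=; last by do !split; adjoin_mem.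
have [|||MS Mu Mv] := recover [:: u ^+ 2 * S; u^-1; v / u; w]; try by adjoin_mem.
by do !split; adjoin_mem.
Qed.

Lemma pencil_swap23 L a b c S u v w :
  pencil_presentation L a b c S u v w -> pencil_presentation L a c b S v u w.
Proof.
move=> [iSuv wE LE]; split.
- by apply: (indep_adjoin iSuv) => //=; do !split; adjoin_mem.
- by rewrite /pencil_eq wE; ring.
- by move=> f; rewrite LE; apply: adjoin_eq; rewrite /=; do !split; adjoin_mem.
Qed.

(* With r = w / (v^2 S + c) the pencil becomes the quadric
   c r^2 + S (r v)^2 = (S + a) (S u^2 + b) over K(S). *)
Lemma pencil_quadric L a b c S u v w : pencil_presentation L a b c S u v w ->
  let r := w / (v ^+ 2 * S + iota c) in
  iota c * r ^+ 2 + S * (r * v) ^+ 2 = (S + iota a) * (u ^+ 2 * S + iota b).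
Proof.
move=> pres r; have [_ _ _ _ [_ V0 _]] := pencil_neq0 pres; case: pres => _ wE _.
transitivity (w ^+ 2 / (v ^+ 2 * S + iota c)); first by rewrite /r; field.
by rewrite wE mulfK.
Qed.

(* Projecting the quadric from a rational point makes its equation linear in s. *)
Lemma quadric_projection (l : seq F) (be ka : K) (s y0 y1 y3 N : F) : indep l -> (2 < size l)%N ->
  all_adjoin iota (in_list [:: s; y0; y1; y3]) l -> ka != 0 -> adj [:: y1; y3] N ->
  s * (y1 ^+ 2 - iota be * y3 ^+ 2) = N - iota ka * y0 ^+ 2 -> adj [:: y0; y1; y3] s.
Proof.
move=> il l3 all ka0 MN eq_s; have ka'0 : iota ka != 0 by rewrite fmorph_eq0.
have sub f : adj [:: y1; y3] f -> adj [:: y0; y1; y3] f.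
  by apply: adjoin_in_list_sub => g; rewrite !inE => /orP[]->; rewrite !orbT.
have [D0|D0] := eqVneq (y1 ^+ 2 - iota be * y3 ^+ 2) 0; last first.
  have -> : s = (N - iota ka * y0 ^+ 2) / (y1 ^+ 2 - iota be * y3 ^+ 2) by rewrite -eq_s mulfK.
  by have := sub N MN; move=> {}MN; adjoin_mem.
pose A := alg_over iota (in_list [:: s; y3]).
have gen f : f \in [:: s; y3] -> adjoin iota A f.
  by move=> fin; apply: adjoin_gen; apply: adjoin_alg_over; apply: adjoin_gen.
have As : adjoin iota A s by apply: gen; rewrite !inE eqxx.
have A3 : adjoin iota A y3 by apply: gen; rewrite !inE eqxx orbT.
have A1 : adjoin iota A y1.
  by apply: adjoin_alg_over_sqrt; move/subr0_eq: D0 => ->; adjoin_mem.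
have AN : adjoin iota A N.
  by apply: adjoin_trans MN => g; rewrite /in_list !inE => /orP[]/eqP->.
have A0 : adjoin iota A y0.
  apply: adjoin_alg_over_sqrt; have -> : y0 ^+ 2 = N / iota ka.
    have -> : N = iota ka * y0 ^+ 2 by apply/eqP; rewrite -subr_eq0 -eq_s D0 mulr0.
    by rewrite mulrC mulKf.
  by adjoin_mem.
suff : (size l <= 2)%N by rewrite leqNgt l3.
apply: (indep_size_le (l' := [:: s; y3]) il) => f fl; apply: alg_over_closed.
by apply: adjoin_trans (all_adjoinP all fl) => g; rewrite /in_list !inE => /or4P[]/eqP->.
Qed.

Lemma pencil_projection L a b c S u v w (be ka : K) (s y0 y1 y3 N : F) :
  let M := [:: s; y0; y1; y3] in let r := w / (v ^+ 2 * S + iota c) in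
  pencil_presentation L a b c S u v w -> ka != 0 -> adj [:: y1; y3] N ->
  s * (y1 ^+ 2 - iota be * y3 ^+ 2) = N - iota ka * y0 ^+ 2 ->
  all_adjoin iota (in_list [:: S; u; v; w]) [:: y0; y1; y3] ->
  all_adjoin iota (in_list M) [:: S; u; v; r] -> three_generated iota L.
Proof.
move=> M r pres ka0 MN eq_s gens [MS [Mu [Mv [Mr _]]]].
have [_ _ _ _ [_ V0 _]] := pencil_neq0 pres; case: pres => iSuv _ LE.
have Mw : adj M w.
  by have -> : w = r * (v ^+ 2 * S + iota c); [rewrite /r divfK | adjoin_mem].
have Ms : adj [:: y0; y1; y3] s by apply: (quadric_projection iSuv) MN eq_s.
have sub f : adj M f -> adj [:: y0; y1; y3] f.
  apply: adjoin_trans => g; rewrite /in_list inE => /orP[/eqP->//|gy].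
  by apply: adjoin_gen.
apply: three_generated_eq (fun f => iff_sym (LE f)) _.
by apply: (@three_generated_list _ _ _ _ y0 y1 y3 gens); rewrite /=; do !split; apply: sub.
Qed.

(* A square root of abc, of a, or of a / b gives a rational point of the quadric. *)
Lemma pencil_rational_sqrt_abc L a b c k S u v w :
  a != 0 -> b != 0 -> c != 0 -> k ^+ 2 = a * b * c ->
  pencil_presentation L a b c S u v w -> three_generated iota L.
Proof.
move=> a0 b0 c0 kE pres; have [S0 u0 v0 _ [_ V0 w0]] := pencil_neq0 pres.
have /= := pencil_quadric pres; set r := w / _ => quadric.
have k0 : k != 0 by rewrite -sqrf_eq0 kE !mulf_neq0.
have [a'0 b'0 k'0] : [/\ iota a != 0, iota b != 0 & iota k != 0] by rewrite !fmorph_eq0.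
have {}kE : iota k ^+ 2 = iota a * iota b * iota c by rewrite -rmorphXn kE !rmorphM.
have r0 : r != 0 by rewrite mulf_neq0 ?invr_neq0.
pose y := r * v; pose t := (iota k * r / (iota a * iota b) - 1) / S.
have rE : r = iota a * iota b * (1 + S * t) / iota k by rewrite /t; field; nonzero.
have vE : v = y / r by rewrite /y; field.
pose N := - (iota b + iota a * u ^+ 2 - 2%:R * iota a * iota b * t).
apply: (pencil_projection (s := S) (y0 := y) (y1 := u) (y3 := t) (be := a * b) (ka := -1)
  (N := N) pres).
- by rewrite oppr_eq0 oner_eq0.
- by rewrite /N; adjoin_mem.
- apply: (mulfI S0); apply/eqP; rewrite -subr_eq0; apply/eqP.
  transitivity ((S + iota a) * (u ^+ 2 * S + iota b) -
      (iota a * iota b * (1 + S * t) ^+ 2 + S * (r * v) ^+ 2)).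
    by rewrite /N -/y rmorphN1 rmorphM; ring.
  rewrite -quadric; have -> : iota c = iota k ^+ 2 / (iota a * iota b).
    by rewrite kE; field; nonzero.
  by rewrite [in iota k ^+ 2 / _ * _]rE; field; nonzero.
- by rewrite /= /y /t /r; do !split; adjoin_mem.
have Mr : adj [:: S; y; u; t] r by rewrite rE; adjoin_mem.
by rewrite -/r /= vE; do !split; adjoin_mem.
Qed.

Lemma pencil_rational_sqrt_a L a b c k S u v w : c != 0 -> k ^+ 2 = a ->
  pencil_presentation L a b c S u v w -> three_generated iota L.
Proof.
move=> c0 kE pres; have [S0 u0 v0 _ [_ V0 w0]] := pencil_neq0 pres.
have /= := pencil_quadric pres; set r := w / _ => quadric.
have r0 : r != 0 by rewrite mulf_neq0 ?invr_neq0.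
pose y0 := r / (u * S); pose y3 := (u * S)^-1; pose y1 := (r * v / u - iota k) / S.
have uE : u = (S * y3)^-1 by rewrite /y3; field; rewrite S0 u0 oner_neq0.
have rE : r = S * y0 * u by rewrite /y0; field; nonzero.
have vE : v = (iota k + S * y1) * u / r by rewrite /y1; field; nonzero.
pose N := 1 + iota a * iota b * y3 ^+ 2 - 2%:R * iota k * y1.
apply: (pencil_projection (s := S) (y0 := y0) (y1 := y1) (y3 := y3) (be := b) (ka := c)
  (N := N) pres) => //.
- by rewrite /N; adjoin_mem.
- apply: (mulfI (expf_neq0 2 (mulf_neq0 u0 S0))); apply/eqP; rewrite -subr_eq0; apply/eqP.
  transitivity (iota c * r ^+ 2 + S * (r * v) ^+ 2 - (S + iota a) * (u ^+ 2 * S + iota b)).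
    by rewrite /N /y0 /y1 /y3 -kE rmorphXn; field; nonzero.
  by rewrite quadric subrr.
- by rewrite /= /y0 /y1 /y3 /r; do !split; adjoin_mem.
have Mu : adj [:: S; y0; y1; y3] u by rewrite uE; apply/adjoin_inv/adjoin_mul; adjoin_mem.
have Mr : adj [:: S; y0; y1; y3] r by rewrite rE; adjoin_mem.
by rewrite -/r /= vE; do !split; adjoin_mem.
Qed.

Lemma pencil_rational_sqrt_ab L a b c k S u v w : c != 0 -> b * k ^+ 2 = a ->
  pencil_presentation L a b c S u v w -> three_generated iota L.
Proof.
move=> c0 kE pres; have [S0 u0 v0 Sa [_ V0 w0]] := pencil_neq0 pres.
have /= := pencil_quadric pres; set r := w / _ => quadric.
have r0 : r != 0 by rewrite mulf_neq0 ?invr_neq0.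
pose s := S + iota a; have SE : S = s - iota a by rewrite /s addrK.
have s0 : s != 0 := Sa.
pose y0 := r / (u * s); pose y3 := (u^-1 - iota k) / s; pose y1 := r * v / (u * s).
have uE : u = (iota k + s * y3)^-1 by rewrite /y3 mulrC divfK // addrC subrK invrK.
have rE : r = s * y0 * u by rewrite /y0; field; nonzero.
have vE : v = s * y1 * u / r by rewrite /y1; field; nonzero.
pose N := 1 + 2%:R * iota b * iota k * y3 + iota a * y1 ^+ 2.
apply: (pencil_projection (s := s) (y0 := y0) (y1 := y1) (y3 := y3) (be := b) (ka := c)
  (N := N) pres) => //.
- by rewrite /N; adjoin_mem.
- apply: (mulfI (expf_neq0 2 (mulf_neq0 u0 s0))); apply/eqP; rewrite -subr_eq0; apply/eqP.
  transitivity (iota c * r ^+ 2 + (s - iota a) * (r * v) ^+ 2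
                - s * (u ^+ 2 * (s - iota a) + iota b)).
    by rewrite /N /y0 /y1 /y3 -kE rmorphM rmorphXn; field; nonzero.
  by rewrite -SE quadric subrr.
- by rewrite /= /y0 /y1 /y3 /r /s; do !split; adjoin_mem.
have Mu : adj [:: s; y0; y1; y3] u by rewrite uE; adjoin_mem.
have Mr : adj [:: s; y0; y1; y3] r by rewrite rE; adjoin_mem.
by rewrite -/r /= SE vE; do !split; adjoin_mem.
Qed.

Lemma pencil_rational L a b c S u v w : a != 0 -> b != 0 -> c != 0 -> square_product a b c ->
  pencil_presentation L a b c S u v w -> three_generated iota L.
Proof.
have half (x y z : K) : y != 0 -> z ^+ 2 = x * y -> y * (z / y) ^+ 2 = x.
  by move=> y0 zE; rewrite expr_div_n zE; field.
move=> a0 b0 c0 [i [j [l [+ [k]]]]].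
case: i j l => [] [] [] //= _; rewrite ?expr1 ?expr0 ?mulr1 ?mul1r => kE pres.
- exact: pencil_rational_sqrt_abc kE pres.
- exact: pencil_rational_sqrt_ab c0 (half _ _ _ b0 kE) pres.
- exact: pencil_rational_sqrt_ab b0 (half _ _ _ c0 kE) (pencil_swap23 pres).
- exact: pencil_rational_sqrt_a c0 kE pres.
- exact: pencil_rational_sqrt_ab a0 (half _ _ _ c0 kE) (pencil_swap23 (pencil_swap12 pres)).
- exact: pencil_rational_sqrt_a c0 kE (pencil_swap12 pres).
- exact: pencil_rational_sqrt_a b0 kE (pencil_swap12 (pencil_swap23 pres)).
Qed.
End Pencil.

Section GraphPencils.
Variables (K F : fieldType) (iota : {rmorphism K -> F}) (a b c : K) (Z1 Z2 Z3 r1 r2 r3 : F).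
Hypotheses (a_neq0 : a != 0) (b_neq0 : b != 0) (c_neq0 : c != 0).
Hypothesis Z_indep : indep_over iota (@no_element F) [:: Z1; Z2; Z3].
Local Notation adj l := (adjoin iota (in_list l)).
Local Notation L := (adj [:: Z1; Z2; Z3; r1; r2; r3]).

(* With q_i = a_i Z_i / r_i and P = Z1 Z2 Z3, each q_i^2 / P equals a_i Z_i / (1 - Z_i). *)
Lemma complete_graph_pencil : iota a * (1 - Z1) = Z2 * Z3 * r1 ^+ 2 ->
  iota b * (1 - Z2) = Z1 * Z3 * r2 ^+ 2 -> iota c * (1 - Z3) = Z1 * Z2 * r3 ^+ 2 ->
  exists S u v w, pencil_presentation iota L a b c S u v w.
Proof.
move=> Z1a Z2b Z3c; have [a0 b0 c0] := coefs_neq0 iota a_neq0 b_neq0 c_neq0.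
have [z1 z2 z3] := indep3_neq0 Z_indep; have [y1 y2 y3] := indep3_subr1_neq0 Z_indep.
have [r10 r20 r30] := roots_neq0 a_neq0 b_neq0 c_neq0 Z_indep Z1a Z2b Z3c.
have ratio (d Z y z r : F) : d != 0 -> Z != 0 -> y != 0 -> z != 0 -> r != 0 ->
    d * (1 - Z) = y * z * r ^+ 2 -> (d * Z / r) ^+ 2 / (Z * y * z) = d * Z / (1 - Z).
  move=> d0 Z0 y0 z0 r0 e; have -> : 1 - Z = y * z * r ^+ 2 / d by rewrite -e; field.
  by field; nonzero.
pose q1 := iota a * Z1 / r1; pose q2 := iota b * Z2 / r2; pose q3 := iota c * Z3 / r3.
pose P := Z1 * Z2 * Z3.
have [P0 q10 q20 q30] : [/\ P != 0, q1 != 0, q2 != 0 & q3 != 0].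
  by rewrite !mulf_neq0 ?invr_neq0.
pose S := q1 ^+ 2 / P; pose u := q2 / q1; pose v := q3 / q1; pose w := q1 * q2 * q3 / P ^+ 2.
have SE : S = iota a * Z1 / (1 - Z1) by rewrite -(ratio _ _ Z2 Z3 r1).
have uS : u ^+ 2 * S = iota b * Z2 / (1 - Z2).
  by rewrite -(ratio _ _ Z1 Z3 r2) // -/q2 /u /S /P; field; nonzero.
have vS : v ^+ 2 * S = iota c * Z3 / (1 - Z3).
  by rewrite -(ratio _ _ Z1 Z2 r3) // -/q3 /v /S /P; field; nonzero.
have shift (d Z T : F) : 1 - Z != 0 -> T = d * Z / (1 - Z) -> T + d = d / (1 - Z).
  by move=> y0 ->; field.
have invert (d Z T : F) : d != 0 -> 1 - Z != 0 -> T = d * Z / (1 - Z) -> Z = T / (T + d).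
  by move=> d0 y0 TE; rewrite (shift _ _ _ y0 TE) TE; field; rewrite d0 y0.
have ZE M : adj M S -> adj M u -> adj M v -> all_adjoin iota (in_list M) [:: Z1; Z2; Z3].
  move=> MS Mu Mv /=; rewrite (invert _ _ _ a0 y1 SE) (invert _ _ _ b0 y2 uS)
    (invert _ _ _ c0 y3 vS).
  by do !split; adjoin_mem.
have q1E : q1 = S ^+ 2 * u * v / w by rewrite /S /u /v /w; field; nonzero.
exists S, u, v, w; split.
- by apply: (indep_adjoin Z_indep) => //; apply: ZE; adjoin_mem.
- rewrite /pencil_eq (shift _ _ _ y1 SE) (shift _ _ _ y2 uS) (shift _ _ _ y3 vS).
  transitivity (S * (u ^+ 2 * S) * (v ^+ 2 * S) / P); first by rewrite /S /u /v /w; field; nonzero.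
  by rewrite uS vS SE /P; field; nonzero.
apply: adjoin_eq; last by rewrite /= /S /u /v /w /q1 /q2 /q3 /P; do !split; adjoin_mem.
have [|||M1 [M2 [M3 _]]] := ZE [:: S; u; v; w]; try by adjoin_mem.
have Mq1 : adj [:: S; u; v; w] q1 by rewrite q1E; adjoin_mem.
have -> : r1 = iota a * Z1 / q1 by rewrite /q1; field; nonzero.
have -> : r2 = iota b * Z2 / (u * q1) by rewrite /u /q2; field; nonzero.
have -> : r3 = iota c * Z3 / (v * q1) by rewrite /v /q3; field; nonzero.
by rewrite /=; do !split; adjoin_mem.
Qed.

Lemma path_graph_pencil : iota a * (1 - Z1) = Z3 * r1 ^+ 2 -> iota b * (1 - Z2) = Z3 * r2 ^+ 2 ->
  iota c * (1 - Z3) = Z1 * Z2 * r3 ^+ 2 ->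
  exists S u v w, pencil_presentation iota L (a * c) (b * c) c S u v w.
Proof.
move=> Z1a Z2b Z3c; have [a0 b0 c0] := coefs_neq0 iota a_neq0 b_neq0 c_neq0.
have [z1 z2 z3] := indep3_neq0 Z_indep; have [y1 y2 y3] := indep3_subr1_neq0 Z_indep.
have [r10 r20 r30] := roots_neq0 a_neq0 b_neq0 c_neq0 Z_indep Z1a Z2b Z3c.
have aE : iota a = Z3 * r1 ^+ 2 / (1 - Z1) by rewrite -Z1a mulfK.
have bE : iota b = Z3 * r2 ^+ 2 / (1 - Z2) by rewrite -Z2b mulfK.
have cE : iota c = Z1 * Z2 * r3 ^+ 2 / (1 - Z3) by rewrite -Z3c mulfK.
pose S := - (iota a * iota c) / (1 - Z1); pose u := iota b * r1 / (iota a * r2).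
pose v := Z3 * r1 / iota a; pose w := iota a * iota b * iota c * Z1 * Z2 * r3 / (Z3 * r1 * r2).
have uS : u ^+ 2 * S = - (iota b * iota c) / (1 - Z2) by rewrite /u /S aE bE; field; nonzero.
have vS : v ^+ 2 * S = - (iota c * Z3) by rewrite /v /S aE; field; nonzero.
have u0 : u != 0 by rewrite !mulf_neq0 ?invr_neq0 ?mulf_neq0.
have recover M : adj M S -> adj M u -> adj M v ->
    all_adjoin iota (in_list M) [:: Z1; Z2; Z3; r1; r2].
  move=> MS Mu Mv; have M3 : adj M Z3.
    by have -> : Z3 = - (v ^+ 2 * S) / iota c; [rewrite vS; field | adjoin_mem].
  have m1 : adj M r1.
    by have -> : r1 = iota a * v / Z3; [rewrite /v; field; nonzero | adjoin_mem].
  have m2 : adj M r2.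
    by have -> : r2 = iota b * r1 / (iota a * u); [rewrite /u; field; nonzero | adjoin_mem].
  have M1 : adj M Z1.
    by have -> : Z1 = 1 - Z3 * r1 ^+ 2 / iota a; [rewrite -Z1a; field | adjoin_mem].
  have M2 : adj M Z2.
    by have -> : Z2 = 1 - Z3 * r2 ^+ 2 / iota b; [rewrite -Z2b; field | adjoin_mem].
  by rewrite /=; do !split.
exists S, u, v, w; split.
- apply: (indep_adjoin Z_indep) => //.
  by have [|||M1 [M2 [M3 _]]] := recover [:: S; u; v]; try by adjoin_mem.
- by rewrite /pencil_eq uS vS /w /S !rmorphM aE bE cE; field; nonzero.
apply: adjoin_eq; last by rewrite /= /S /u /v /w; do !split; adjoin_mem.
have [|||M1 [M2 [M3 [m1 [m2 _]]]]] := recover [:: S; u; v; w]; try by adjoin_mem.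
have -> : r3 = w * (Z3 * r1 * r2) / (iota a * iota b * iota c * Z1 * Z2).
  by rewrite /w; field; nonzero.
by rewrite /=; do !split; adjoin_mem.
Qed.
End GraphPencils.

(** * The field of invariants *)

Section FixedFields.
Variables (K F : fieldType) (iota : {rmorphism K -> F}).
Hypothesis two_neq0 : (2%:R : K) != 0.

Lemma two_neq0_ext : (2%:R : F) != 0.
Proof. by rewrite -(rmorph_nat iota) fmorph_eq0. Qed.

Lemma fixed_adjoin (s : {rmorphism F -> F}) A f : (forall k, s (iota k) = iota k) ->
  (forall g, A g -> s g = g) -> adjoin iota A f -> s f = f.
Proof.
move=> s_base sA; elim=> [//|//|g h _ sg _ sh|g _ sg|g h _ sg _ sh|g _ sg].
- by rewrite rmorphD sg sh.
- by rewrite rmorphN sg.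
- by rewrite rmorphM sg sh.
- by rewrite fmorphV sg.
Qed.

Lemma adjoin_sqrt_linear A z (q : {poly subfield_of iota A}) : adjoin iota A (z ^+ 2) ->
  exists g0 g1, [/\ adjoin iota A g0, adjoin iota A g1
                  & eval_at (sf_val iota A) z q = g0 + g1 * z].
Proof.
move=> Az; elim/poly_ind: q => [|q e [g0 [g1 [A0 A1 qE]]]].
  by exists 0, 0; rewrite rmorph0 mul0r addr0; split; adjoin_mem.
have Ae := sf_valP e; exists (g1 * z ^+ 2 + sf_val iota A e), g0; split=> //; first by adjoin_mem.
by rewrite rmorphD rmorphM eval_atX eval_atC qE; ring.
Qed.

Lemma quadratic_fixed (s : {rmorphism F -> F}) A z f : (forall k, s (iota k) = iota k) ->
  (forall g, A g -> s g = g) -> adjoin iota A (z ^+ 2) -> s z = - z ->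
  adjoin iota (with_list A [:: z]) f -> s f = f -> adjoin iota A f.
Proof.
move=> s_base sA Az sz /adjoin_with_fraction[n [d [d0 fE]]] sf.
have fix_adj g : adjoin iota A g -> s g = g by apply: fixed_adjoin.
have [n0 [n1 [An0 An1 nE]]] := adjoin_sqrt_linear n Az.
have [e0 [e1 [Ae0 Ae1 dE]]] := adjoin_sqrt_linear d Az.
rewrite dE in d0 fE; rewrite nE in fE.
have conj0 : e0 - e1 * z != 0.
  have -> : e0 - e1 * z = s (e0 + e1 * z).
    by rewrite rmorphD rmorphM (fix_adj _ Ae0) (fix_adj _ Ae1) sz mulrN.
  by rewrite fmorph_eq0.
pose D := (e0 + e1 * z) * (e0 - e1 * z).
have D0 : D != 0 by rewrite mulf_neq0.
have AD : adjoin iota A D.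
  have -> : D = e0 ^+ 2 - e1 ^+ 2 * z ^+ 2 by rewrite /D; ring.
  by adjoin_mem.
pose f0 := (n0 * e0 - n1 * e1 * z ^+ 2) / D; pose f1 := (n1 * e0 - n0 * e1) / D.
have [A0 A1] : adjoin iota A f0 /\ adjoin iota A f1 by split; rewrite /f0 /f1; adjoin_mem.
have {}fE : f = f0 + f1 * z by rewrite fE /f0 /f1 /D; field; rewrite d0 conj0.
have : f1 * z * 2%:R = 0.
  transitivity (f - s f); last by rewrite sf subrr.
  by rewrite fE rmorphD rmorphM (fix_adj _ A0) (fix_adj _ A1) sz; ring.
move/eqP; rewrite mulf_eq0 (negPf two_neq0_ext) orbF => /eqP f1z0.
by rewrite fE f1z0 addr0.
Qed.

Lemma fixed_field_generated (S : (F -> F) -> Prop) f :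
  fixed_field (automorphism_group S) f <-> forall s, S s -> s f = f.
Proof.
split=> [fixed s Ss|fixed s]; first by apply: fixed; apply: automorphism_group_mem.
elim=> [//|t /fixed //|t t' _ tf _ t'f /=|t t' _ tf tK _]; first by rewrite t'f tf.
by rewrite -{1}tf tK.
Qed.

Definition trace_of (d x : F) := x + d / x.
Definition zeta (d x : F) := (x - d / x) / (x + d / x).

Lemma transcendental_trace_zeta (d : K) x : d != 0 -> ~ alg_over iota (@no_element F) x ->
  [/\ x != 0, trace_of (iota d) x != 0, zeta (iota d) x != 0 & 1 - zeta (iota d) x != 0].
Proof.
move=> d0 tx; have d'0 : iota d != 0 by rewrite fmorph_eq0.
have nx f : adjoin iota (@no_element F) f -> x ^+ 2 != f.
  by move=> Af; apply/eqP => e; apply: tx; apply: alg_over_sqrt; rewrite e; apply: adjoin_alg_over.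
have x0 : x != 0 by rewrite -sqrf_eq0 nx //; adjoin_mem.
have t0 : trace_of (iota d) x != 0.
  have -> : trace_of (iota d) x = (x ^+ 2 - - iota d) / x by rewrite /trace_of; field.
  by rewrite mulf_neq0 ?invr_neq0 // subr_eq0 nx //; adjoin_mem.
split=> //.
  have -> : zeta (iota d) x = (x ^+ 2 - iota d) / x / trace_of (iota d) x.
    by rewrite /zeta /trace_of; congr (_ / _); field.
  by rewrite !mulf_neq0 ?invr_neq0 // subr_eq0 nx //; adjoin_mem.
have -> : 1 - zeta (iota d) x = 2%:R * iota d / (x * trace_of (iota d) x).
  rewrite /zeta -/(trace_of _ _) -{1}(divff t0) -mulrBl invfM mulrA; congr (_ / _).
  by rewrite /trace_of; field.
by rewrite !mulf_neq0 ?invr_neq0 ?mulf_neq0 ?two_neq0_ext.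
Qed.

Lemma rmorph_trace_zeta_sign (s : {rmorphism F -> F}) d x (e : bool) :
  s d = d -> s x = (-1) ^+ e * x ->
  s (trace_of d x) = (-1) ^+ e * trace_of d x /\ s (zeta d x) = zeta d x.
Proof.
move=> sd sx; have sdx : s (d / x) = (-1) ^+ e * (d / x).
  by rewrite rmorphM fmorphV sd sx invfM invr_sign mulrCA.
rewrite /zeta /trace_of rmorphM fmorphV rmorphB !rmorphD sx sdx -mulrDr -mulrBr; split=> //.
by rewrite -mulf_div divff ?mul1r // signr_eq0.
Qed.

Lemma rmorph_trace_zeta_invert (s : {rmorphism F -> F}) d x :
  d != 0 -> x != 0 -> s d = d -> s x = d / x ->
  s (trace_of d x) = trace_of d x /\ s (zeta d x) = - zeta d x.
Proof.
move=> d0 x0 sd sx; have sdx : s (d / x) = x by rewrite rmorphM fmorphV sd sx invf_div mulrC divfK.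
rewrite /zeta /trace_of rmorphM fmorphV rmorphB !rmorphD sx sdx addrC; split=> //.
by rewrite -mulNr opprB.
Qed.

Section TraceZeta.
Variables d x : F.
Hypotheses (x0 : x != 0) (t0 : trace_of d x != 0).

Lemma trace_zetaD : trace_of d x * (1 + zeta d x) = x * 2%:R.
Proof. by rewrite /zeta -/(trace_of d x) mulrDr mulr1 mulrCA divff // mulr1 /trace_of; ring. Qed.

Lemma trace_zetaB : trace_of d x * (1 - zeta d x) = 2%:R * d / x.
Proof. by rewrite /zeta -/(trace_of d x) mulrBr mulr1 mulrCA divff // mulr1 /trace_of; ring. Qed.

Lemma trace_zeta_root : x = trace_of d x * (1 + zeta d x) / 2%:R.
Proof. by rewrite trace_zetaD mulfK ?two_neq0_ext. Qed.

Lemma zeta_sqr_root : 1 - zeta d x != 0 -> x ^+ 2 = d * (1 + zeta d x) / (1 - zeta d x).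
Proof.
move=> z0; apply: (mulIf z0); rewrite divfK //; apply: (mulfI t0).
by rewrite mulrCA trace_zetaB [RHS]mulrCA trace_zetaD; field.
Qed.

Lemma zeta_pythagoras : d * (1 - zeta d x ^+ 2) = (2%:R * d / trace_of d x) ^+ 2.
Proof.
apply: (mulIf (expf_neq0 2 t0)); rewrite -[RHS]exprMn divfK // -mulrA mulrBl mul1r -exprMn.
by rewrite /zeta -/(trace_of d x) divfK // /trace_of; field.
Qed.
End TraceZeta.
End FixedFields.

Section Invariants.
Variables (K F : fieldType) (iota : {rmorphism K -> F}) (I : finType).
Variables (a : I -> K) (b : rel I) (x : I -> F) (s : I -> {rmorphism F -> F}).
Hypotheses (two_neq0 : (2%:R : K) != 0) (a_neq0 : forall i, a i != 0).
Hypothesis x_gen : forall f, adjoin iota (in_list (codom x)) f.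
Hypothesis x_indep : indep_over iota (@no_element F) (codom x).
Hypothesis s_base : forall i k, s i (iota k) = iota k.
Hypothesis s_diag : forall i, s i (x i) = iota (a i) / x i.
Hypothesis s_off : forall i j, i != j -> s i (x j) = (-1) ^+ b i j * x j.

Local Notation z i := (zeta (iota (a i)) (x i)).
Local Notation p i := (trace_of (iota (a i)) (x i)).
Local Notation m i := (\prod_(l | l != i) z l ^+ b l i).

Definition twist_square i : F := z i ^+ 2.
Definition twist_root i : F := 2%:R * iota (a i) / (p i * m i).
Local Notation invariants := (codom twist_square ++ codom twist_root).

Lemma trace_zeta_neq0 i : [/\ x i != 0, p i != 0, z i != 0 & 1 - z i != 0].
Proof. by apply: transcendental_trace_zeta => //; apply: (indep_mem x_indep); apply: codom_f. Qed.

Lemma zeta_prod_neq0 i : m i != 0.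
Proof. by apply/prodf_neq0 => l _; rewrite expf_neq0 //; have [] := trace_zeta_neq0 l. Qed.

Lemma alg_over_twist_square A i : adjoin iota A (twist_square i) -> alg_over iota A (x i).
Proof.
move=> AZ; have [x0 p0 _ z0] := trace_zeta_neq0 i.
apply: alg_over_closed; apply: adjoin_alg_over_sqrt.
have Az : adjoin iota (alg_over iota A) (z i).
  by apply: adjoin_alg_over_sqrt; apply: adjoin_gen; apply: adjoin_alg_over.
by rewrite (zeta_sqr_root x0 p0 z0); adjoin_mem.
Qed.

Lemma invariants_twist_system : twist_system iota b a twist_square twist_root.
Proof.
split=> // [|i].
  apply: (indep_exchange x_indep); first by rewrite !size_codom.
  by move=> f /codomP[i ->]; apply: alg_over_twist_square; apply: adjoin_gen; apply: codom_f.
have [x0 p0 _ _] := trace_zeta_neq0 i; have m0 := zeta_prod_neq0 i.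
rewrite /twist_square (zeta_pythagoras x0 p0) /twist_root.
have -> : \prod_(l | l != i) (z l ^+ 2) ^+ b l i = m i ^+ 2.
  by rewrite -prodrXl; apply: eq_bigr => l _; rewrite -!exprM mulnC.
by field; rewrite p0 m0.
Qed.

Lemma rmorph_trace_zeta i j : s i (p j) = (-1) ^+ ((i != j) && b i j) * p j /\
  s i (z j) = (-1) ^+ (i == j) * z j.
Proof.
have [<-|ij] := eqVneq i j; last by rewrite mul1r; apply: rmorph_trace_zeta_sign; rewrite ?s_off.
have [x0 _ _ _] := trace_zeta_neq0 i; rewrite mul1r mulN1r.
by apply: rmorph_trace_zeta_invert; rewrite ?fmorph_eq0.
Qed.

Lemma rmorph_zeta i j : s i (z j) = (-1) ^+ (i == j) * z j.
Proof. by have [] := rmorph_trace_zeta i j. Qed.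

Lemma rmorph_trace i j : s i (p j) = (-1) ^+ ((i != j) && b i j) * p j.
Proof. by have [] := rmorph_trace_zeta i j. Qed.

Lemma rmorph_zeta_prod i j : s i (m j) = (-1) ^+ ((i != j) && b i j) * m j.
Proof.
rewrite rmorph_prod; have [->|ij] := eqVneq i j.
  rewrite mul1r; apply: eq_bigr => l lj.
  by rewrite rmorphXn rmorph_zeta eq_sym (negPf lj) mul1r.
rewrite (bigD1 i) // [in RHS](bigD1 i) //= mulrA; congr (_ * _).
  by rewrite rmorphXn rmorph_zeta eqxx exprMn -exprM mul1n.
by apply: eq_bigr => l /andP[_ li]; rewrite rmorphXn rmorph_zeta eq_sym (negPf li) mul1r.
Qed.

Lemma rmorph_twist_square i j : s i (twist_square j) = twist_square j.
Proof. by rewrite rmorphXn rmorph_zeta exprMn sqrr_sign mul1r. Qed.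

Lemma rmorph_twist_root i j : s i (twist_root j) = twist_root j.
Proof.
rewrite /twist_root !(rmorphM, fmorphV) rmorph_nat s_base rmorph_trace rmorph_zeta_prod.
by rewrite mulrACA -expr2 sqrr_sign mul1r.
Qed.

Lemma rmorph_invariant i f : f \in invariants -> s i f = f.
Proof.
by rewrite mem_cat => /orP[/codomP[j ->]|/codomP[j ->]];
  [apply: rmorph_twist_square | apply: rmorph_twist_root].
Qed.

Local Notation with_zetas l := (with_list (in_list invariants) [seq z i | i <- l]).

Lemma adjoin_zetas f : adjoin iota (with_zetas (enum I)) f.
Proof.
pose A := with_zetas (enum I).
have Az i : adjoin iota A (z i).
  by apply: adjoin_gen; right; apply: map_f; rewrite mem_enum.
have Ar i : adjoin iota A (twist_root i).
  by apply: adjoin_gen; left; rewrite /in_list mem_cat codom_f orbT.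
apply: adjoin_trans (x_gen f) => _ /codomP[i ->].
have [x0 p0 _ _] := trace_zeta_neq0 i; have m0 := zeta_prod_neq0 i.
have Azi := Az i; have Ari := Ar i.
have Am : adjoin iota A (m i) by apply: adjoin_prod => l _; apply: adjoin_exp.
have Ap : adjoin iota A (p i).
  have -> : p i = 2%:R * iota (a i) / (twist_root i * m i).
    have two0 := two_neq0_ext iota two_neq0.
    have a'0 : iota (a i) != 0 by rewrite fmorph_eq0.
    by rewrite /twist_root; field; rewrite a'0 two0 p0 m0.
  by adjoin_mem.
by rewrite (trace_zeta_root iota two_neq0 p0); adjoin_mem.
Qed.

Lemma fixed_invariants f : (forall i, s i f = f) <-> adjoin iota (in_list invariants) f.
Proof.
split=> [sf|Yf i]; last by apply: fixed_adjoin Yf => // g; apply: rmorph_invariant.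
suff drop l : uniq l -> adjoin iota (with_zetas l) f -> adjoin iota (in_list invariants) f.
  exact: drop (enum_uniq I) (adjoin_zetas f).
elim: l => [_|i l IH /= /andP[il ul] Af].
  by apply: adjoin_mono => g [].
apply: (IH ul); apply: (quadratic_fixed two_neq0 (s := s i) (z := z i)) => //.
- move=> g [/rmorph_invariant//|/mapP[j jl ->]].
  by rewrite rmorph_zeta; have [ij|_] := eqVneq i j; [rewrite ij jl in il | rewrite mul1r].
- by apply: adjoin_gen; left; rewrite /in_list mem_cat codom_f.
- by rewrite rmorph_zeta eqxx mulN1r.
apply: adjoin_mono Af => g; rewrite /with_list inE => -[Yg|/orP[/eqP->|gl]]; first by left; left.
  by right; rewrite mem_head.
by left; right.
Qed.

Lemma invariants_purely_transcendental (ys : seq F) : (size ys <= #|I|)%N ->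
  (forall f, adjoin iota (in_list invariants) f <-> adjoin iota (in_list ys) f) ->
  purely_transcendental iota (adjoin iota (in_list invariants)).
Proof.
move=> ys_le eq_ys; apply: (purely_transcendental_generators x_indep _ _ eq_ys);
  first by rewrite size_codom.
move=> _ /codomP[i ->]; apply: alg_over_twist_square; apply/eq_ys; apply: adjoin_gen.
by rewrite /in_list mem_cat codom_f.
Qed.
End Invariants.

(** * The invariants of three involutions *)

Section Indeterminates.
Variable K : fieldType.
Local Notation ratfun := (ratfun3 K).
Local Notation tofrac := (@FracField.tofrac {mpoly K[3]}).

Lemma indets_algebraically_independent :
  algebraically_independent (const3 K) (fun f => exists i, f = indet K i).
Proof.
move=> n y uy indet_y p p0; have [t tE] := fin_all_exists indet_y.
have t_inj : injective t by move=> i j e; apply: (tuple_uniqP _ uy); rewrite !tE e.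
pose subst : {rmorphism {mpoly K[n]} -> {mpoly K[3]}} := mmap (@mpolyC 3 K) (fun j => 'X_(t j)).
pose back : {rmorphism {mpoly K[3]} -> {mpoly K[n]}} := mmap (@mpolyC n K)
  (fun i => if [pick j | t j == i] is Some j then 'X_j else 0).
have substE : (tofrac \o subst : {rmorphism {mpoly K[n]} -> ratfun}) =1 mmap (const3 K) (tnth y).
  apply: mpoly_morph_ext => [k|i] /=; first by rewrite !mmapC.
  by rewrite !mmapX !mmap1U tE.
have substK : back \o subst =1 id.
  apply: (@mpoly_morph_ext _ _ _ (back \o subst) idfun) => [k|i] /=; first by rewrite !mmapC.
  rewrite !mmapX !mmap1U mmapX mmap1U; case: pickP => [j /eqP/t_inj->//|/(_ i)].
  by rewrite eqxx.
have /eqP : tofrac (subst p) = 0 by rewrite -p0 -substE.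
by rewrite tofrac_eq0 => /eqP subst0; rewrite -(substK p) /= subst0 rmorph0.
Qed.

Lemma indet_inj : injective (indet K).
Proof.
move=> i j /eqP; rewrite tofrac_eq => /eqP/(congr1 (@mlead _ _)); rewrite !mleadXm.
by move=> /(congr1 (fun m : 'X_{1..3} => m i)); rewrite !mnm1E eqxx; case: eqP.
Qed.

Lemma indets_indep : indep_over (const3 K) (@no_element ratfun) (codom (indet K)).
Proof.
apply: (algebraically_independent_indep indets_algebraically_independent).
  by rewrite map_inj_uniq ?enum_uniq //; apply: indet_inj.
by move=> f /codomP.
Qed.

Lemma indets_generate f : adjoin (const3 K) (in_list (codom (indet K))) f.
Proof.
have poly_in (p : {mpoly K[3]}) : adjoin (const3 K) (in_list (codom (indet K))) (tofrac p).
  elim/mpolyind: p => [|k m p _ _ IH]; first by rewrite rmorph0; apply: adjoin0.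
  rewrite rmorphD; apply: adjoin_add => //; rewrite -mul_mpolyC rmorphM.
  apply: adjoin_mul; first exact: adjoin_base.
  rewrite mpolyXE_id rmorph_prod; apply: adjoin_prod => i _; rewrite rmorphXn.
  by apply/adjoin_exp/adjoin_gen/codom_f.
by have [n [d [_ ->]]] := fracP f; apply: adjoin_div.
Qed.

Lemma is_square_const3 k : is_square (const3 K k) -> is_square k.
Proof.
have lead_mul (p q : {mpoly K[3]}) : mleadc (p * q) = mleadc p * mleadc q.
  have [->|p0] := eqVneq p 0; first by rewrite mul0r mleadc0 mul0r.
  have [->|q0] := eqVneq q 0; first by rewrite mulr0 mleadc0 mulr0.
  by apply: mleadcM_proper; rewrite mulf_neq0 ?mleadc_eq0.
move=> [f]; have [n [d [d0 ->]]] := fracP f => e.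
have td0 : tofrac d != 0 by rewrite tofrac_eq0.
have nd : n * n = k%:MP * (d * d).
  apply/eqP; rewrite -tofrac_eq !tofracM -(inj_eq (mulIf (invr_neq0 (mulf_neq0 td0 td0)))).
  by rewrite mulfK ?mulf_neq0 // -[X in _ == X]e expr2 mulf_div.
have lead0 : mleadc d != 0 by rewrite mleadc_eq0.
exists (mleadc n / mleadc d); rewrite expr_div_n expr2 -lead_mul nd !lead_mul mleadcC.
by rewrite -expr2 mulfK ?expf_neq0.
Qed.
End Indeterminates.

Section TwistRationality.
Variables (K F : fieldType) (iota : {rmorphism K -> F}).
Hypothesis two_neq0 : (2%:R : K) != 0.
Hypothesis square_descent : forall k, is_square (iota k) -> is_square k.

Lemma pencil_rational_iff (L : F -> Prop) a b c S u v w : a != 0 -> b != 0 -> c != 0 ->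
  (three_generated iota L -> purely_transcendental iota L) ->
  pencil_presentation iota L a b c S u v w ->
  purely_transcendental iota L <-> square_product a b c.
Proof.
move=> a0 b0 c0 rational pres; split=> [pt|sq]; last first.
  by apply: rational; apply: pencil_rational sq pres.
have [iSuv wE LE] := pres; apply: NNPP => nsq.
apply: (@pencil_nonrational _ _ iota a b c S u v w two_neq0);
  last by apply/(purely_transcendental_eq _ LE).
- move=> [i [j [l [ijl]]]]; rewrite -!rmorphXn -!rmorphM => /square_descent sq.
  by apply: nsq; exists i, j, l.
- by apply: (indep_adjoin iSuv) => //=; do !split; adjoin_mem.
- exact: wE.
Qed.

Variables (b : rel 'I_3) (a : 'I_3 -> K) (Z r : 'I_3 -> F).
Hypothesis sys : twist_system iota b a Z r.
Local Notation L := (adjoin iota (in_list (codom Z ++ codom r))).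
Hypothesis rational : three_generated iota L -> purely_transcendental iota L.

Lemma complete_graph_rational_iff i j l : uniq [:: i; j; l] -> complete_graph b i j l ->
  purely_transcendental iota L <-> square_product (a i) (a j) (a l).
Proof.
move=> u /and5P[ij ji il li /andP[jl lj]]; have [a0 _ _] := sys.
have [Zi Zj Zl] := twist_equations sys u; rewrite ij ji il li jl lj !expr1 in Zi Zj Zl.
have [S [u' [v [w pres]]]] :=
  complete_graph_pencil (a0 i) (a0 j) (a0 l) (twist_indep sys u) Zi Zj Zl.
apply: pencil_rational_iff rational (pencil_presentation_eq _ pres) => // f.
exact: twist_generators.
Qed.

Lemma path_graph_rational_iff i j l : uniq [:: i; j; l] -> path_graph b i j l ->
  purely_transcendental iota L <-> square_product (a i) (a j) (a l).
Proof.
move=> u /and5P[/negPf ij /negPf ji il li /andP[jl lj]]; have [a0 _ _] := sys.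
have [Zi Zj Zl] := twist_equations sys u.
rewrite ij ji il li jl lj !(expr1, expr0, mul1r) in Zi Zj Zl.
have [S [u' [v [w pres]]]] := path_graph_pencil (a0 i) (a0 j) (a0 l) (twist_indep sys u) Zi Zj Zl.
rewrite -(square_product_scale (a0 i) (a0 j) (a0 l)).
apply: pencil_rational_iff rational (pencil_presentation_eq _ pres) => [|||f];
  rewrite ?mulf_neq0 //.
exact: twist_generators.
Qed.

Lemma twist_rational_iff :
  purely_transcendental iota L <-> (exceptional_graph b -> square_product (a 0) (a 1) (a 2)).
Proof.
have [exc|nexc] := boolP (exceptional_graph b); last first.
  by split=> // _; apply/rational/(nonexceptional_three_generated sys).
suff sqE : purely_transcendental iota L <-> square_product (a 0) (a 1) (a 2).
  by rewrite sqE; split=> [sq _|/(_ isT)].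
case/or4P: exc => [complete|path|path|path].
- exact: complete_graph_rational_iff complete.
- exact: path_graph_rational_iff path.
- by rewrite (path_graph_rational_iff _ path) //; split; apply: square_productC23.
rewrite (path_graph_rational_iff _ path) //.
by split=> [/square_productC23/square_productC12|/square_productC12/square_productC23].
Qed.
End TwistRationality.

Lemma forall_ord3 (P : 'I_3 -> Prop) :
  P (@Ordinal 3 0 isT) -> P (@Ordinal 3 1 isT) -> P (@Ordinal 3 2 isT) -> forall i, P i.
Proof.
by move=> P0 P1 P2 -[[|[|[|i]]]] lti //; rewrite (bool_irrelevance lti isT).
Qed.

Lemma fixed_field_ord3 (F : fieldType) (s : 'I_3 -> {rmorphism F -> F}) f :
  fixed_field (automorphism_group (fun t => [\/ t = s 0, t = s 1 | t = s 2])) f <->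
  forall i, s i f = f.
Proof.
rewrite fixed_field_generated; split=> [fixed|fixed _ [->|->|->] //].
apply: forall_ord3; apply: fixed; [apply: Or31 | apply: Or32 | apply: Or33];
  by congr (GRing.RMorphism.sort (s _)); apply: val_inj.
Qed.

Lemma sign_exists (R : pzRingType) (e : R) : e = 1 \/ e = -1 -> exists s : bool, e = (-1) ^+ s.
Proof. by case=> ->; [exists false | exists true]. Qed.

Lemma exceptionalP (K : fieldType) (b : rel 'I_3) : (2%:R : K) != 0 ->
  exceptional ((-1) ^+ b 0 1 : K) ((-1) ^+ b 0 2) ((-1) ^+ b 1 0) ((-1) ^+ b 1 2)
    ((-1) ^+ b 2 0) ((-1) ^+ b 2 1) <-> exceptional_graph b.
Proof.
move=> two0; have one_neqN1 : (1 : K) <> -1.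
  by move=> e; case/eqP: two0; rewrite mulr2n {2}e subrr.
have sign_pos (e : bool) : (-1) ^+ e = 1 :> K -> e = false by case: e => //; rewrite expr1 => /esym.
have sign_neg (e : bool) : (-1) ^+ e = -1 :> K -> e = true by case: e => //; rewrite expr0.
rewrite /exceptional_graph /complete_graph /path_graph; split.
  by case=> -[] => [/sign_pos->/sign_pos->/sign_neg->/sign_neg->[/sign_neg->/sign_neg->]
    |/sign_pos->/sign_pos->/sign_neg->/sign_neg->[/sign_neg->/sign_neg->]
    |/sign_pos->/sign_pos->/sign_neg->/sign_neg->[/sign_neg->/sign_neg->]
    |/sign_neg->/sign_neg->/sign_neg->/sign_neg->[/sign_neg->/sign_neg->]]; rewrite ?orbT.
case/or4P=> /and5P[].
- by move=> -> -> -> -> /andP[-> ->]; constructor 4.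
- by move=> /negPf-> /negPf-> -> -> /andP[-> ->]; constructor 1.
- by move=> /negPf-> /negPf-> -> -> /andP[-> ->]; constructor 2.
- by move=> /negPf-> /negPf-> -> -> /andP[-> ->]; constructor 3.
Qed.

Lemma fixed_field_rational_iff (K : fieldType) (a : 'I_3 -> K) (b : rel 'I_3)
    (s : 'I_3 -> {rmorphism ratfun3 K -> ratfun3 K}) :
  (2%:R : K) != 0 -> (forall i, a i != 0) -> (forall i k, s i (const3 K k) = const3 K k) ->
  (forall i, s i (indet K i) = const3 K (a i) / indet K i) ->
  (forall i j, i != j -> s i (indet K j) = (-1) ^+ b i j * indet K j) ->
  purely_transcendental (const3 K) (fun f => forall i, s i f = f) <->
  (exceptional_graph b -> square_product (a 0) (a 1) (a 2)).
Proof.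
move=> two0 a0 s_base s_diag s_off.
have gen := @indets_generate K; have indep := @indets_indep K.
have inv := fixed_invariants two0 a0 gen indep s_base s_diag s_off.
rewrite (purely_transcendental_eq _ inv).
apply: (twist_rational_iff two0 (@is_square_const3 K)).
  exact: invariants_twist_system.
move=> [y1 [y2 [y3 yE]]].
by apply: (invariants_purely_transcendental two0 a0 indep (ys := [:: y1; y2; y3]));
  rewrite ?card_ord.
Qed.

Theorem theorem8 (K : fieldType) (charK : 2%N \notin [pchar K])
    (a b c : K) (a_neq0 : a != 0) (b_neq0 : b != 0) (c_neq0 : c != 0)
    (e12 e13 e21 e23 e31 e32 : K)
    (e12_sign : e12 = 1 \/ e12 = -1) (e13_sign : e13 = 1 \/ e13 = -1)
    (e21_sign : e21 = 1 \/ e21 = -1) (e23_sign : e23 = 1 \/ e23 = -1)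
    (e31_sign : e31 = 1 \/ e31 = -1) (e32_sign : e32 = 1 \/ e32 = -1)
    (sigma1 sigma2 sigma3 : {rmorphism ratfun3 K -> ratfun3 K})
    (sigma1_aut : is_automorphism_over (const3 K) sigma1)
    (sigma2_aut : is_automorphism_over (const3 K) sigma2)
    (sigma3_aut : is_automorphism_over (const3 K) sigma3)
    (sigma1_x : [/\ sigma1 x1 = const3 K a / x1,
                    sigma1 x2 = const3 K e12 * x2
                  & sigma1 x3 = const3 K e13 * x3])
    (sigma2_x : [/\ sigma2 x1 = const3 K e21 * x1,
                    sigma2 x2 = const3 K b / x2
                  & sigma2 x3 = const3 K e23 * x3])
    (sigma3_x : [/\ sigma3 x1 = const3 K e31 * x1,
                    sigma3 x2 = const3 K e32 * x2
                  & sigma3 x3 = const3 K c / x3]) :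
  let G := automorphism_group
             (fun s => [\/ s = sigma1, s = sigma2 | s = sigma3]) in
  let rational := purely_transcendental (const3 K) (fixed_field G) in
  (~ exceptional e12 e13 e21 e23 e31 e32 -> rational) /\
  (exceptional e12 e13 e21 e23 e31 e32 ->
   forall (L : fieldExtType K) (ra rb rc : L),
     ra ^+ 2 = a%:A -> rb ^+ 2 = b%:A -> rc ^+ 2 = c%:A ->
     (rational <-> (\dim <<1 & [:: ra; rb; rc]>>%VS <= 4)%N)).
Proof.
move=> G rational; have two0 : (2%:R : K) != 0.
  by apply: contraNneq charK => two0; rewrite inE /= two0.
have [b12 ?] := sign_exists e12_sign; have [b13 ?] := sign_exists e13_sign.
have [b21 ?] := sign_exists e21_sign; have [b23 ?] := sign_exists e23_sign.
have [b31 ?] := sign_exists e31_sign; have [b32 ?] := sign_exists e32_sign.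
subst e12 e13 e21 e23 e31 e32; rewrite !rmorph_sign in sigma1_x sigma2_x sigma3_x.
pose signs := [:: [:: false; b12; b13]; [:: b21; false; b23]; [:: b31; b32; false]].
pose b' (i j : 'I_3) := nth false (nth [::] signs i) j.
pose a' (i : 'I_3) := [:: a; b; c]`_i.
pose s (i : 'I_3) := nth sigma1 [:: sigma1; sigma2; sigma3] i.
have ratE : rational <-> (exceptional_graph b' -> square_product a b c).
  rewrite /rational (purely_transcendental_eq _ (fixed_field_ord3 s)).
  apply: (fixed_field_rational_iff (a := a')) => //.
  - exact: forall_ord3.
  - by apply: forall_ord3; [case: sigma1_aut | case: sigma2_aut | case: sigma3_aut].
  - by apply: forall_ord3; [case: sigma1_x | case: sigma2_x | case: sigma3_x].
  - by case: sigma1_x sigma2_x sigma3_x => ? ? ? [? ? ?] [? ? ?]; do 2!apply: forall_ord3.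
have excE := exceptionalP b' two0.
split=> [nexc|exc L ra rb rc ha hb hc]; first by apply/ratE => /excE/nexc.
rewrite (dim_three_sqrt two0 a_neq0 b_neq0 c_neq0 ha hb hc) ratE.
by split=> [|sq _ //]; apply; apply/excE.
Qed.
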